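(* Let $f \in W^{1,1}(\mathbb{R}^n) \cap W^{1,\infty}(\mathbb{R}^n)$ be nonzero. Assume that one of the following conditions is fulfilled: (a) $K\subset\mathbb{R}^n$ is a star body and $q>n$; (b) $K\subset\mathbb{R}^n$ is a bounded star body and $q\in(-\infty,n)\setminus\{0\}$. Then the following limits hold: (i) for any fixed $s\in(0,1)$, $\lim_{p\to\infty}\widetilde{\mathrm V}_q(K,\Pi^{\ast,s}_p f)=\widetilde{\mathrm V}_q(K,\Pi^{\ast,s}_\infty f)$; (ii) $\lim_{p\to\infty}\widetilde{\mathrm V}_q(K,\Pi^{\ast}_p f)=\widetilde{\mathrm V}_q(K,\Pi^{\ast}_\infty f)$; (iii) $\lim_{s\to1^-}\widetilde{\mathrm V}_q(K,\Pi^{\ast,s}_\infty f)=\widetilde{\mathrm V}_q(K,\Pi^{\ast}_\infty f)$.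
   Context: Functions are real valued; $W^{1,p}(\mathbb{R}^n)=\{f\in L^p: |\nabla f|\in L^p\}$, $p\in[1,\infty]$; elements of $W^{1,\infty}(\mathbb{R}^n)$ are identified with their Lipschitz representatives. For a set $K\subset\mathbb{R}^n$ star-shaped with respect to the origin, the gauge function is $\|x\|_K=\inf\{\lambda>0: x\in\lambda K\}\in[0,\infty]$ and the radial function is $\rho_K(x)=\sup\{\lambda>0:\lambda x\in K\}=\|x\|_K^{-1}\in[0,\infty]$, $x\neq0$. $K$ is a star body if $\rho_K$ is strictly positive and continuous on $\mathbb{R}^n\setminus\{0\}$. For $q\in\mathbb{R}\setminus\{0,n\}$ the dual mixed volume is $$\widetilde{\mathrm V}_q(K,L)=\frac1n\int_{\mathbb{S}^{n-1}}\|\xi\|_K^{-n+q}\|\xi\|_L^{-q}\,d\xi .$$ The following sets star-shaped with respect to the origin are defined through their gauge functions (a set with prescribed gauge $\|\cdot\|$ being $\{\xi:\|\xi\|\le 1\}$), for $\xi\in\mathbb{R}^n$, $s\in(0,1)$, $p\in[1,\infty)$: - $\Pi^{\ast,s}_p f$: $\|\xi\|_{\Pi^{\ast,s}_p f}^{ps}=p(1-s)\int_0^\infty t^{-ps-1}\int_{\mathbb{R}^n}|f(x+t\xi)-f(x)|^p\,dx\,dt$; - $\Pi^{\ast}_p f$: $\|\xi\|_{\Pi^\ast_p f}^p=\int_{\mathbb{R}^n}|\langle\nabla f(x),\xi\rangle|^p\,dx$; - $\Pi^{\ast,s}_\infty f$: $\|\xi\|_{\Pi^{\ast,s}_\infty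 f}^{s}=\sup_{(x,t)\in\mathbb{R}^n\times(0,\infty)}t^{-s}|f(x+t\xi)-f(x)|$; - $\Pi^{\ast}_\infty f$: $\|\xi\|_{\Pi^\ast_\infty f}=\operatorname{ess\,sup}_{x\in\mathbb{R}^n}|\langle\nabla f(x),\xi\rangle|$. *)

(* Defs.v *)
From HB Require Import structures.
From mathcomp Require Import all_boot all_order all_algebra.
From mathcomp Require Import all_classical all_reals all_analysis.
From mathcomp Require Import measurable_realfun ess_sup_inf.
Import Order.TTheory GRing.Theory Num.Theory.
Import numFieldNormedType.Exports.

Set Implicit Arguments.
Unset Strict Implicit.
Unset Printing Implicit Defensive.

Local Open Scope classical_set_scope.
Local Open Scope ring_scope.

(* R^n is 'rV[R]_n with the library's topology (that of the sup norm); its    *)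
(* measurable sets are generated by the coordinates, as for n.-tuple R, so    *)
(* they are the Borel sets.                                                   *)
Section rV_measurable.
Context {R : realType} (n : nat).

Definition rV_coord (i : 'I_n) (x : 'rV[R]_n) : R := x ord0 i.

Definition rV_measurable : set (set 'rV[R]_n) := g_sigma_preimage rV_coord.

Let rV_measurable0 : rV_measurable set0.
Proof. exact: sigma_algebra0. Qed.

Let rV_measurableC A : rV_measurable A -> rV_measurable (~` A).
Proof. exact: sigma_algebraC. Qed.

Let rV_measurable_bigcup (F : (set 'rV[R]_n)^nat) :
  (forall i, rV_measurable (F i)) -> rV_measurable (\bigcup_i F i).
Proof. exact: sigma_algebra_bigcup. Qed.

HB.instance Definition _ :=
  @isMeasurable.Build (measure_tuple_display default_measure_display)
    'rV[R]_n rV_measurable rV_measurable0 rV_measurableC rV_measurable_bigcup.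

End rV_measurable.

Section rV_measurable_fun.
Context {R : realType}.

Lemma measurable_rV_coord n (i : 'I_n) :
  measurable_fun [set: 'rV[R]_n] (rV_coord i).
Proof.
move=> _ Y mY; rewrite setTI; apply: sub_sigma_algebra => /=.
rewrite -bigcup_seq/=; exists i => /=; first by rewrite mem_index_enum.
by exists Y => //; rewrite setTI.
Qed.

Lemma measurable_fun_rVP d (T : measurableType d) n (f : T -> 'rV[R]_n) :
  measurable_fun [set: T] f <->
  forall i, measurable_fun [set: T] (rV_coord i \o f).
Proof.
split=> [mf i|mf].
  by apply: (measurableT_comp _ mf); exact: measurable_rV_coord.
suff : g_sigma_preimage (fun i => rV_coord i \o f) `<=` measurable.
  move=> prefS _ A mA; rewrite setTI; apply: prefS.
  by rewrite g_sigma_preimage_comp; exists A => //; rewrite setTI.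
apply: smallest_sub; first exact: sigma_algebra_measurable.
case: n => [|n] in f mf *; first by rewrite big_ord0.
rewrite -bigcup_mkord_ord; apply: bigcup_sub => i Ii.
by move=> A [B mB <-]; exact: mf.
Qed.

Definition rV_cons n (xv : measurableTypeR R * 'rV[R]_n) : 'rV[R]_n.+1 :=
  row_mx (xv.1 : R)%:M xv.2.

Lemma measurable_rV_cons n : measurable_fun setT (@rV_cons n).
Proof.
apply/measurable_fun_rVP => i.
case: (split_ordP (m := 1) i) => j ij.
  rewrite (_ : _ \o _ = fst); first exact: measurable_fst.
  apply/funext => -[x v]; rewrite /= /rV_coord /rV_cons ij.
  by rewrite (@row_mxEl _ 1 1 n) (ord1 j) mxE eqxx mulr1n.
rewrite (_ : _ \o _ = rV_coord j \o snd).
  apply: measurableT_comp; first exact: measurable_rV_coord.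
  exact: measurable_snd.
apply/funext => -[x v]; rewrite /= /rV_coord /rV_cons ij.
by rewrite (@row_mxEr _ 1 1 n).
Qed.

End rV_measurable_fun.

(* Lebesgue measure on R^(n+1) is the product of those on R and R^n. *)
Section lebesgue_rV.
Context {R : realType}.

Section step.
Variables (n : nat) (mu : {sigma_finite_measure set 'rV[R]_n -> \bar R}).

Local Notation prod_mu := (@lebesgue_measure R \x mu)%E.

Definition lebesgue_rV_step : set 'rV[R]_n.+1 -> \bar R :=
  pushforward prod_mu (@rV_cons R n).

HB.instance Definition _ := Measure.copy lebesgue_rV_step
  (measure_function_pushforward__canonical__measure_function_Measure
     prod_mu (@measurable_rV_cons R n)).

Let lebesgue_rV_step_sigma_finite : sigma_finite setT lebesgue_rV_step.
Proof.
have /sigma_finiteP[F [FT ndF Foo]] :=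
  sigma_finiteT (@lebesgue_measure R : {sigma_finite_measure set _ -> \bar R}).
have /sigma_finiteP[G [GT ndG Goo]] := sigma_finiteT mu.
pose g (y : 'rV[R]_n.+1) : measurableTypeR R * 'rV[R]_n :=
  (rV_coord ord0 y, \row_i y ord0 (lift ord0 i)).
have mg : measurable_fun setT g.
  apply/measurable_fun_pairP; split; first exact: measurable_rV_coord.
  apply/measurable_fun_rVP => i.
  rewrite (_ : _ \o _ = rV_coord (lift ord0 i)).
    exact: measurable_rV_coord.
  by apply/funext => y; rewrite /= /rV_coord mxE.
have gK : cancel (@rV_cons R n) g.
  move=> [x v]; rewrite /g /rV_cons /rV_coord; congr pair.
    rewrite (_ : ord0 = lshift n (ord0 : 'I_1)); last exact/val_inj.
    by rewrite (@row_mxEl _ 1 1 n) mxE eqxx mulr1n.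
  apply/rowP => i; rewrite mxE.
  rewrite (_ : lift ord0 i = rshift 1 i); last exact/val_inj.
  by rewrite (@row_mxEr _ 1 1 n).
exists (fun k => g @^-1` (F k `*` G k)).
  apply/seteqP; split=> // y _.
  have [i _ Fi] : (\bigcup_i F i) (g y).1 by rewrite -FT.
  have [j _ Gj] : (\bigcup_i G i) (g y).2 by rewrite -GT.
  exists (maxn i j) => //; split.
  - by move: Fi; exact/subsetPset/ndF/leq_maxl.
  - by move: Gj; exact/subsetPset/ndG/leq_maxr.
move=> k; have [mF Fk] := Foo k; have [mG Gk] := Goo k; split.
  by rewrite -[X in measurable X]setTI; apply: mg => //; exact: measurableX.
rewrite /lebesgue_rV_step /pushforward -comp_preimage.
rewrite (_ : g \o _ = id); last by apply/funext => z /=; rewrite gK.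
by rewrite preimage_id product_measure1E// lte_mul_pinfty// ge0_fin_numE.
Qed.

HB.instance Definition _ := Measure_isSigmaFinite.Build _ _ _ lebesgue_rV_step
  lebesgue_rV_step_sigma_finite.

End step.

Fixpoint lebesgue_rV (n : nat) :
    {sigma_finite_measure set 'rV[R]_n -> \bar R} :=
  match n with
  | 0 => [the {sigma_finite_measure set _ -> \bar R} of
            @dirac _ 'rV[R]_0 0%R R]
  | m.+1 => [the {sigma_finite_measure set _ -> \bar R} of
               lebesgue_rV_step (lebesgue_rV m)]
  end.

End lebesgue_rV.
Arguments lebesgue_rV {R} n.

Section sphere.
Context {R : realType} (n : nat).
Implicit Types x y : 'rV[R]_n.

Definition dotv x y : R := \sum_(i < n) x ord0 i * y ord0 i.

Definition enorm x : R := Num.sqrt (dotv x x).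

Definition unit_sphere : set 'rV[R]_n := [set x | enorm x = 1].

Definition unit_eball : set 'rV[R]_n := [set x | enorm x <= 1].

Definition enormalize x : 'rV[R]_n := (enorm x)^-1 *: x.

Lemma measurable_enorm : measurable_fun setT enorm.
Proof.
have dge0 x : 0 <= dotv x x by apply: sumr_ge0 => i _; rewrite -expr2 sqr_ge0.
rewrite (_ : enorm = fun x => dotv x x `^ 2^-1); last first.
  by apply/funext => x; rewrite powR12_sqrt.
apply: (measurableT_comp (measurable_powR _) _).
apply: measurable_sum => i.
by apply: measurable_funM; exact: measurable_rV_coord.
Qed.

Lemma measurable_enormalize : measurable_fun setT enormalize.
Proof.
apply/measurable_fun_rVP => i.
rewrite (_ : _ \o _ = fun x => enorm x `^ (-1) * rV_coord i x); last first.
  by apply/funext => x; rewrite /= /rV_coord mxE powR_inv1// sqrtr_ge0.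
apply: measurable_funM; last exact: measurable_rV_coord.
by apply: (measurableT_comp (measurable_powR _) _); exact: measurable_enorm.
Qed.

Lemma measurable_unit_eball : measurable unit_eball.
Proof.
rewrite -[unit_eball]setTI (_ : unit_eball = enorm @^-1` `]-oo, 1]).
  by apply: measurable_enorm => //; exact: measurable_itv.
by apply/seteqP; split=> x /=; rewrite in_itv.
Qed.

(* The measure d xi of S^(n-1), as determined by polar coordinates: A has     *)
(* measure n * |{r xi : xi in A, 0 < r <= 1}|. It is a measure on R^n carried *)
(* by the sphere.                                                             *)
Definition surface_measure : set 'rV[R]_n -> \bar R :=
  pushforward (mscale n%:R%:nng (mrestr (lebesgue_rV n) measurable_unit_eball))
    enormalize.

HB.instance Definition _ := Measure.copy surface_measure
  (measure_function_pushforward__canonical__measure_function_Measure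
     (mscale n%:R%:nng (mrestr (lebesgue_rV n) measurable_unit_eball))
     measurable_enormalize).

End sphere.
Arguments unit_sphere {R} n.
Arguments unit_eball {R} n.
Arguments surface_measure {R} n.

(* Powers of x in [0, +oo] with 0 ^ r = +oo and (+oo) ^ r = 0 for r < 0; the  *)
(* library's poweR has 0 `^ r = 0 and +oo `^ r = +oo there.                   *)
Definition epow {R : realType} (x : \bar R) (r : R) : \bar R :=
  if 0 <= r then (x `^ r)%E else ((x `^ (- r))^-1)%E.

Section star_bodies.
Context {R : realType} (n : nat).
Implicit Types (K L : set 'rV[R]_n) (x xi : 'rV[R]_n).

Definition star_shaped K :=
  forall x, K x -> forall t : R, 0 <= t <= 1 -> K (t *: x).

Definition gauge K x : \bar R :=
  ereal_inf [set l%:E | l in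
    [set l : R | 0 < l /\ exists2 y, K y & x = l *: y]].

(* The supremum is taken in [0, +oo]: that of the empty set is 0. *)
Definition radial K x : \bar R :=
  maxe 0%E (ereal_sup [set l%:E | l in [set l : R | 0 < l /\ K (l *: x)]]).

Definition star_body K :=
  star_shaped K /\
  forall x, x != 0 -> (0 < radial K x)%E /\ {for x, continuous (radial K)}.

Definition dual_mixed_volume (q : R) K L : \bar R :=
  ((n%:R^-1)%:E * \int[surface_measure n]_(xi in unit_sphere n)
     (epow (gauge K xi) (- n%:R + q) * epow (gauge L xi) (- q)))%E.

Definition set_of_gauge (g : 'rV[R]_n -> \bar R) : set 'rV[R]_n :=
  [set xi | (g xi <= 1)%E].

End star_bodies.

Section sobolev.
Context {R : realType} (n : nat).
Implicit Types (f phi : 'rV[R]_n -> R) (g : 'rV[R]_n -> 'rV[R]_n).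

Local Notation lambda := (lebesgue_rV n).

Definition basis_vec (i : 'I_n) : 'rV[R]_n := delta_mx ord0 i.

Fixpoint Ck (k : nat) phi : Prop :=
  continuous phi /\
  if k is k'.+1 then
    forall i, (forall x, derivable phi x (basis_vec i)) /\
              Ck k' (fun x => 'D_(basis_vec i) phi x)
  else True.

Definition test_function phi :=
  (forall k, Ck k phi) /\ compact (closure [set x | phi x != 0]).

Definition locally_integrable_rV f :=
  forall A : set 'rV[R]_n, compact A -> lambda.-integrable A (EFin \o f).

Definition is_weak_gradient f g :=
  [/\ locally_integrable_rV f,
      forall i, measurable_fun setT (fun x => g x ord0 i),
      forall i, locally_integrable_rV (fun x => g x ord0 i) &
      forall phi, test_function phi -> forall i,
        \int[lambda]_x (f x * 'D_(basis_vec i) phi x) =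
        - \int[lambda]_x (g x ord0 i * phi x)].

(* A chosen representative of the weak gradient, which is unique a.e. *)
Definition weak_gradient f : 'rV[R]_n -> 'rV[R]_n :=
  xget (fun=> 0) [set g | is_weak_gradient f g].

Definition sobolev (p : \bar R) f :=
  [/\ f \in Lfun lambda p,
      exists g, is_weak_gradient f g &
      (fun x => enorm (weak_gradient f x)) \in Lfun lambda p].

End sobolev.

Section polar_projection_bodies.
Context {R : realType} (n : nat) (f : 'rV[R]_n -> R).
Implicit Types (s p : R) (xi : 'rV[R]_n).

Local Notation lambda := (lebesgue_rV n).

Definition frac_polar_gauge s p xi : \bar R :=
  (((p * (1 - s))%:E *
    \int[lebesgue_measure]_(t in `]0%R, +oo[)
      ((t `^ (- (p * s) - 1))%:E *
       \int[lambda]_x (`|f (x + t *: xi) - f x| `^ p)%:E)) `^ (p * s)^-1)%E.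

Definition polar_gauge p xi : \bar R :=
  ((\int[lambda]_x (`|dotv (weak_gradient f x) xi| `^ p)%:E) `^ p^-1)%E.

Definition frac_polar_gauge_infty s xi : \bar R :=
  (ereal_sup [set (xt.2 `^ (- s) * `|f (xt.1 + xt.2 *: xi) - f xt.1|)%:E
             | xt in [set xt : 'rV[R]_n * R | (0 < xt.2)%R]] `^ s^-1)%E.

Definition polar_gauge_infty xi : \bar R :=
  ess_sup lambda (fun x => `|dotv (weak_gradient f x) xi|%:E).

Definition frac_polar_body s p := set_of_gauge (frac_polar_gauge s p).
Definition polar_body p := set_of_gauge (polar_gauge p).
Definition frac_polar_body_infty s := set_of_gauge (frac_polar_gauge_infty s).
Definition polar_body_infty := set_of_gauge polar_gauge_infty.

End polar_projection_bodies.

(* Main.v *)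
(* The dual mixed volumes are integrals over the sphere of a function of [K]
   times a power of a gauge. If the quotients of the gauges by their limit tend
   to [1] uniformly on the sphere, then each integral lies between multiples
   [1 - d] and [1 + d] of the limit, whether that is finite or not. This leaves
   three statements about gauges, which do not involve [K].

   Let [slope xi] be the supremum of [|f (x + t xi) - f x| / t]. Pairing [f] with
   the translates of a test function, and differentiating along the translation,
   shows that [slope xi] is the essential supremum of [|<grad f, xi>|]. The gauge
   for [s < 1] and [p = +oo] is [M(xi)^(1/s)], where [M(xi)] is the supremum of
   [t^-s |f (x + t xi) - f x|]. Since [f] is Lipschitz, integrable and nonzero,
   it tends to [0] at infinity, hence is bounded, and both suprema are bounded
   below by a positive constant on the sphere.

   Upper bounds are explicit: [M <= slope^s (2 sup|f|)^(1-s)] when [s --> 1],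
   [|<grad f, xi>|^p <= slope^(p-1) |<grad f, xi>|] when [p --> +oo], and similarly
   for the fractional gauges. For the lower bounds, an almost extremal increment
   stays almost extremal, on a set of positive measure, for all directions near
   the given one, and compactness of the sphere makes them uniform. *)

Require Import Defs.
From HB Require Import structures.
From mathcomp Require Import all_boot all_order all_algebra.
From mathcomp Require Import all_classical all_reals all_analysis.
From mathcomp Require Import measurable_realfun ess_sup_inf.
From mathcomp Require Import ring lra.
Import Order.TTheory GRing.Theory Num.Theory.
Import numFieldNormedType.Exports.

Set Implicit Arguments.
Unset Strict Implicit.
Unset Printing Implicit Defensive.

Local Open Scope classical_set_scope.
Local Open Scope ring_scope.

(** * Borel sets and Lebesgue measure on R^n *)

(** The function [f] is never differentiated pointwise. The shift is put on the test function [phi],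
    so that the integral of [f(y) phi(y - r xi)] is differentiable in [r] although [f] is only
    Lipschitz. Its derivative at [0] bounds the pairings of [<grad f, xi>] by the slope; the mean
    value theorem on [[0, t]] bounds the increments of [f] by the essential supremum. The former
    bound concerns smooth functions only. It becomes a pointwise one because indicators of
    measurable sets inside a box are approximated by smooth functions, through Dynkin induction
    starting from boxes. Uniformity in [xi] rests on subadditivity: the slope and its Hoelder
    analogue are subadditive in the direction and small on short vectors, so that moving [xi] has an
    explicit cost. Compactness of the sphere enters as a near-covering property: around each [xi0],
    a neighbourhood and a set of parameters [s] or [p] are exhibited such that the bound holds on
    their product. The fractions of [e] found there share out the total loss. *)

Lemma bigcup_count_measurable d (T : measurableType d) (I : countType)
    (D : set I) (F : I -> set T) :
  (forall i, D i -> measurable (F i)) -> measurable (\bigcup_(i in D) F i).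
Proof.
move=> mF.
rewrite (_ : \bigcup_(i in D) F i =
  \bigcup_(k in [set k | exists2 i, D i & unpickle k = Some i])
    (if unpickle k is Some i then F i else set0)).
  by apply: bigcup_measurable => k [i Di ->]; exact: mF.
apply/seteqP; split=> x [i].
  by move=> Di Fix_; exists (pickle i); [exists i|]; rewrite ?pickleK.
by move=> [j Dj ->]; exists j.
Qed.

Section borel_rV.
Context {R : realType} (n : nat).
Implicit Types (u : 'rV[R]_n -> R) (x y : 'rV[R]_n).

Lemma rV_norm_le x (r : R) : 0 <= r ->
  (`|x| <= r) <-> (forall i, `|x ord0 i| <= r).
Proof.
move=> r0; rewrite [`|x|]mx_normrE; split=> [h i|h].
  by apply: le_trans h; exact: (le_bigmax _ (fun ij => `|x ij.1 ij.2|) (ord0, i)).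
by apply: bigmax_le => // -[i j] _ /=; rewrite ord1.
Qed.

Lemma rV_norm_lt x (r : R) : 0 < r ->
  (`|x| < r) <-> (forall i, `|x ord0 i| < r).
Proof.
move=> r0; rewrite [`|x|]mx_normrE; split=> [h i|h].
  by apply: le_lt_trans h; exact: (le_bigmax _ (fun ij => `|x ij.1 ij.2|) (ord0, i)).
by apply: bigmax_lt => // -[i j] _ /=; rewrite ord1.
Qed.

Lemma rV_coord_le_norm x i : `|x ord0 i| <= `|x|.
Proof. by move: i; apply/rV_norm_le. Qed.

Lemma measurable_rV_box (P : 'I_n -> set R) :
  (forall i, measurable (P i)) ->
  measurable [set x : 'rV[R]_n | forall i, P i (x ord0 i)].
Proof.
move=> mP.
rewrite (_ : [set x | _] = \bigcap_(i in [set: 'I_n]) (rV_coord i @^-1` P i)).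
  apply: fin_bigcap_measurable; first exact: finite_finset.
  move=> i _; rewrite -[X in measurable X]setTI.
  by apply: measurable_rV_coord => //; exact: mP.
by apply/seteqP; split=> x /= h i; [move=> _|]; exact: h.
Qed.

Lemma ball_rVE x (r : R) : 0 < r ->
  ball x r = [set y | forall i, ball (x ord0 i) r (y ord0 i)].
Proof.
move=> r0; apply/seteqP; split=> y.
  rewrite -[in X in X -> _]ball_normE /= => /(rV_norm_lt _ r0) h i.
  by have := h i; rewrite !mxE -ball_normE.
move=> /= h; rewrite -ball_normE /=; apply/(rV_norm_lt _ r0) => i; have := h i.
by rewrite !mxE -ball_normE.
Qed.

Lemma measurable_rV_ball x (r : R) : measurable (ball x r).
Proof.
have [r0|r0] := leP r 0.
  have -> : ball x r = set0; last exact: measurable0.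
  rewrite -ball_normE; apply/seteqP; split=> y //= /lt_le_trans/(_ r0).
  by rewrite normr_lt0.
rewrite ball_rVE//; apply: (@measurable_rV_box (fun i => ball (x ord0 i) r)) => i.
exact: measurable_ball.
Qed.

(** The sigma-algebra is generated by the coordinates, so this needs separability: [U] is the union
    of the countably many balls with rational centre and radius [1 / (k + 1)] that it contains. *)
Lemma open_measurable_rV (U : set 'rV[R]_n) : open U -> measurable U.
Proof.
move=> oU.
pose c (q : 'rV[rat]_n) : 'rV[R]_n := \row_i ratr (q ord0 i).
pose B (qk : 'rV[rat]_n * nat) : set 'rV[R]_n := ball (c qk.1) qk.2.+1%:R^-1.
rewrite (_ : U = \bigcup_(qk in [set qk | B qk `<=` U]) B qk).
  apply: bigcup_count_measurable => qk _; exact: measurable_rV_ball.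
apply/seteqP; split; last by move=> x [qk qkU]; exact: qkU.
move=> x Ux; have [e /= e0 xe] : nbhs_ball x U.
  by apply/nbhs_ballP; apply: open_nbhs_nbhs.
have [k k0] : exists k : nat, k.+1%:R^-1 < e / 2.
  have e2 : 0 < e / 2 by rewrite divr_gt0.
  have [k _ /(_ k (leqnn _))] := near_infty_natSinv_lt (PosNum e2).
  by exists k.
pose d : R := k.+1%:R^-1; have d0 : 0 < d by rewrite invr_gt0.
have qi (i : 'I_n) : exists q : rat, `|ratr q - x ord0 i| < d.
  have xd : x ord0 i - d < x ord0 i + d.
    by rewrite ltrBlDr -addrA ltrDl addr_gt0.
  have [q] := rat_in_itvoo xd.
  by rewrite in_itv/= => qd; exists q; rewrite ltr_distl.
have [q qP] := choice qi.
exists (\row_i q i, k).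
  move=> y; rewrite /B /= => /= cy; apply: xe.
  rewrite -ball_normE /=; move: cy; rewrite -ball_normE /= => cy.
  have xc : `|x - c (\row_i q i)| < d.
    by apply/(rV_norm_lt _ d0) => i; rewrite !mxE distrC.
  rewrite (le_lt_trans (ler_distD (c (\row_i q i)) _ _))//.
  by rewrite (splitr e) ltrD// (lt_trans _ k0).
rewrite /B /= -ball_normE/=; apply/(rV_norm_lt _ d0) => i; rewrite !mxE; exact: qP.
Qed.

Lemma continuous_measurable_rV u : continuous u -> measurable_fun setT u.
Proof.
move=> cu mT; apply: (measurability _ (RGenOInfty.measurableE R)) => //.
move=> _ [_ [r ->] <-]; rewrite setTI.
apply: open_measurable_rV.
move/continuousP : cu; apply.
by rewrite set_itvE; exact: open_gt.
Qed.

Lemma measurable_scalar_add (xi : 'rV[R]_n) :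
  measurable_fun setT (fun tx : measurableTypeR R * 'rV[R]_n =>
    (tx.2 + (tx.1 : R) *: xi : 'rV[R]_n)).
Proof.
apply/measurable_fun_rVP => i; apply: (eq_measurable_fun
  (fun tx : measurableTypeR R * 'rV[R]_n => rV_coord i tx.2 + (tx.1 : R) * xi ord0 i)).
  by move=> tx _; rewrite /= /rV_coord !mxE.
apply: measurable_funD.
  by apply: measurableT_comp; [exact: measurable_rV_coord|exact: measurable_snd].
by apply: measurable_funM => //; exact: measurable_fst.
Qed.

Lemma measurable_addv (v : 'rV[R]_n) :
  measurable_fun setT (fun x : 'rV[R]_n => x + v).
Proof.
apply/measurable_fun_rVP => i; apply: (eq_measurable_fun
  (fun x : 'rV[R]_n => rV_coord i x + v ord0 i)).
  by move=> x _; rewrite /= /rV_coord !mxE.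
by apply: measurable_funD => //; exact: measurable_rV_coord.
Qed.

End borel_rV.

Section lebesgue_rV_theory.
Context {R : realType}.
Local Open Scope ereal_scope.

(** The measure is by definition the image of a product, so this is Tonelli; it drives the induction
    on the dimension below. *)
Lemma ge0_integral_lebesgue_rVS n (F : 'rV[R]_n.+1 -> \bar R) :
  measurable_fun setT F -> (forall x, 0 <= F x) ->
  \int[lebesgue_rV n.+1]_x F x =
  \int[@lebesgue_measure R]_a \int[lebesgue_rV n]_v F (rV_cons (a, v)).
Proof.
move=> mF F0.
transitivity (\int[pushforward (@lebesgue_measure R \x lebesgue_rV n)
    (@rV_cons R n)]_x F x); first by [].
rewrite ge0_integral_pushforward//; last exact: measurable_rV_cons.
rewrite preimage_setT fubini_tonelli1//; last by move=> z; exact: F0.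
by apply: measurableT_comp => //; exact: measurable_rV_cons.
Qed.

(** Uniqueness of Lebesgue measure: the image measure gives each half-open interval its length. *)
Lemma lebesgue_measure_translation (c : R) (A : set (measurableTypeR R)) :
  measurable A ->
  pushforward (@lebesgue_measure R) (fun x : measurableTypeR R => (x + c)%R : measurableTypeR R) A =
  lebesgue_measure A.
Proof.
move=> mA; have mc : measurable_fun setT
    (fun x : measurableTypeR R => (x + c)%R : measurableTypeR R).
  exact: measurable_funD.
pose mu := measure_function_pushforward__canonical__measure_function_Measure
  (@lebesgue_measure R) mc.
rewrite -[LHS]/(mu A); apply/esym/lebesgue_measure_unique => //.
move=> _ [[a b] _ <-].
rewrite [RHS](_ : _ = lebesgue_measure `](a - c)%R, (b - c)%R]%classic).
  rewrite !lebesgue_measure_itv/= !lte_fin ltrD2r.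
  by case: ifPn => // _; rewrite -!EFinB opprB addrA subrK.
rewrite /mu /= /pushforward; congr lebesgue_measure.
by apply/seteqP; split=> x /=; rewrite !in_itv/= ltrBlDr lerBrDr.
Qed.

Lemma ge0_integral_translation1 (c : R) (F : R -> \bar R) :
  measurable_fun setT F -> (forall x, 0 <= F x) ->
  \int[@lebesgue_measure R]_x F (x + c)%R = \int[@lebesgue_measure R]_x F x.
Proof.
move=> mF F0; have mc : measurable_fun setT
    (fun x : measurableTypeR R => (x + c)%R : measurableTypeR R).
  exact: measurable_funD.
rewrite -[LHS](@ge0_integral_pushforward _ _ _ _ _ _ mc lebesgue_measure setT F)//.
apply: eq_measure_integral => A mA _.
exact: lebesgue_measure_translation.
Qed.

Lemma ge0_integral_translation n (v : 'rV[R]_n) (F : 'rV[R]_n -> \bar R) :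
  measurable_fun setT F -> (forall x, 0 <= F x) ->
  \int[lebesgue_rV n]_x F (x + v)%R = \int[lebesgue_rV n]_x F x.
Proof.
elim: n v F => [|n IH] v F mF F0.
  by apply: eq_integral => x _; congr F; apply/rowP; case.
have mFv : measurable_fun setT (fun x : 'rV[R]_n.+1 => F (x + v)%R).
  by apply: measurableT_comp => //; exact: measurable_addv.
rewrite !ge0_integral_lebesgue_rVS//.
pose w : 'rV[R]_n := (\row_i v ord0 (lift ord0 i))%R.
(* A translation splits into one of the first coordinate and one of the remaining row, which Tonelli
   treats separately. *)
have E (a : R) (x : 'rV[R]_n) : (rV_cons ((a : measurableTypeR R), x) + v =
    rV_cons ((a + v ord0 ord0 : R)%R : measurableTypeR R, x + w))%R.
  apply/rowP => i; rewrite mxE /rV_cons/=.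
  case: (split_ordP (m := 1) i) => j ->.
    rewrite !(@row_mxEl _ 1 1 n) (ord1 j) !mxE eqxx !mulr1n.
    by congr (_ + v _ _)%R; exact/val_inj.
  by rewrite !(@row_mxEr _ 1 1 n) !mxE; congr (_ + v _ _)%R; exact/val_inj.
under eq_integral do under eq_integral do rewrite E.
have mc : measurable_fun setT (fun z => F (@rV_cons R n z)).
  by apply: measurableT_comp => //; exact: measurable_rV_cons.
transitivity (\int[@lebesgue_measure R]_a
    \int[lebesgue_rV n]_x F (rV_cons ((a + v ord0 ord0 : R)%R : measurableTypeR R, x))).
  apply: eq_integral => a _.
  have := IH w (fun x => F (rV_cons ((a + v ord0 ord0 : R)%R : measurableTypeR R, x))).
  by apply => //; exact: (measurable_fun_pair2 _ mc).
pose H (a : R) := \int[lebesgue_rV n]_x F (rV_cons (a : measurableTypeR R, x)).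
apply: (ge0_integral_translation1 _ (F := H)) => //.
  exact: (measurable_fun_fubini_tonelli_F (fun z => F (@rV_cons R n z))).
by move=> a; apply: integral_ge0.
Qed.

End lebesgue_rV_theory.

Section lebesgue_rV_box.
Context {R : realType}.
Local Open Scope ereal_scope.

Lemma lebesgue_rV_box n (P : 'I_n -> set R) (c : 'I_n -> R) :
  (forall i, measurable (P i)) ->
  (forall i, lebesgue_measure (P i) = (c i)%:E) ->
  lebesgue_rV n [set x : 'rV[R]_n | forall i, P i (x ord0 i)] =
  (\prod_(i < n) c i)%:E.
Proof.
elim: n P c => [|n IH] P c mP cP.
  rewrite big_ord0 (_ : [set x | _] = setT); first exact: diracT.
  by apply/seteqP; split=> // x _ [].
pose P' i := P (lift ord0 i); pose c' i := c (lift ord0 i).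
have IH' := IH P' c' (fun i => mP _) (fun i => cP _).
rewrite big_ord_recl EFinM -cP -[X in _ * X]IH'.
rewrite -product_measure1E//; last 2 first.
- exact: mP.
- exact: measurable_rV_box (fun i => mP _).
rewrite -[LHS]/(product_measure1 _ _ (@rV_cons R n @^-1` _)).
congr product_measure1; apply/seteqP; split=> -[a x]/=.
  move=> h; split.
    have := h ord0; rewrite /rV_cons/= (_ : ord0 = lshift n (ord0 : 'I_1)).
      by rewrite (@row_mxEl _ 1 1 n) mxE eqxx mulr1n.
    exact/val_inj.
  move=> i; have := h (lift ord0 i).
  rewrite /rV_cons/= {2}(_ : lift ord0 i = rshift 1 i); last exact/val_inj.
  by rewrite (@row_mxEr _ 1 1 n).
move=> [Pa Px] i; rewrite /rV_cons/=.
case: (split_ordP (m := 1) i) => j ij.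
  rewrite ij (@row_mxEl _ 1 1 n) (ord1 j) mxE eqxx mulr1n.
  by move: Pa; congr (P _ _); exact/val_inj.
rewrite ij (@row_mxEr _ 1 1 n).
by move: (Px j); congr (P _ _); exact/val_inj.
Qed.

(** Balls are those of the sup norm, hence cubes of side [2 r]. *)
Lemma lebesgue_rV_ball n (x : 'rV[R]_n) (r : R) : (0 < r)%R ->
  lebesgue_rV n (ball x r) = ((r *+ 2) ^+ n)%:E.
Proof.
move=> r0.
rewrite ball_rVE// (@lebesgue_rV_box _ (fun i => ball (x ord0 i) r) (fun=> r *+ 2)%R).
- by rewrite prodr_const card_ord.
- by move=> i; exact: measurable_ball.
- by move=> i; rewrite lebesgue_measure_ball// ltW.
Qed.

End lebesgue_rV_box.

(* [K] is not assumed measurable, so the integrand of a dual mixed volume need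
   not be. The library defines the integral of an arbitrary nonnegative function
   as a supremum over simple functions, which is enough for monotonicity and
   homogeneity. *)
Section nonmeasurable_integral.
Local Open Scope ereal_scope.
Context d (T : measurableType d) (R : realType) (mu : {measure set T -> \bar R}).
Import HBNNSimple.

Lemma nonneg_le_integral (D : set T) (f g : T -> \bar R) :
  (forall x, D x -> 0 <= f x) -> (forall x, D x -> f x <= g x) ->
  \int[mu]_(x in D) f x <= \int[mu]_(x in D) g x.
Proof.
move=> f0 fg; have g0 x : D x -> 0 <= g x.
  by move=> Dx; rewrite (le_trans (f0 _ Dx))// fg.
rewrite !ge0_integralE//; apply: le_ereal_sup => _ [h hf <-]; exists h => // x.
rewrite (le_trans (hf x))// /patch; case: ifPn => //; rewrite inE; exact: fg.
Qed.

Lemma nonneg_integralZl_le (D : set T) (f : T -> \bar R) (k : R) :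
  (forall x, D x -> 0 <= f x) -> (0 < k)%R ->
  k%:E * \int[mu]_(x in D) f x <= \int[mu]_(x in D) (k%:E * f x).
Proof.
move=> f0 k0; rewrite -lee_pdivlMl//.
rewrite !ge0_integralE//; last first.
  by move=> x Dx; rewrite mule_ge0 ?lee_fin ?(ltW k0) ?f0.
apply: ge_ereal_sup => _ [h hf <-]; rewrite lee_pdivlMl//.
rewrite -sintegralrM; apply: ereal_sup_ubound.
exists (scale_nnsfun h (ltW k0)) => // x.
rewrite /= EFinM; move: (hf x); rewrite /patch; case: ifPn => _ hx.
  by rewrite lee_pmul2l.
by apply: mule_ge0_le0 => //; rewrite lee_fin ltW.
Qed.

(** The missing inequality is the preceding lemma for the factor [k^-1] and the function [k f]. *)
Lemma nonneg_integralZl (D : set T) (f : T -> \bar R) (k : R) :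
  (forall x, D x -> 0 <= f x) -> (0 < k)%R ->
  \int[mu]_(x in D) (k%:E * f x) = k%:E * \int[mu]_(x in D) f x.
Proof.
move=> f0 k0; apply/eqP; rewrite eq_le nonneg_integralZl_le// andbT.
have kf0 x : D x -> 0 <= k%:E * f x.
  by move=> Dx; rewrite mule_ge0 ?lee_fin ?(ltW k0) ?f0.
have ki0 : (0 < k^-1)%R by rewrite invr_gt0.
have := nonneg_integralZl_le kf0 ki0.
rewrite lee_pdivrMl// => /le_trans; apply; rewrite lee_pmul2l//.
apply: nonneg_le_integral => x Dx; last first.
  by rewrite muleA -EFinM mulVf ?gt_eqF// mul1e.
by rewrite muleA -EFinM mulVf ?gt_eqF// mul1e f0.
Qed.

End nonmeasurable_integral.

(** * Convergence of dual mixed volumes *)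

Section ratio.
Local Open Scope ereal_scope.
Context {R : realType}.

(** A multiplicative squeeze also makes sense for [l = +oo]: the lower bound with [d = 1 / 2] then
    forces [u i = +oo] eventually. *)
Lemma cvg_ratio I (F : set_system I) (FF : Filter F) (u : I -> \bar R) (l : \bar R) :
  0 <= l ->
  (forall d : R, (0 < d < 1)%R -> \forall i \near F,
     (1 - d)%:E * l <= u i <= (1 + d)%:E * l) ->
  u i @[i --> F] --> l.
Proof.
move=> + ul; case: l ul => [l| |] // ul; last first.
  move=> _.
  have : \forall i \near F, u i = +oo.
    have h2 : (0 < (2^-1 : R) < 1)%R by lra.
    apply: filterS (ul 2^-1%R h2) => i /andP[+ _].
    rewrite gt0_muley; first by rewrite leye_eq => /eqP.
    by rewrite lte_fin subr_gt0; case/andP: h2.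
  by move=> ?; apply: cvg_near_cst.
rewrite lee_fin => l0.
have fu : \forall i \near F, u i \is a fin_num.
  have h2 : (0 < (2^-1 : R) < 1)%R by lra.
  apply: filterS (ul 2^-1%R h2) => i /andP[h1 h3].
  rewrite fin_real// (lt_le_trans _ h1) ?ltNyr//.
  by rewrite (le_lt_trans h3)// -EFinM ltry.
apply/fine_cvgP; split => //.
apply/cvgrPdist_le => e e0.
(* This ensures [d * l <= e]; dividing by [l + 1] rather than [l] allows [l = 0]. *)
pose d := (Num.min 2^-1 (e / (l + 1)))%R.
have l10 : (0 < l + 1)%R by rewrite ltr_wpDl.
have dd : (0 < d < 1)%R.
  rewrite lt_min invr_gt0 ltr0n/= divr_gt0//=.
  by rewrite gt_min invf_lt1// ltr1n.
have dl : (d * l <= e)%R.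
  have : (d <= e / (l + 1))%R by rewrite ge_min lexx orbT.
  rewrite ler_pdivlMr//; apply: le_trans; rewrite ler_pM2l ?lerDl//.
  by case/andP: dd.
near=> i.
rewrite /=; have : u i \is a fin_num by near: i.
have : (1 - d)%:E * l%:E <= u i <= (1 + d)%:E * l%:E by near: i; exact: ul.
case: (u i) => // r; rewrite -!EFinM !lee_fin /= => /andP[h1 h2] _.
rewrite mulrBl mul1r in h1; rewrite mulrDl mul1r in h2.
by rewrite ler_distl; apply/andP; split; lra.
Unshelve. all: by end_near. Qed.

End ratio.

Section gauges.
Local Open Scope ereal_scope.
Context {R : realType} (n : nat).
Implicit Types (xi : 'rV[R]_n) (g : 'rV[R]_n -> \bar R).

(** By homogeneity, [xi] lies in the dilate by [l] exactly when [g xi <= l], so the gauge is the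
    infimum of the positive reals above [g xi]. *)
Lemma gauge_set_of_gauge g xi : 0 <= g xi ->
  (forall l : R, (0 < l)%R -> g (l^-1 *: xi)%R = (l^-1)%:E * g xi) ->
  gauge (set_of_gauge g) xi = g xi.
Proof.
move=> g0 gZ.
have E : [set l%:E | l in [set l : R | (0 < l)%R /\
    exists2 y, set_of_gauge g y & xi = (l *: y)%R]] =
    [set l%:E | l in [set l : R | (0 < l)%R /\ g xi <= l%:E]].
  congr image; apply/seteqP; split=> l /= [l0 h]; split=> //.
    case: h => y gy xiE; move: gy; rewrite /set_of_gauge /=.
    have -> : y = (l^-1 *: xi)%R by rewrite xiE scalerA mulVf ?gt_eqF// scale1r.
    by rewrite gZ// lee_pdivrMl// mule1.
  exists (l^-1 *: xi)%R; last by rewrite scalerA mulfV ?gt_eqF// scale1r.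
  by rewrite /set_of_gauge /= gZ// lee_pdivrMl// mule1.
rewrite /gauge E; apply/eqP; rewrite eq_le; apply/andP; split; last first.
  by apply: le_ereal_inf_tmp => _ [l [l0 gl] <-].
move: g0; case gxi: (g xi) => [r| |] //; last by move=> _; exact: leey.
(* Only positive [l] compete, so for [g xi = 0] the infimum is not attained; hence the detour
   through [r + e]. *)
rewrite lee_fin => r0; apply/lee_addgt0Pr => e e0.
apply: ereal_inf_lbound; exists (r + e)%R => //; split.
  by rewrite ltr_wpDl.
by rewrite lee_fin lerDl ltW.
Qed.

Lemma epow_EFin (x r : R) : (0 < x)%R -> epow x%:E r = (x `^ r)%:E.
Proof.
move=> x0; rewrite /epow; case: ifPn => r0; first by rewrite poweR_EFin.
by rewrite poweR_EFin inver gt_eqF ?powR_gt0// powRN invrK.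
Qed.

Lemma epow_ge0 (x : \bar R) r : 0 <= epow x r.
Proof.
rewrite /epow; case: ifPn => _; first exact: poweR_ge0.
by rewrite inve_ge0 poweR_ge0.
Qed.

Lemma dual_mixed_volume_cvg I (F : set_system I) (FF : Filter F) (q : R)
    (K : set 'rV[R]_n) (L_ : I -> set 'rV[R]_n) (L : set 'rV[R]_n) :
  (forall xi, unit_sphere n xi -> 0 < gauge L xi < +oo) ->
  (forall e : R, (0 < e < 1)%R -> \forall i \near F, forall xi,
    unit_sphere n xi ->
    (1 - e)%:E * gauge L xi <= gauge (L_ i) xi <= (1 + e)%:E * gauge L xi) ->
  dual_mixed_volume q K (L_ i) @[i --> F] --> dual_mixed_volume q K L.
Proof.
move=> L0 LL; apply: cvg_ratio => //.
  rewrite /dual_mixed_volume mule_ge0 ?lee_fin ?invr_ge0//.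
  by apply: integral_ge0 => xi _; rewrite mule_ge0 ?epow_ge0.
move=> d d01.
(* Continuity of [z ^ (- q)] at [1] converts a tolerance [d] on the power into a tolerance [e] on
   the quotient of the gauges, whatever the sign of [q]. Keeping [e < 1] makes the gauges of [L_ i]
   positive. *)
have [e e01 he] : exists2 e : R, (0 < e < 1)%R &
    forall z : R, (1 - e <= z <= 1 + e -> 1 - d <= z `^ (- q) <= 1 + d)%R.
  have cq : {for 1%R, continuous (fun z : R => z `^ (- q))}%R.
    apply/differentiable_continuous/derivable1_diffP.
    by apply: derivable_powR; rewrite in_itv/= andbT.
  have /cvgrPdist_le/(_ d) := cq; rewrite powR1.
  have /andP[d0 d1] := d01 => /(_ d0)/nbhs_ballP[e /= e0 eP].
  exists (Num.min (e / 2) 2^-1)%R; first by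
    rewrite lt_min divr_gt0//= invr_gt0 ltr0n/= gt_min; apply/orP; right; lra.
  move=> z; rewrite -ler_distlC => hz.
  rewrite -ler_distl distrC; apply: eP; rewrite -ball_normE /=.
  rewrite (le_lt_trans hz)// gt_min; apply/orP; left; lra.
apply: filterS (LL e e01) => i hi.
have hw xi : unit_sphere n xi ->
    ((1 - d)%:E * epow (gauge L xi) (- q) <= epow (gauge (L_ i) xi) (- q)
     <= (1 + d)%:E * epow (gauge L xi) (- q)).
  move=> Sxi; have /andP[] := L0 xi Sxi; have /andP[] := hi xi Sxi.
  case: (gauge L xi) => [g| |] //; case: (gauge (L_ i) xi) => [gi| |] //.
  rewrite -!EFinM !lee_fin lte_fin => h1 h2 g0 _.
  have z1 : (1 - e <= gi / g <= 1 + e)%R by rewrite ler_pdivlMr// ler_pdivrMr// h1.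
  have gi0 : (0 < gi)%R.
    by rewrite (lt_le_trans _ h1)// mulr_gt0// subr_gt0; case/andP: e01.
  rewrite !epow_EFin// -!EFinM !lee_fin.
  have -> : (gi `^ (- q) = (gi / g) `^ (- q) * g `^ (- q))%R.
    by rewrite -powRM ?divr_ge0 ?ltW// divfK ?gt_eqF.
  by have /andP[? ?] := he _ z1; rewrite !ler_pM2r ?powR_gt0//; apply/andP.
have /andP[d0 d1] := d01.
rewrite /dual_mixed_volume !(muleCA _ (n%:R^-1)%:E).
have D1 : (0 < 1 - d)%R by rewrite subr_gt0.
have D2 : (0 < 1 + d)%R by rewrite addr_gt0.
rewrite -(nonneg_integralZl _ _ D1); last first.
  by move=> xi _; rewrite mule_ge0 ?epow_ge0.
rewrite -(nonneg_integralZl _ _ D2); last first.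
  by move=> xi _; rewrite mule_ge0 ?epow_ge0.
apply/andP; split; apply: lee_wpmul2l; rewrite ?lee_fin ?invr_ge0//;
  apply: nonneg_le_integral => xi Sxi.
- by rewrite !mule_ge0 ?epow_ge0// lee_fin subr_ge0 ltW.
- rewrite muleCA lee_wpmul2l ?epow_ge0//.
  by have /andP[] := hw xi Sxi.
- by rewrite !mule_ge0 ?epow_ge0.
- rewrite [leRHS]muleCA lee_wpmul2l ?epow_ge0//.
  by have /andP[] := hw xi Sxi.
Qed.

End gauges.

(** * Smooth bump functions *)

Section flat_exp.
Context {R : realType}.
Implicit Types (m : nat) (t : R).

(* The powers of [t^-1] make the family closed under differentiation. *)
Definition flat_exp m t : R := if 0 < t then t^-1 ^+ m * expR (- t^-1) else 0.

Lemma flat_exp_ge0 m t : 0 <= flat_exp m t.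
Proof.
rewrite /flat_exp; case: ifPn => // t0.
by rewrite mulr_ge0 ?expR_ge0// exprn_ge0// invr_ge0 ltW.
Qed.

(** One term of the exponential series, [u ^ (m + 2) / (m + 2)!] at [u = t^-1], is a lower bound of
    [expR u]. The order is chosen to leave a factor [t ^ 2], which kills the difference quotient at
    [0]. *)
Lemma flat_exp_le m t : flat_exp m t <= (m.+2)`!%:R * t ^+ 2.
Proof.
rewrite /flat_exp; case: ifPn => t0; last by rewrite mulr_ge0 ?sqr_ge0.
have u0 : 0 <= t^-1 by rewrite invr_ge0 ltW.
have := expR_ge1Dxn m.+1 u0.
set F : R := (m.+2)`!%:R; have F0 : 0 < F by rewrite ltr0n fact_gt0.
move=> h; have {}h : t^-1 ^+ m.+2 / F <= expR t^-1 by rewrite (le_trans _ h)// lerDr.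
rewrite expRN.
have h2 : (expR t^-1)^-1 <= (t^-1 ^+ m.+2 / F)^-1.
  by rewrite lef_pV2// posrE ?expR_gt0// divr_gt0// exprn_gt0// invr_gt0.
have tm0 : 0 <= t^-1 ^+ m by rewrite exprn_ge0.
apply: le_trans (ler_wpM2l tm0 h2) _.
rewrite invf_div mulrCA ler_pM2l// -addn2 exprD invfM mulrA mulfV; last first.
  by rewrite expf_neq0// invr_neq0// gt_eqF.
by rewrite mul1r exprVn invrK.
Qed.

Lemma is_derive_flat_exp m t :
  is_derive t 1 (flat_exp m)
    (- m%:R * flat_exp m.+1 t + flat_exp m.+2 t).
Proof.
have [t0|t0|->] := ltgtP t 0.
- rewrite /flat_exp !ltNge (ltW t0)/= mulr0 addr0.
  apply: (@near_eq_is_derive _ _ _ (cst 0)).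
    near=> s; rewrite /flat_exp ltNge.
    suff -> : s <= 0 by [].
    by apply/ltW; near: s; exact: lt_nbhsl.
- have tn0 : t != 0 by rewrite gt_eqF.
  have H1 : is_derive t 1 (@GRing.inv R) (- (t ^- 2)).
    apply: DeriveDef; first exact: derivableV.
    by rewrite (@deriveV _ _ id)// derive_id [LHS]mulr1.
  have H2 : is_derive t 1 (expR \o (fun x : R => - x^-1)) (expR (- t^-1) * t ^- 2).
    apply: is_derive1_comp.
    by rewrite -[X in is_derive _ _ _ X]opprK; exact: is_deriveN.
  apply: (@near_eq_is_derive _ _ _
    ((@GRing.inv R ^+ m) * (expR \o (fun x : R => - x^-1)))).
    near=> s; rewrite /flat_exp; have -> : 0 < s by near: s; exact: lt_nbhsr.
    by rewrite [LHS]/= /GRing.mul/=; congr (_ * _); rewrite fctE.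
  have H3 := is_deriveM (is_deriveX m H1) H2.
  apply: (is_derive_eq H3); rewrite /flat_exp t0 /GRing.scale/= fctE.
  rewrite -!exprVn; move: t^-1 (expR _) => u e {H1 H2 H3}.
  case: m => [|m]; first by rewrite !expr0 /=; ring.
  by rewrite [m.+1.-1]/= !exprS; move: (u ^+ m) => w; ring.
- rewrite /flat_exp ltxx mulr0 addr0.
  (* At the junction the quotient is at most a constant times [|h|], by the quadratic bound. *)
  have C : h^-1 *: (flat_exp m (h *: 1 + 0) - flat_exp m 0) @[h --> 0^'] --> (0 : R).
    have C0 : 0 < (m.+2)`!%:R :> R by rewrite ltr0n fact_gt0.
    apply/cvgrPdist_le => e e0; near=> h.
    have hn0 : h != 0 by near: h; exact: nbhs_dnbhs_neq.
    rewrite sub0r normrN /GRing.scale/= mulr1 addr0 {2}/flat_exp ltxx subr0.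
    rewrite normrM (ger0_norm (flat_exp_ge0 _ _)) normfV.
    have h0 : 0 < `|h| by rewrite normr_gt0.
    rewrite ler_pdivrMl// (le_trans (flat_exp_le _ _))// -real_normK ?num_real//.
    rewrite expr2 mulrCA ler_pM2l// mulrC -ler_pdivlMr//.
    by near: h; apply: dnbhs0_le; rewrite divr_gt0.
  apply: DeriveDef; first by apply/cvg_ex; exists 0.
  exact/cvg_lim.
Unshelve. all: by end_near. Qed.

End flat_exp.

Section Ck_theory.
Context {R : realType} {n : nat}.
Implicit Types (phi psi : 'rV[R]_n -> R) (x v : 'rV[R]_n).

Lemma is_derive_line phi x v (d : R) :
  is_derive (0 : R) (1 : R) (fun h : R => phi (h *: v + x)) d ->
  is_derive x v phi d.
Proof.
move=> [dl <-].
have E : (fun h : R => h^-1 *: ((phi \o shift x) (h *: v) - phi x)) =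
    (fun h : R => h^-1 *: (((fun h : R => phi (h *: v + x)) \o shift 0) (h *: 1)
      - phi (0 *: v + x))).
  by apply/funext => h /=; rewrite addr0 [h *: 1]mulr1 scale0r add0r.
by apply: DeriveDef; rewrite /derivable /derive E.
Qed.

Lemma CkW k phi : Ck k.+1 phi -> Ck k phi.
Proof.
elim: k phi => [phi []//|k IH phi [cphi dphi]]; split=> // i.
by have [d1 d2] := dphi i; split=> //; exact: IH.
Qed.

Lemma Ck_cst k (c : R) : Ck k (fun _ : 'rV[R]_n => c).
Proof.
elim: k c => [|k IH] c; split; try exact: cst_continuous.
  by [].
move=> i; split; first by move=> x; exact: derivable_cst.
rewrite [X in Ck k X](_ : _ = fun=> 0); first exact: IH.
by apply/funext => x; rewrite derive_cst.
Qed.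

Lemma CkD k phi psi : Ck k phi -> Ck k psi -> Ck k (fun x => phi x + psi x).
Proof.
elim: k phi psi => [|k IH] phi psi [c1 d1] [c2 d2].
  by split=> // x; apply: continuousD; [exact: c1|exact: c2].
split=> [x|i]; first by apply: continuousD; [exact: c1|exact: c2].
have [p1 k1] := d1 i; have [p2 k2] := d2 i.
split; first by move=> x; exact: derivableD.
rewrite [X in Ck _ X](_ : _ = fun x => 'D_(basis_vec i) phi x + 'D_(basis_vec i) psi x).
  exact: IH.
by apply/funext => x; rewrite -deriveD.
Qed.

Lemma CkM k phi psi : Ck k phi -> Ck k psi -> Ck k (fun x => phi x * psi x).
Proof.
elim: k phi psi => [|k IH] phi psi h1 h2; have [c1 d1] := h1; have [c2 d2] := h2.
  by split=> // x; apply: continuousM; [exact: c1|exact: c2].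
split=> [x|i]; first by apply: continuousM; [exact: c1|exact: c2].
have [p1 k1] := d1 i; have [p2 k2] := d2 i.
split; first by move=> x; exact: derivableM.
rewrite [X in Ck _ X](_ : _ = fun x => phi x * 'D_(basis_vec i) psi x +
    psi x * 'D_(basis_vec i) phi x).
  by apply: CkD; apply: IH => //; exact: CkW.
by apply/funext => x; rewrite -[LHS]/('D_(basis_vec i) (phi * psi) x) deriveM.
Qed.

Lemma CkZ k (c : R) phi : Ck k phi -> Ck k (fun x => c * phi x).
Proof. by move=> h; apply: CkM => //; exact: Ck_cst. Qed.

Lemma Ck_prod k I (s : seq I) (phi : I -> 'rV[R]_n -> R) :
  (forall i, Ck k (phi i)) -> Ck k (fun x => \prod_(i <- s) phi i x).
Proof.
move=> h; elim: s => [|i s IH].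
  by rewrite [X in Ck _ X](_ : _ = fun=> 1); [exact: Ck_cst|apply/funext => x; rewrite big_nil].
rewrite [X in Ck _ X](_ : _ = fun x => phi i x * \prod_(j <- s) phi j x).
  exact: CkM.
by apply/funext => x; rewrite big_cons.
Qed.

Definition flat_coord m (a b : R) (i : 'I_n) : 'rV[R]_n -> R :=
  fun x => flat_exp m (a * x ord0 i + b).

Lemma is_derive_flat_coord m a b i x v :
  is_derive x v (flat_coord m a b i)
    (a * v ord0 i * (- m%:R * flat_coord m.+1 a b i x + flat_coord m.+2 a b i x)).
Proof.
apply: is_derive_line; rewrite /flat_coord mulrC.
rewrite (_ : (fun h : R => _) = flat_exp m \o
    (fun h : R => (a * v ord0 i) * h + (a * x ord0 i + b))); last first.
  by apply/funext => h /=; rewrite !mxE; congr flat_exp; ring.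
apply: is_derive1_comp.
  by rewrite mulr0 add0r; exact: is_derive_flat_exp.
have := is_deriveD (is_deriveZ (a * v ord0 i) (is_derive_id (0 : R) (1 : R)))
  (is_derive_cst (a * x ord0 i + b) (0 : R) (1 : R)).
by rewrite addr0 /GRing.scale/= mulr1; exact.
Qed.

Lemma differentiable_flat_coord m a b i x : differentiable (flat_coord m a b i) x.
Proof.
have -> : flat_coord m a b i = flat_exp m \o (fun x => a * x ord0 i + b) by [].
apply: differentiable_comp; last first.
  by apply/derivable1_diffP; have [] := is_derive_flat_exp m (a * x ord0 i + b).
apply: differentiableD; last exact: differentiable_cst.
apply: (@differentiableZ _ _ _ (fun x : 'rV[R]_n => x ord0 i)).
exact: differentiable_coord.
Qed.

(** Induction on [k] for all [m] at once, since a partial derivative combines the indices [m + 1]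
    and [m + 2]. *)
Lemma Ck_flat_coord k m a b i : Ck k (flat_coord m a b i).
Proof.
elim: k m => [|k IH] m.
  by split=> // x; exact/differentiable_continuous/differentiable_flat_coord.
split; first by move=> x; exact/differentiable_continuous/differentiable_flat_coord.
move=> j; split; first by move=> x; have [] := is_derive_flat_coord m a b i x (basis_vec j).
rewrite [X in Ck _ X](_ : _ = fun x => (a * basis_vec j ord0 i) *
    (- m%:R * flat_coord m.+1 a b i x + flat_coord m.+2 a b i x)).
  by apply: CkZ; apply: CkD; [apply: CkZ|]; exact: IH.
by apply/funext => x; have [_ ->] := is_derive_flat_coord m a b i x (basis_vec j).
Qed.

End Ck_theory.

Section test_functions.
Context {R : realType} {n : nat}.
Implicit Types (phi psi u : 'rV[R]_n -> R) (x v : 'rV[R]_n).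

Lemma compact_closure_bounded (A : set 'rV[R]_n) (M : R) :
  (forall x, A x -> `|x| <= M) -> compact (closure A).
Proof.
move=> AM; apply: bounded_closed_compact; last exact: closed_closure.
have cB := @closed_closed_ball_ R 'rV[R]_n 0 M.
exists M; split; first exact: num_real.
move=> y My x /= clx; rewrite (le_trans _ (ltW My))//.
suff : closed_ball_ Num.norm (0 : 'rV[R]_n) M x by rewrite /closed_ball_/= sub0r normrN.
apply: cB; apply: closure_subset clx => z Az.
by rewrite /closed_ball_/= sub0r normrN AM.
Qed.

Lemma bounded_support_integrable u (C M : R) :
  measurable_fun setT u -> (forall x, `|u x| <= C) ->
  (forall x, M < `|x| -> u x = 0) ->
  (lebesgue_rV n).-integrable setT (EFin \o u).
Proof.
move=> mu uC uM.
pose r : R := `|M| + 1; have r0 : 0 < r by rewrite ltr_wpDl.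
have mB : measurable (ball (0 : 'rV[R]_n) r) by exact: measurable_rV_ball.
have mBoo : (lebesgue_rV n (ball (0%R : 'rV[R]_n) r) < +oo)%E.
  by rewrite lebesgue_rV_ball// ltry.
have uE : u = u \_ (ball (0 : 'rV[R]_n) r).
  apply/funext => x; rewrite /patch; case: ifPn => // /negP.
  rewrite inE -ball_normE /= sub0r normrN => /negP; rewrite -leNgt => rx.
  by apply: uM; rewrite (lt_le_trans _ rx)// (le_lt_trans (ler_norm _))// ltrDl.
rewrite uE -restrict_EFin; apply/(integrable_mkcond _ mB).
apply: measurable_bounded_integrable => //.
- exact: measurable_funTS.
- exists C; split; first exact: num_real.
  by move=> y Cy x _ /=; rewrite (le_trans (uC x))// ltW.
Qed.

(** Vanishing is stated near [x], not just at [x], so that the partial derivatives vanish there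
    too. *)
Lemma test_function_bounded_support phi : test_function phi ->
  exists M : R, forall x, M < `|x| -> \forall y \near x, phi y = 0.
Proof.
move=> [_ cK]; have [M [_ hM]] := compact_bounded cK.
exists (M + 1) => x Mx.
have nK : ~ closure [set x | phi x != 0] x.
  have M1 : M < M + 1 by rewrite ltrDl.
  by move=> /(hM _ M1) /=; rewrite leNgt Mx.
have := open_nbhs_nbhs (conj (closed_openC (@closed_closure _ _)) nK).
apply: filterS => y /= ny; apply/eqP; apply: contrapT => /negP y0.
by apply: ny; exact: subset_closure.
Qed.

Lemma test_function_continuous phi : test_function phi -> continuous phi.
Proof. by move=> [/(_ 0%N)[]]. Qed.

Lemma test_function_partial_continuous phi i : test_function phi ->
  continuous (fun x => 'D_(basis_vec i) phi x).
Proof. by move=> [/(_ 1%N)[_ /(_ i)[_ []]]]. Qed.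

Lemma continuous_bounded u (M : R) : continuous u ->
  (forall x, M < `|x| -> u x = 0) -> exists2 C, 0 <= C & forall x, `|u x| <= C.
Proof.
move=> cu uM.
have cB : compact (closed_ball_ Num.norm (0 : 'rV[R]_n) M).
  apply: bounded_closed_compact; last exact: closed_closed_ball_.
  exists M; split; first exact: num_real.
  move=> y My x; rewrite /closed_ball_ /= sub0r normrN => /le_trans; apply.
  exact: ltW.
have cwu : {within closed_ball_ Num.norm (0 : 'rV[R]_n) M, continuous u}.
  exact: continuous_subspaceT.
have [C [_ hC]] := compact_bounded (continuous_compact cwu cB).
exists (`|C| + 1) => [|x]; first by rewrite addr_ge0.
have [xM|xM] := leP `|x| M; last by rewrite uM// normr0 addr_ge0.
apply: (hC (`|C| + 1)); first by rewrite (le_lt_trans (ler_norm _))// ltrDl.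
by exists x => //; rewrite /closed_ball_/= sub0r normrN.
Qed.

Lemma test_function_bounded phi : test_function phi ->
  exists2 C, 0 <= C & forall x, `|phi x| <= C.
Proof.
move=> tphi; have [M hM] := test_function_bounded_support tphi.
apply: (@continuous_bounded _ M); first exact: test_function_continuous.
by move=> x /hM/nbhs_singleton.
Qed.

Lemma test_function_partial_bounded phi i : test_function phi ->
  exists2 C, 0 <= C & forall x, `|'D_(basis_vec i) phi x| <= C.
Proof.
move=> tphi; have [M hM] := test_function_bounded_support tphi.
apply: (@continuous_bounded _ M); first exact: test_function_partial_continuous.
move=> x /hM h; rewrite (@near_eq_derive _ _ _ _ (cst 0)) ?derive_cst//.
Qed.

Lemma test_function_integrable phi : test_function phi ->
  (lebesgue_rV n).-integrable setT (EFin \o phi).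
Proof.
move=> tphi; have [M hM] := test_function_bounded_support tphi.
have [C _ hC] := test_function_bounded tphi.
apply: (bounded_support_integrable (C := C) (M := M)) => //.
  by apply: continuous_measurable_rV; exact: test_function_continuous.
by move=> x /hM/nbhs_singleton.
Qed.

(* [Ck] only speaks of partial derivatives along the basis; differentiability
   is what gives the derivative along an arbitrary direction. *)
Definition smooth_cs phi := test_function phi /\ forall x, differentiable phi x.

Lemma smooth_csZD (c : R) phi psi : smooth_cs phi -> smooth_cs psi ->
  smooth_cs (fun x => c * phi x + psi x).
Proof.
move=> [t1 d1] [t2 d2]; split; last first.
  move=> x; apply: differentiableD => //.
  by apply: (@differentiableZ _ _ _ phi).
split.
  move=> k; apply: CkD; last by case: t2.
  by apply: CkZ; case: t1.
have [M1 h1] := test_function_bounded_support t1.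
have [M2 h2] := test_function_bounded_support t2.
apply: (@compact_closure_bounded _ (Num.max M1 M2)) => x /=.
rewrite leNgt; apply: contra; rewrite gt_max => /andP[m1 m2].
rewrite (nbhs_singleton (h1 _ m1)) (nbhs_singleton (h2 _ m2)).
by rewrite mulr0 addr0.
Qed.

Lemma smooth_cs0 : smooth_cs (fun=> 0).
Proof.
split; last by move=> x; exact: differentiable_cst.
split; first by move=> k; exact: Ck_cst.
by apply: (@compact_closure_bounded _ 0) => x /=; rewrite eqxx.
Qed.

(** A smooth function between [0] and [1] which, for [k > 0], is positive exactly on the open box.
    With [k = 1] it localises around a point; as [k] grows it tends to the indicator of the box. *)
Definition bump (k : R) (a b : 'rV[R]_n) : 'rV[R]_n -> R := fun x =>
  \prod_(i < n) (flat_coord 0 k (- (k * a ord0 i)) i x *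
                 flat_coord 0 (- k) (k * b ord0 i) i x).

Definition open_box (a b : 'rV[R]_n) : set 'rV[R]_n :=
  [set x | forall i, x ord0 i \in `]a ord0 i, b ord0 i[].

Lemma open_box_norm a b x : open_box a b x -> `|x| <= `|a| + `|b|.
Proof.
move=> xab; apply/rV_norm_le; first by rewrite addr_ge0.
move=> i; have := xab i; rewrite in_itv/= => /andP[ax xb].
have := rV_coord_le_norm a i; have := rV_coord_le_norm b i.
rewrite !ler_norml => /andP[h1 h2] /andP[h3 h4].
have := normr_ge0 a; have := normr_ge0 b => h5 h6.
by apply/andP; split; lra.
Qed.

Lemma flat_exp0_le1 (t : R) : flat_exp 0 t <= 1.
Proof.
rewrite /flat_exp; case: ifPn => // t0; rewrite expr0 mul1r.
by rewrite -expR0 ler_expR oppr_le0 invr_ge0 ltW.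
Qed.

Lemma flat_exp0_gt0 (t : R) : 0 < t -> 0 < flat_exp 0 t.
Proof. by move=> t0; rewrite /flat_exp t0 expr0 mul1r expR_gt0. Qed.

Lemma bumpE k a b x : bump k a b x =
  \prod_(i < n) (flat_exp 0 (k * (x ord0 i - a ord0 i)) *
                 flat_exp 0 (k * (b ord0 i - x ord0 i))).
Proof.
apply: eq_bigr => i _; rewrite /flat_coord.
by congr (flat_exp _ _ * flat_exp _ _); ring.
Qed.

Lemma bump_ge0 k a b x : 0 <= bump k a b x.
Proof. by apply: prodr_ge0 => i _; rewrite mulr_ge0// flat_exp_ge0. Qed.

Lemma bump_le1 k a b x : bump k a b x <= 1.
Proof.
apply: prodr_ile1 => i _; rewrite mulr_ge0 ?flat_exp_ge0//=.
by rewrite mulr_ile1 ?flat_exp_ge0 ?flat_exp0_le1.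
Qed.

Lemma bump_gt0 k a b x : 0 < k -> open_box a b x -> 0 < bump k a b x.
Proof.
move=> k0 h; rewrite bumpE; apply: prodr_gt0 => i _.
have := h i; rewrite in_itv/= => /andP[ax xb].
by rewrite mulr_gt0// flat_exp0_gt0// mulr_gt0// subr_gt0.
Qed.

Lemma bump_eq0 k a b x : 0 < k -> ~ open_box a b x -> bump k a b x = 0.
Proof.
move=> k0 /existsNP[i]; rewrite in_itv/= => h.
rewrite bumpE (bigD1 i)//= /flat_exp !pmulr_rgt0// !subr_gt0.
case: ifPn => ax; last by rewrite !mul0r.
case: ifPn => xb; last by rewrite mulr0 mul0r.
by exfalso; apply: h; rewrite ax.
Qed.

Lemma bump_cvg a b x :
  bump m.+1%:R a b x @[m --> \oo] --> (\1_(open_box a b) x : R).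
Proof.
have [xab|xab] := pselect (open_box a b x); last first.
  rewrite indicE memNset//; apply: cvg_near_cst; apply: nearW => m.
  by rewrite bump_eq0.
rewrite indicE mem_set// [true%:R]mulr1n.
have c1 (c : R) : 0 < c -> flat_exp 0 (m.+1%:R * c) @[m --> \oo] --> (1 : R).
  move=> c0; rewrite [X in X @ _ --> _](_ : _ = fun m => expR (- (c^-1 * harmonic m))).
    rewrite -expR0 -oppr0 -(mulr0 c^-1).
    apply: continuous_cvg; first exact: continuous_expR.
    by apply: cvgN; apply: cvgM; [exact: cvg_cst|exact: cvg_harmonic].
  apply/funext => m; rewrite /flat_exp mulr_gt0// expr0 mul1r.
  by rewrite /harmonic/= invfM mulrC.
under eq_cvg do rewrite bumpE.
have := @cvg_big R _ *%R 1 xpredT (@mul_continuous R) nat \oo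
  (index_enum 'I_n) (fun i m => flat_exp 0 (m.+1%:R * (x ord0 i - a ord0 i)) *
    flat_exp 0 (m.+1%:R * (b ord0 i - x ord0 i))) (fun=> 1 * 1) _.
rewrite [X in _ -> _ --> X]big1; last by move=> i _; rewrite mulr1.
apply => i _; have := xab i; rewrite in_itv/= => /andP[ax xb].
by apply: cvgM; apply: c1; rewrite subr_gt0.
Qed.

Lemma differentiable_bump k a b x : differentiable (bump k a b) x.
Proof.
have -> : bump k a b = fun x => \prod_(i <- index_enum 'I_n)
                (flat_coord 0 k (- (k * a ord0 i)) i x *
                 flat_coord 0 (- k) (k * b ord0 i) i x) by [].
elim: (index_enum _) => [|i s IH].
  rewrite [X in differentiable X _](_ : _ = cst 1); first exact: differentiable_cst.
  by apply/funext => y; rewrite big_nil.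
rewrite [X in differentiable X _](_ : _ =
  (flat_coord 0 k (- (k * a ord0 i)) i * flat_coord 0 (- k) (k * b ord0 i) i)
  * (fun x => \prod_(i <- s) (flat_coord 0 k (- (k * a ord0 i)) i x *
                 flat_coord 0 (- k) (k * b ord0 i) i x))); last first.
  by apply/funext => y; rewrite big_cons.
by apply: differentiableM => //; apply: differentiableM => //;
  exact: differentiable_flat_coord.
Qed.

Lemma smooth_cs_bump k a b : 0 < k -> smooth_cs (bump k a b).
Proof.
move=> k0; split; last by move=> x; exact: differentiable_bump.
split.
  by move=> m; apply: Ck_prod => i; apply: CkM; exact: Ck_flat_coord.
apply: (@compact_closure_bounded _ (`|a| + `|b|)) => x /= /eqP bx.
by apply: open_box_norm; apply: contrapT => /(bump_eq0 k0).
Qed.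

End test_functions.

(** * Weak gradients and difference quotients *)

Section translations.
Context {R : realType} {n : nat}.
Implicit Types (phi u : 'rV[R]_n -> R) (x v : 'rV[R]_n).
Local Notation lambda := (lebesgue_rV n).

Lemma integral_translation v (F : 'rV[R]_n -> \bar R) : measurable_fun setT F ->
  (\int[lambda]_x F (x + v)%R = \int[lambda]_x F x)%E.
Proof.
move=> mF; rewrite integralE [RHS]integralE.
rewrite -(ge0_integral_translation v (measurable_funepos mF)) => [|x]; last first.
  exact: funepos_ge0.
rewrite -(ge0_integral_translation v (measurable_funeneg mF)) => [|x]; last first.
  exact: funeneg_ge0.
by congr (_ - _)%E; apply: eq_integral => x _; rewrite !(funeposE, funenegE).
Qed.

Lemma Rintegral_translation v u : measurable_fun setT u ->
  \int[lambda]_x u (x + v) = \int[lambda]_x u x.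
Proof.
move=> mu; rewrite /Rintegral (integral_translation v (F := EFin \o u))//.
exact/measurable_EFinP.
Qed.

Lemma integrable_translation v u :
  lambda.-integrable setT (EFin \o u) ->
  lambda.-integrable setT (EFin \o (fun x => u (x + v))).
Proof.
move=> /integrableP[mu iu].
have mu' : measurable_fun setT (fun x : 'rV[R]_n => (EFin \o u) (x + v)).
  by apply: measurableT_comp => //; exact: measurable_addv.
apply/integrableP; split=> //.
rewrite (@ge0_integral_translation _ _ v (fun x => `|(u x)%:E|)%E)//.
exact: measurableT_comp.
Qed.

Lemma integrable_bounded_mul (u w : 'rV[R]_n -> R) (C : R) :
  lambda.-integrable setT (EFin \o u) -> measurable_fun setT w ->
  (forall x, `|w x| <= C) ->
  lambda.-integrable setT (EFin \o (fun x => u x * w x)).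
Proof.
move=> iu mw wC.
have Ciu := integrableZl measurableT C iu.
apply: le_integrable Ciu => //.
  apply/measurable_EFinP; apply: measurable_funM => //.
  by apply/measurable_EFinP; case/integrableP : iu.
move=> x _ /=; rewrite lee_fin normrM mulrC normrM ler_wpM2r//.
by rewrite (le_trans (wC x))// ler_norm.
Qed.

Lemma Ck_translation k v phi : Ck k phi -> Ck k (fun x => phi (x + v)).
Proof.
have c phi' : continuous phi' -> continuous (fun x : 'rV[R]_n => phi' (x + v)).
  move=> cphi x; apply: (@continuous_comp _ _ _ (fun x => x + v)); last exact: cphi.
  by apply: continuousD; [exact: cvg_id|exact: cst_continuous].
elim: k phi => [|k IH] phi [cphi dphi]; split=> //; try exact: c.
move=> i; have [d1 d2] := dphi i.
have E x : (fun h : R => h^-1 *: (((fun x => phi (x + v)) \o shift x)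
      (h *: basis_vec i) - phi (x + v))) =
    (fun h : R => h^-1 *: ((phi \o shift (x + v)) (h *: basis_vec i) - phi (x + v))).
  by apply/funext => h /=; rewrite addrA.
split; first by move=> x; rewrite /derivable E; exact: d1.
rewrite [X in Ck _ X](_ : _ = fun x => 'D_(basis_vec i) phi (x + v)).
  exact: (IH (fun x => 'D_(basis_vec i) phi x)).
by apply/funext => x; rewrite /derive E.
Qed.

Lemma smooth_cs_translation v phi : smooth_cs phi -> smooth_cs (fun x => phi (x + v)).
Proof.
move=> [tphi dphi]; split.
  split; first by move=> k; apply: Ck_translation; case: tphi.
  have [M hM] := test_function_bounded_support tphi.
  apply: (@compact_closure_bounded _ _ _ (M + `|v|)) => x /=.
  rewrite leNgt; apply: contra => h.
  apply/eqP/(nbhs_singleton (hM _ _)).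
  have := ler_normB (x + v) v; rewrite addrK; lra.
move=> x; apply: (@differentiable_comp _ _ _ _ (fun x => x + v)) => //.
Qed.

Lemma row_basis_sum v : v = \sum_(i < n) v ord0 i *: basis_vec i.
Proof. exact: row_sum_delta. Qed.

Lemma derive_basis_sum phi x v : differentiable phi x ->
  'D_v phi x = \sum_(i < n) v ord0 i * 'D_(basis_vec i) phi x.
Proof.
move=> d; rewrite deriveE// {1}(row_basis_sum v) linear_sum.
by apply: eq_bigr => i _; rewrite linearZ deriveE.
Qed.

Lemma integrable_sum_R I (s : seq I) (u : I -> 'rV[R]_n -> R) :
  (forall i, lambda.-integrable setT (EFin \o u i)) ->
  lambda.-integrable setT (EFin \o (fun x => \sum_(i <- s) u i x)).
Proof.
move=> iu; elim: s => [|i s IH].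
  rewrite [X in integrable _ _ X](_ : _ = cst 0%E); first exact: integrable0.
  by apply/funext => x; rewrite /= big_nil.
rewrite [X in integrable _ _ X](_ : _ =
  (EFin \o u i) \+ (EFin \o (fun x => (\sum_(i <- s) u i x)%R)))%E.
  exact: integrableD.
by apply/funext => x; rewrite /= big_cons.
Qed.

Lemma Rintegral_sum I (s : seq I) (u : I -> 'rV[R]_n -> R) :
  (forall i, lambda.-integrable setT (EFin \o u i)) ->
  \int[lambda]_x (\sum_(i <- s) u i x) = \sum_(i <- s) \int[lambda]_x u i x.
Proof.
move=> iu; elim: s => [|i s IH].
  rewrite big_nil; under eq_Rintegral do rewrite big_nil.
  by rewrite Rintegral_cst// mul0r.
rewrite big_cons -IH; under eq_Rintegral do rewrite big_cons.
by rewrite RintegralD//; exact: integrable_sum_R.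
Qed.

End translations.

Section weak_gradient_lipschitz.
Context {R : realType} {n : nat}.
Local Notation lambda := (@lebesgue_rV R n).
Variables (f : 'rV[R]_n -> R) (g : 'rV[R]_n -> 'rV[R]_n).
Hypothesis fi : lambda.-integrable setT (EFin \o f).
Hypothesis wg : is_weak_gradient f g.
Hypothesis gi : forall i, lambda.-integrable setT (EFin \o (fun x => g x ord0 i)).
Variable xi : 'rV[R]_n.
Implicit Types (phi : 'rV[R]_n -> R).

Lemma measurable_weak_derivative : measurable_fun setT (fun x => dotv (g x) xi).
Proof.
apply: measurable_sum => i; apply: measurable_funM => //.
by case: wg => _ + _ _; exact.
Qed.

Lemma integrable_weak_derivative : lambda.-integrable setT (EFin \o (fun x => dotv (g x) xi)).
Proof.
apply: integrable_sum_R => i.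
rewrite [X in integrable _ _ X](_ : _ =
  (fun x => (xi ord0 i)%:E * (EFin \o (fun x => g x ord0 i)) x)%E).
  exact: integrableZl.
by apply/funext => x; rewrite /= mulrC.
Qed.

Lemma smooth_cs_measurable phi : smooth_cs phi -> measurable_fun setT phi.
Proof.
move=> [tphi _]; apply: continuous_measurable_rV.
exact: test_function_continuous.
Qed.

Lemma smooth_cs_derive_bounded phi : smooth_cs phi ->
  exists2 C, 0 <= C & forall x, `|'D_xi phi x| <= C.
Proof.
move=> [tphi dphi].
have /choice[C hC] i : exists C, 0 <= C /\
    forall x, `|'D_(basis_vec i) phi x| <= C.
  by have [C C0 hC] := test_function_partial_bounded i tphi; exists C.
exists (\sum_(i < n) `|xi ord0 i| * C i).
  by apply: sumr_ge0 => i _; rewrite mulr_ge0//; case: (hC i).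
move=> x; rewrite derive_basis_sum//.
rewrite (le_trans (ler_norm_sum _ _ _))//; apply: ler_sum => i _.
by rewrite normrM ler_wpM2l//; case: (hC i).
Qed.

Lemma integrable_f_derive phi i : smooth_cs phi ->
  lambda.-integrable setT (EFin \o (fun x => f x * 'D_(basis_vec i) phi x)).
Proof.
move=> [tphi dphi]; have [C _ hC] := test_function_partial_bounded i tphi.
apply: (integrable_bounded_mul (C := C)) => //.
apply: continuous_measurable_rV.
exact: test_function_partial_continuous.
Qed.

Lemma integrable_mul_smooth phi u : smooth_cs phi ->
  lambda.-integrable setT (EFin \o u) ->
  lambda.-integrable setT (EFin \o (fun x => u x * phi x)).
Proof.
move=> sphi ui; have [C _ hC] := test_function_bounded sphi.1.
by apply: (integrable_bounded_mul (C := C)) => //; exact: smooth_cs_measurable.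
Qed.

(** The definition of a weak gradient is an integration by parts along the basis vectors;
    differentiability of [phi] extends it linearly to the direction [xi]. *)
Lemma weak_derivative_smooth phi : smooth_cs phi ->
  \int[lambda]_x (- (f x * 'D_xi phi x)) = \int[lambda]_x (dotv (g x) xi * phi x).
Proof.
move=> sphi; have [tphi dphi] := sphi.
transitivity (\int[lambda]_x
    (\sum_(i < n) (- xi ord0 i) * (f x * 'D_(basis_vec i) phi x))).
  apply: eq_Rintegral => x _; rewrite derive_basis_sum// mulr_sumr -sumrN.
  by apply: eq_bigr => i _; ring.
transitivity (\int[lambda]_x (\sum_(i < n) xi ord0 i * (g x ord0 i * phi x))).
  have iZ (c : R) u : lambda.-integrable setT (EFin \o u) ->
      lambda.-integrable setT (EFin \o (fun x => c * u x)).
    by move=> iu; exact: (integrableZl measurableT c iu).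
  rewrite Rintegral_sum; last by move=> i; exact: (iZ _ _ (integrable_f_derive i sphi)).
  rewrite Rintegral_sum; last by move=> i; exact: (iZ _ _ (integrable_mul_smooth sphi (gi i))).
  apply: eq_bigr => i _.
  rewrite (RintegralZl _ measurableT (integrable_f_derive i sphi)).
  rewrite (RintegralZl _ measurableT (integrable_mul_smooth sphi (gi i))).
  by case: wg => _ _ _ /(_ _ tphi i) ->; rewrite mulrNN.
apply: eq_Rintegral => x _; rewrite /dotv mulr_suml.
by apply: eq_bigr => i _; ring.
Qed.

(** By translation invariance this pairs [phi] with [f (y + r xi)], but in this form the dependence
    on [r] is carried by the smooth factor. *)
Definition shifted_pairing phi (r : R) : R := \int[lambda]_y (f y * phi (y - r *: xi)).

Lemma is_derive_shifted_integrand phi (y : 'rV[R]_n) (r : R) : smooth_cs phi ->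
  is_derive r (1 : R) (fun r : R => f y * phi (y - r *: xi))
    (- (f y * 'D_xi phi (y - r *: xi))).
Proof.
move=> [tphi dphi].
have E : (fun k : R => k^-1 *: (((fun r : R => phi (y - r *: xi)) \o shift r) (k *: 1)
      - phi (y - r *: xi))) =
    (fun k : R => k^-1 *: ((phi \o shift (y - r *: xi)) (k *: (- xi))
      - phi (y - r *: xi))).
  apply/funext => k /=; congr (_ *: (phi _ - _)).
  by rewrite [k *: 1]mulr1 scalerDl opprD scalerN addrCA.
have D : derivable phi (y - r *: xi) (- xi) by exact: diff_derivable.
have dp : is_derive r (1 : R) (fun r : R => phi (y - r *: xi))
    (- 'D_xi phi (y - r *: xi)).
  apply: DeriveDef; first by rewrite /derivable E; exact: D.
  rewrite [LHS]/derive E -[LHS]/('D_(- xi) phi (y - r *: xi)).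
  by rewrite (deriveE (- xi) (dphi _)) (deriveE xi (dphi _)) raddfN.
have := is_deriveZ (f y) dp.
by rewrite /GRing.scale/= mulrN.
Qed.

(** Differentiation under the integral sign, dominated by [C |f|] where [C] bounds the derivative of
    [phi] along [xi]; integration by parts against the translated [phi] then moves the derivative to
    [g]. *)
Lemma is_derive_shifted_pairing phi (a : R) : smooth_cs phi ->
  is_derive a (1 : R) (shifted_pairing phi) (\int[lambda]_y (dotv (g y) xi * phi (y - a *: xi))).
Proof.
move=> sphi.
have [C C0 hC] := smooth_cs_derive_bounded sphi.
have Ia : a \in `]a - 1, a + 1[ by rewrite in_itv/=; apply/andP; split; lra.
have s_tr (r : R) : smooth_cs (fun y => phi (y - r *: xi)) by exact: smooth_cs_translation.
have fint (r : R) : lambda.-integrable setT (EFin \o (fun y => f y * phi (y - r *: xi))).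
  exact: integrable_mul_smooth.
have der (r : R) y := is_derive_shifted_integrand y r sphi.
have Gint : lambda.-integrable setT (EFin \o (fun y => C * `|f y|)).
  apply: (integrableZl measurableT C (f := EFin \o (fun y => `|f y|))).
  exact: integrable_norm.
pose k (r : R) y := f y * phi (y - r *: xi).
have k0 y : 0 <= C * `|f y| by rewrite mulr_ge0.
have kd (r : R) y : `|partial1of2 k r y| <= C * `|f y|.
  rewrite partial1of2E; have [_ ->] := der r y.
  by rewrite normrN normrM mulrC ler_wpM2r.
have kder (r : R) y : derivable (k^~ y) r 1 by have [] := der r y.
apply: DeriveDef.
  apply: (@derivable_under_integral _ _ _ lambda k setT measurableT a (a - 1) (a + 1)
    Ia (fun r _ => fint r) (fun r y _ _ => kder r y) (fun y => C * `|f y|)) => //.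
rewrite -derive1E (@differentiation_under_integral _ _ _ lambda k setT measurableT
    a (a - 1) (a + 1) Ia (fun r _ => fint r) (fun r y _ _ => kder r y)
    (fun y => C * `|f y|))//.
rewrite -weak_derivative_smooth//.
apply: eq_Rintegral => y _; rewrite partial1of2E; have [_ ->] := der a y.
congr (- (_ * _)).
have E : (fun k : R => k^-1 *: (((fun y => phi (y - a *: xi)) \o shift y) (k *: xi)
      - phi (y - a *: xi))) =
    (fun k : R => k^-1 *: ((phi \o shift (y - a *: xi)) (k *: xi)
      - phi (y - a *: xi))).
  by apply/funext => k0' /=; rewrite addrA.
by rewrite /derive E.
Qed.

Lemma shifted_pairing_sub phi (t : R) : smooth_cs phi ->
  lambda.-integrable setT (EFin \o (fun y => (f (y + t *: xi) - f y) * phi y)) /\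
  shifted_pairing phi t - shifted_pairing phi 0 = \int[lambda]_y ((f (y + t *: xi) - f y) * phi y).
Proof.
move=> sphi.
have s_tr (r : R) : smooth_cs (fun y => phi (y - r *: xi)) by exact: smooth_cs_translation.
have fint (r : R) : lambda.-integrable setT (EFin \o (fun y => f y * phi (y - r *: xi))).
  exact: integrable_mul_smooth.
have fti : lambda.-integrable setT (EFin \o (fun y => f (y + t *: xi) * phi y)).
  by apply: integrable_mul_smooth => //; exact: integrable_translation.
have Ft : shifted_pairing phi t = \int[lambda]_y (f (y + t *: xi) * phi y).
  rewrite /shifted_pairing -(@Rintegral_translation _ _ (t *: xi)).
    by apply: eq_Rintegral => y _; rewrite addrK.
  by case/integrableP : (fint t) => /measurable_EFinP.
have F0 : shifted_pairing phi 0 = \int[lambda]_y (f y * phi y).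
  by apply: eq_Rintegral => y _; rewrite scale0r subr0.
have f0i : lambda.-integrable setT (EFin \o (fun y => f y * phi y)).
  exact: integrable_mul_smooth.
split.
  rewrite (_ : _ \o _ = ((EFin \o (fun y => (f (y + t *: xi) * phi y)%R)) \-
    (EFin \o (fun y => (f y * phi y)%R)))%E); first exact: integrableB.
  by apply/funext => y; rewrite /= -EFinB mulrBl.
by rewrite Ft F0 -RintegralB//; apply: eq_Rintegral => y _; rewrite mulrBl.
Qed.

Section upper.
Variable (Lam : R).
Hypothesis fLam : forall y (t : R), `|f (y + t *: xi) - f y| <= `|t| * Lam.

Lemma shifted_pairing_le phi (t : R) : smooth_cs phi ->
  `|shifted_pairing phi t - shifted_pairing phi 0| <= `|t| * Lam * \int[lambda]_y `|phi y|.
Proof.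
move=> sphi; have phii := test_function_integrable sphi.1.
have [di ->] := shifted_pairing_sub t sphi.
rewrite (le_trans (le_normr_Rintegral _ di))//.
rewrite -RintegralZl//; last exact: integrable_norm.
apply: le_Rintegral => //.
- exact: integrable_norm.
- exact: (integrableZl measurableT (`|t| * Lam) (integrable_norm phii)).
- by move=> y _; rewrite normrM ler_wpM2r.
Qed.

(** The left-hand side is the derivative of the shifted pairing at [0], and each of its difference
    quotients obeys the bound. *)
Lemma weak_derivative_le phi : smooth_cs phi ->
  `|\int[lambda]_y (dotv (g y) xi * phi y)| <= Lam * \int[lambda]_y `|phi y|.
Proof.
move=> sphi; have [] := is_derive_shifted_pairing 0 sphi.
rewrite /derivable /derive => dP PE.
have E0 : \int[lambda]_y (dotv (g y) xi * phi (y - 0 *: xi)) =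
    \int[lambda]_y (dotv (g y) xi * phi y).
  by apply: eq_Rintegral => y _; rewrite scale0r subr0.
rewrite E0 in PE; rewrite -PE.
pose Q (k : R) : R := k^-1 *: ((shifted_pairing phi \o shift 0) (k *: 1) - shifted_pairing phi 0).
have dQ : Q @ 0^' --> lim (Q @ 0^') := dP.
have cn : `|Q k| @[k --> 0^'] --> `|lim (Q @ 0^')| by exact: cvg_norm.
rewrite -/Q.
rewrite -(cvg_lim _ cn)//.
apply: limr_le; first exact: cvgP cn.
near=> k.
have k0 : k != 0 by near: k; exact: nbhs_dnbhs_neq.
have := shifted_pairing_le k sphi.
rewrite /Q /= addr0 [k *: 1]mulr1 /GRing.scale/= normrM normfV => H.
by rewrite ler_pdivrMl ?normr_gt0// mulrA.
Unshelve. all: by end_near. Qed.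

End upper.

(** The converse direction: by the mean value theorem the difference is [t] times a pairing of
    [<g, xi>] with some translate of [phi], and translating does not change the integral of
    [|phi|]. *)
Lemma shifted_pairing_le_ae (N : R) phi (t : R) : smooth_cs phi -> 0 <= N -> 0 <= t ->
  {ae lambda, forall x, `|dotv (g x) xi| <= N} ->
  `|shifted_pairing phi t - shifted_pairing phi 0| <= t * N * \int[lambda]_y `|phi y|.
Proof.
move=> sphi N0 t0 hN.
have dPhi (r : R) := is_derive_shifted_pairing r sphi.
have cPhi : {within `[0, t], continuous (shifted_pairing phi)}.
  apply: continuous_subspaceT => r.
  by apply/differentiable_continuous/derivable1_diffP; have [] := dPhi r.
have [r _ ->] := MVT_segment t0 (fun r _ => dPhi r) cPhi.
rewrite subr0 normrM (ger0_norm t0) mulrC -mulrA ler_wpM2l//.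
have s_r : smooth_cs (fun y => phi (y - r *: xi)) by exact: smooth_cs_translation.
have hi : lambda.-integrable setT (EFin \o (fun y => dotv (g y) xi * phi (y - r *: xi))).
  exact: integrable_mul_smooth integrable_weak_derivative.
rewrite (le_trans (le_normr_Rintegral _ hi))//.
have phii := test_function_integrable sphi.1.
have phiri := test_function_integrable s_r.1.
have -> : \int[lambda]_y `|phi y| = \int[lambda]_y `|phi (y - r *: xi)|.
  rewrite -(@Rintegral_translation _ _ (- (r *: xi)) (fun y => `|phi y|))//.
  by apply: measurableT_comp => //; exact: smooth_cs_measurable.
rewrite -RintegralZl//; last exact: integrable_norm.
rewrite /Rintegral fine_le//.
- exact/integrable_fin_num/integrable_norm.
- apply/integrable_fin_num => //.
  exact: (integrableZl measurableT N (integrable_norm phiri)).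
apply: ae_ge0_le_integral => //.
- apply/measurable_EFinP/measurableT_comp => //.
  by case/integrableP : hi => /measurable_EFinP.
- by move=> y _; rewrite lee_fin mulr_ge0.
- apply/measurable_EFinP; apply: measurable_funM => //.
  apply: measurableT_comp => //; exact: smooth_cs_measurable.
- apply: filterS hN => y hy _.
  by rewrite lee_fin normrM ler_wpM2r.
Qed.

End weak_gradient_lipschitz.

(** * From bounds on integrals to bounds almost everywhere *)

Section open_boxes.
Context {R : realType} {n : nat}.
Implicit Types (a b x : 'rV[R]_n).

Lemma measurable_open_box a b : measurable (open_box a b).
Proof.
apply: (measurable_rV_box (P := fun i => `]a ord0 i, b ord0 i[%classic)).
by move=> i; exact: measurable_itv.
Qed.

Lemma setI_open_box a b a' b' : open_box a b `&` open_box a' b' =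
  open_box (\row_i Num.max (a ord0 i) (a' ord0 i))
           (\row_i Num.min (b ord0 i) (b' ord0 i)).
Proof.
apply/seteqP; split=> x.
  move=> [h1 h2] i; have := h1 i; have := h2 i; rewrite !in_itv/= !mxE.
  by rewrite gt_max lt_min => /andP[-> ->] /andP[-> ->].
move=> h; split=> i; have := h i; rewrite !in_itv/= !mxE gt_max lt_min;
  by case/andP => /andP[? ?] /andP[? ?]; apply/andP.
Qed.

Definition open_boxes : set (set 'rV[R]_n) :=
  [set A | exists a b, A = open_box a b].

Lemma measurable_open_boxes : @measurable _ 'rV[R]_n = <<s open_boxes >>.
Proof.
apply/seteqP; split; last first.
  apply: smallest_sub; first exact: sigma_algebra_measurable.
  by move=> _ [a [b ->]]; exact: measurable_open_box.
pose T := g_sigma_algebraType open_boxes.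
have mid : measurable_fun [set: T] (id : T -> 'rV[R]_n).
  apply/measurable_fun_rVP => i mT.
  apply: (measurability _ (RGenOpens.measurableE R)) => //.
  move=> _ [_ [c [d ->] <-]]; rewrite setTI.
  (* The slab [c < x_i < d] is unbounded in the other coordinates, hence exhausted by boxes of
     growing size [m]. *)
  pose lo m : 'rV[R]_n := \row_j (if j == i then c else - m%:R).
  pose hi m : 'rV[R]_n := \row_j (if j == i then d else m%:R).
  rewrite (_ : _ @^-1` _ = \bigcup_m open_box (lo m) (hi m)).
    apply: bigcupT_measurable => m; apply: sub_sigma_algebra.
    by exists (lo m), (hi m).
  apply/seteqP; split=> x /=.
    rewrite /rV_coord/= => xcd.
    exists (Num.trunc `|x|).+1 => // j; rewrite in_itv/= !mxE.
    case: eqP => [->|_]; first by move: xcd; rewrite in_itv.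
    by rewrite -ltr_norml (le_lt_trans (rV_coord_le_norm _ _))// truncnS_gt.
  by move=> [m _ /(_ i)]; rewrite !mxE eqxx.
by move=> A mA; have := mid measurableT A mA; rewrite setTI preimage_id.
Qed.

End open_boxes.

Section approximation.
Context {R : realType} {n : nat}.
Local Notation lambda := (@lebesgue_rV R n).
Variables (h : 'rV[R]_n -> R).
Hypothesis hi : lambda.-integrable setT (EFin \o h).
Implicit Types (u v phi : 'rV[R]_n -> R).

Let W (x : 'rV[R]_n) : R := 1 + `|h x|.

Let mh : measurable_fun setT h.
Proof. by case/integrableP : hi => /measurable_EFinP. Qed.

Let W_ge0 x : 0 <= W x. Proof. by rewrite addr_ge0. Qed.

Let mW : measurable_fun setT W.
Proof. by apply: measurable_funD => //; exact: measurableT_comp. Qed.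

(* Convergence for the weight [1 + |h|] gives that of the integrals of both [u]
   and [h * u]. *)
Definition wnorm u : \bar R := (\int[lambda]_x (`|u x| * (1 + `|h x|))%:E)%E.

Lemma wnormD u v : measurable_fun setT u -> measurable_fun setT v ->
  (wnorm (fun x => u x + v x)%R <= wnorm u + wnorm v)%E.
Proof.
move=> mu mv; have m (w : 'rV[R]_n -> R) : measurable_fun setT w ->
    measurable_fun setT (fun x => (`|w x| * W x)%:E).
  move=> mw; apply/measurable_EFinP; apply: measurable_funM => //.
  exact: measurableT_comp.
have p (w : 'rV[R]_n -> R) x : (0 <= (`|w x| * W x)%:E)%E by rewrite lee_fin mulr_ge0.
rewrite /wnorm -(ge0_integralD _ measurableT (fun x _ => p u x) (m _ mu)
  (fun x _ => p v x) (m _ mv)).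
apply: nonneg_le_integral => x _; first exact: (p (fun x => u x + v x)).
by rewrite -EFinD lee_fin -mulrDl ler_wpM2r// ler_normD.
Qed.

Definition approximable u := forall e : R, 0 < e ->
  exists2 phi, smooth_cs phi & (wnorm (fun x => u x - phi x)%R < e%:E)%E.

(** Both closure steps of the Dynkin induction use it: [c = -1] for complements, [c = 1] for finite
    disjoint unions. *)
Lemma approximableD (c : R) u v : `|c| = 1 -> measurable_fun setT u -> measurable_fun setT v ->
  approximable u -> approximable v -> approximable (fun x => c * u x + v x).
Proof.
move=> c1 mu mv au av e e0; have e2 : 0 < e / 2 by rewrite divr_gt0.
have [p sp pe] := au _ e2; have [q sq qe] := av _ e2.
have mp := smooth_cs_measurable sp; have mq := smooth_cs_measurable sq.
exists (fun x => c * p x + q x); first exact: smooth_csZD.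
rewrite (_ : (fun x => _) = (fun x => c * (u x - p x) + (v x - q x))); last first.
  by apply/funext => x; ring.
apply: (le_lt_trans (wnormD _ _)).
- by apply: measurable_funM => //; exact: measurable_funB.
- exact: measurable_funB.
rewrite (splitr e) EFinD; apply: lteD => //.
rewrite (_ : wnorm _ = wnorm (fun x => u x - p x))//.
by apply: eq_integral => x _; rewrite normrM c1 mul1r.
Qed.

Lemma approximable_lim u (u_ : nat -> 'rV[R]_n -> R) :
  measurable_fun setT u -> (forall k, measurable_fun setT (u_ k)) ->
  (forall k, approximable (u_ k)) ->
  (wnorm (fun x => u x - u_ k x)%R @[k --> \oo] --> 0)%E ->
  approximable u.
Proof.
move=> mu mu_ au_ ul e e0; have e2 : 0 < e / 2 by rewrite divr_gt0.
have H : nbhs (0%E : \bar R) [set z | (z < (e / 2)%:E)%E].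
  apply: open_nbhs_nbhs; split; last by rewrite /= lte_fin.
  exact: open_ereal_lt_ereal.
have [k _ /(_ k (leqnn k)) /= uk] := ul _ H.
have [p sp pe] := au_ k _ e2; exists p => //.
rewrite (_ : (fun x => _) = (fun x => (u x - u_ k x) + (u_ k x - p x))); last first.
  by apply/funext => x; ring.
apply: (le_lt_trans (wnormD _ _)).
- exact: measurable_funB.
- by apply: measurable_funB => //; exact: smooth_cs_measurable.
by rewrite (splitr e) EFinD; apply: lteD.
Qed.

(** Dominated convergence. The constant [1] in the weight is integrable only on a set of finite
    measure, which is why everything below happens inside a fixed box. *)
Lemma wnorm_cvg0 (a b : 'rV[R]_n) (u_ : nat -> 'rV[R]_n -> R) :
  (forall k, measurable_fun setT (u_ k)) ->
  (forall k x, `|u_ k x| <= \1_(open_box a b) x) ->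
  (forall x, u_ k x @[k --> \oo] --> (0 : R)) ->
  (wnorm (u_ k) @[k --> \oo] --> 0)%E.
Proof.
move=> mu_ ub u0.
have m1 : measurable_fun setT (\1_(open_box a b) : 'rV[R]_n -> R).
  by apply: measurable_indic; exact: measurable_open_box.
have i1 : lambda.-integrable setT (EFin \o (\1_(open_box a b) : 'rV[R]_n -> R)).
  apply: (bounded_support_integrable (C := 1) (M := `|a| + `|b|)) => //.
    by move=> x; rewrite indicE; case: (_ \in _); rewrite ?normr1 ?normr0.
  move=> x xab; rewrite indicE memNset// => xB; move: xab; rewrite ltNge.
  suff -> : `|x| <= `|a| + `|b| by [].
  exact: open_box_norm xB.
have iW : lambda.-integrable setT (EFin \o (fun x => (\1_(open_box a b) x * W x)%R)).
  rewrite (_ : _ \o _ = ((EFin \o (\1_(open_box a b) : 'rV[R]_n -> R)) \+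
      (EFin \o (fun x => (`|h x| * \1_(open_box a b) x)%R)))%E).
    apply: integrableD => //.
    apply: (integrable_bounded_mul (C := 1)) => //; first exact: integrable_norm.
    by move=> x; rewrite indicE; case: (_ \in _); rewrite ?normr1 ?normr0.
  by apply/funext => x; rewrite /= -EFinD; congr EFin; rewrite /W; ring.
have [||||] := @dominated_convergence _ _ _ lambda setT measurableT
  (fun k x => (`|u_ k x| * W x)%:E) (cst 0%E) _ _ _ _ iW.
- move=> k; apply/measurable_EFinP; apply: measurable_funM => //.
  exact: measurableT_comp.
- exact: measurable_cst.
- apply: aeW => x _; apply: cvg_EFin.
    by apply: nearW.
  rewrite -(mul0r (W x)); apply: cvgMl; rewrite -(normr0 R); exact: cvg_norm.
- apply: aeW => x k _ /=; rewrite lee_fin ger0_norm ?mulr_ge0//.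
  by rewrite ler_wpM2r.
by move=> _ _; rewrite integral0.
Qed.

Lemma approximable_box (a b : 'rV[R]_n) : approximable (\1_(open_box a b)).
Proof.
pose u_ k x : R := \1_(open_box a b) x - bump k.+1%:R a b x.
have m1 : measurable_fun setT (\1_(open_box a b) : 'rV[R]_n -> R).
  by apply: measurable_indic; exact: measurable_open_box.
have sb k : smooth_cs (bump k.+1%:R a b) by exact: smooth_cs_bump.
have H : (wnorm (u_ k) @[k --> \oo] --> 0)%E.
  apply: (wnorm_cvg0 (a := a) (b := b)).
  - by move=> k; apply: measurable_funB => //; exact: smooth_cs_measurable.
  - move=> k x; rewrite /u_; have [xab|xab] := pselect (open_box a b x).
      rewrite indicE mem_set// ger0_norm ?subr_ge0 ?bump_le1//.
      by rewrite lerBlDr lerDl bump_ge0.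
    by rewrite bump_eq0// indicE memNset// subr0 normr0.
  - move=> x; rewrite -(subrr (\1_(open_box a b) x)).
    by apply: cvgB; [exact: cvg_cst|exact: bump_cvg].
move=> e e0; have H1 : nbhs (0%E : \bar R) [set z | (z < e%:E)%E].
  apply: open_nbhs_nbhs; split; last by rewrite /= lte_fin.
  exact: open_ereal_lt_ereal.
have [k _ /(_ k (leqnn k)) /= uk] := H _ H1.
by exists (bump k.+1%:R a b).
Qed.

Lemma approximable0 : approximable (fun=> 0).
Proof.
move=> e e0; exists (fun=> 0); first exact: smooth_cs0.
rewrite /wnorm (eq_integral (cst 0%E)) ?integral0 ?lte_fin//.
by move=> x _; rewrite subrr normr0 mul0r.
Qed.

(** Boxes are stable under intersection and generate the Borel sets, so it suffices that the sets
    [A] with this property contain the boxes and form a Dynkin system. *)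
Lemma approximable_indic (a b : 'rV[R]_n) (A : set 'rV[R]_n) : measurable A ->
  approximable (\1_(A `&` open_box a b)).
Proof.
set Q := open_box a b; have mQ : measurable Q := measurable_open_box a b.
have mI (B : set 'rV[R]_n) : measurable B -> measurable_fun setT (\1_B : 'rV[R]_n -> R).
  exact: measurable_indic.
rewrite [in X in X -> _]measurable_open_boxes.
apply: (@dynkin_induction _ _ open_boxes
  (fun A => approximable (\1_(A `&` Q)))).
- exact: measurable_open_boxes.
- move=> _ _ [c [d ->]] [c' [d' ->]]; rewrite setI_open_box.
  by do 2 eexists.
- by rewrite setTI; exact: approximable_box.
- by move=> _ [c [d ->]]; rewrite /Q setI_open_box; exact: approximable_box.
- move=> S mS aS.
  have -> : \1_(~` S `&` Q) = (fun x => (-1) * \1_(S `&` Q) x + \1_Q x) :> ('rV[R]_n -> R).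
    apply/funext => x; rewrite !indicE !in_setI in_setC.
    by case: (x \in S); case: (x \in Q) => /=; rewrite ?mulr0 ?mulr1 ?add0r ?addNr.
  apply: approximableD => //.
  - by rewrite normrN normr1.
  - by apply: mI; exact: measurableI.
  - exact: approximable_box.
- move=> F mF tF aF.
  have mU : measurable (\bigcup_k F k) by exact: bigcupT_measurable.
  pose u_ N x : R := \sum_(k < N) \1_(F k `&` Q) x.
  have mu_ N : measurable_fun setT (u_ N).
    by apply: measurable_sum => k; (by apply: mI; exact: measurableI).
  apply: (approximable_lim (u_ := u_)) => //.
  - by apply: mI; exact: measurableI.
  - elim=> [|N IH].
      rewrite (_ : u_ 0%N = fun=> 0); first exact: approximable0.
      by apply/funext => x; rewrite /u_ big_ord0.
    rewrite (_ : u_ N.+1 = fun x => 1 * u_ N x + \1_(F N `&` Q) x).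
      by apply: approximableD; rewrite ?normr1//; (by apply: mI; exact: measurableI).
    by apply/funext => x; rewrite /u_ big_ord_recr/= mul1r.
  (* Since the sets are disjoint, only the [k]-th term of the partial sum sees a point of [F k]: the
     sum is [0] up to [N = k] and [1] afterwards. *)
  have uE N x k : F k x -> Q x -> u_ N x = (k < N)%:R.
    move=> Fkx Qx; rewrite /u_.
    have E j : \1_(F j `&` Q) x = (j == k)%:R :> R.
      rewrite indicE; congr (_%:R); congr nat_of_bool.
      apply/idP/eqP => [/set_mem[Fj _]|->]; last exact/mem_set.
      by apply: (tF _ _ I I); exists x.
    under eq_bigr do rewrite E.
    have [kN|kN] := ltnP k N; last first.
      by rewrite big1// => j _; rewrite ltn_eqF// (leq_trans (ltn_ord j)).
    rewrite (bigD1 (Ordinal kN))//= eqxx big1 ?addr0// => j jk.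
    by rewrite (_ : (_ == _) = false)//; apply: contraNF jk => /eqP ?; exact/eqP/val_inj.
  have u0 N x : ~ ((\bigcup_k F k) `&` Q) x -> u_ N x = 0.
    move=> nx; rewrite /u_ big1// => k _; rewrite indicE memNset// => -[Fkx Qx].
    by apply: nx; split=> //; exists k.
  apply: (wnorm_cvg0 (a := a) (b := b)).
  - by move=> N; apply: measurable_funB => //; (by apply: mI; exact: measurableI).
  - move=> N x; have [[[k _ Fkx] Qx]|nx] := pselect (((\bigcup_k F k) `&` Q) x).
      rewrite (uE _ _ _ Fkx Qx) !indicE (mem_set Qx) mem_set; last by split=> //; exists k.
      by case: (k < N)%N; rewrite ?subrr ?subr0 ?normr0 ?normr1.
    by rewrite u0// indicE memNset// subrr normr0 indicE.
  - move=> x; have [[[k _ Fkx] Qx]|nx] := pselect (((\bigcup_k F k) `&` Q) x).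
      apply: cvg_near_cst; exists k.+1 => // N /= kN.
      rewrite (uE _ _ _ Fkx Qx) kN indicE mem_set ?subrr//.
      by split=> //; exists k.
    apply: cvg_near_cst; apply: nearW => N.
    by rewrite u0// indicE memNset// subrr.
Qed.

Variable (Lam : R).
Hypothesis Lam0 : 0 <= Lam.
Hypothesis hLam : forall phi, smooth_cs phi ->
  `|\int[lambda]_y (h y * phi y)| <= Lam * \int[lambda]_y `|phi y|.

Lemma approximable_le u :
  lambda.-integrable setT (EFin \o u) ->
  lambda.-integrable setT (EFin \o (fun x => h x * u x)) ->
  approximable u -> `|\int[lambda]_y (h y * u y)| <= Lam * \int[lambda]_y `|u y|.
Proof.
move=> iu ihu au; apply/ler_addgt0Pr => e e0.
have L1 : 0 < Lam + 1 by rewrite ltr_wpDl.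
(* Replacing [u] by [p] costs at most [r] in the pairing with [h] and [Lam * r] on the right, in
   total [(Lam + 1) * r]. *)
have d0 : 0 < e / (Lam + 1) by rewrite divr_gt0.
have [p sp pe] := au _ d0.
have ip := test_function_integrable sp.1.
have ihp := integrable_mul_smooth sp hi.
pose v x := u x - p x.
have iv : lambda.-integrable setT (EFin \o v) by exact: integrableB iu ip.
have ihv : lambda.-integrable setT (EFin \o (fun x => h x * v x)).
  rewrite (_ : _ \o _ = ((EFin \o (fun x => (h x * u x)%R)) \-
    (EFin \o (fun x => (h x * p x)%R)))%E); first exact: integrableB.
  by apply/funext => x; rewrite /= -EFinB mulrBr.
have nv := integrable_norm iv; have nhv := integrable_norm ihv.
have iW : lambda.-integrable setT (EFin \o (fun x => `|v x| * (1 + `|h x|))).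
  rewrite (_ : _ \o _ = ((EFin \o (fun x => `|v x|%R)) \+
    (EFin \o (fun x => `|h x * v x|%R)))%E); first exact: integrableD.
  by apply/funext => x; rewrite /= -EFinD normrM mulrDr mulr1 [X in _ + X]mulrC.
pose r := \int[lambda]_x (`|v x| * (1 + `|h x|)).
have rd : r < e / (Lam + 1).
  by rewrite -lte_fin /r /Rintegral fineK//; exact: integrable_fin_num.
have vr : \int[lambda]_x `|v x| <= r.
  apply: (le_Rintegral measurableT nv iW) => x _.
  by rewrite mulrDr mulr1 lerDl mulr_ge0.
have hvr : \int[lambda]_x `|h x * v x| <= r.
  apply: (le_Rintegral measurableT nhv iW) => x _.
  by rewrite [leRHS]mulrDr mulr1 [leLHS]normrM [leLHS]mulrC lerDr.
have E1 : \int[lambda]_x (h x * u x) =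
    \int[lambda]_x (h x * p x) + \int[lambda]_x (h x * v x).
  by rewrite -RintegralD//; apply: eq_Rintegral => x _; rewrite /v; ring.
have E2 : \int[lambda]_x `|p x| <= \int[lambda]_x `|u x| + \int[lambda]_x `|v x|.
  have nu := integrable_norm iu; rewrite -RintegralD//.
  apply: (le_Rintegral measurableT (integrable_norm ip) (integrableD measurableT nu nv)).
  by move=> x _; rewrite /= -{1}[p x](subKr (u x)); exact: ler_normB.
have E3 := le_normr_Rintegral measurableT ihv.
have E4 := hLam sp.
rewrite E1 (le_trans (ler_normD _ _))//.
have E5 : Lam * \int[lambda]_x `|p x| <= Lam * \int[lambda]_x `|u x| + Lam * r.
  by rewrite -mulrDr ler_wpM2l// (le_trans E2)// lerD2l.
have : (Lam + 1) * r <= e by rewrite mulrC -ler_pdivlMr// ltW.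
by rewrite mulrDl mul1r => E6; lra.
Qed.

(** Test with the indicator [u] of the part of [{h > Lam}] in a box: the integral of [(h - Lam) u]
    is at most [0] while its integrand is nonnegative, so it vanishes almost everywhere. Countably
    many boxes cover the space. *)
Lemma approximation_ae_le : {ae lambda, forall x, h x <= Lam}.
Proof.
pose Q (m : nat) : set 'rV[R]_n := open_box (const_mx (- m%:R)) (const_mx m%:R).
suff H m : {ae lambda, forall x, Q m x -> h x <= Lam}.
  apply: filterS (ae_foralln H) => x /= hx.
  apply: (hx (Num.trunc `|x|).+1) => i; rewrite in_itv/= !mxE.
  by rewrite -ltr_norml (le_lt_trans (rV_coord_le_norm _ _))// truncnS_gt.
pose A : set 'rV[R]_n := [set x | Lam < h x].
have mA : measurable A.
  rewrite (_ : A = h @^-1` `]Lam, +oo[%classic).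
    by rewrite -[X in measurable X]setTI; apply: mh => //; exact: measurable_itv.
  by apply/seteqP; split=> x; rewrite /A /= in_itv/= andbT.
have mQ : measurable (Q m) := measurable_open_box _ _.
pose u : 'rV[R]_n -> R := \1_(A `&` Q m).
have mu : measurable_fun setT u by apply: measurable_indic; exact: measurableI.
have u1 x : `|u x| <= 1.
  by rewrite /u indicE; case: (_ \in _); rewrite ?normr1 ?normr0.
have iu : lambda.-integrable setT (EFin \o u).
  apply: (bounded_support_integrable (C := 1)
    (M := `|(const_mx (- m%:R) : 'rV[R]_n)| + `|(const_mx m%:R : 'rV[R]_n)|)) => //.
  move=> x xab; rewrite /u indicE memNset// => -[_ xB]; move: xab; rewrite ltNge.
  by move=> /negP; apply; exact: open_box_norm xB.
have ihu : lambda.-integrable setT (EFin \o (fun x => h x * u x)).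
  exact: (integrable_bounded_mul (C := 1)).
have au : approximable u by exact: approximable_indic.
have u0 x : 0 <= u x by rewrite /u indicE.
have := approximable_le iu ihu au; rewrite (_ : \int[lambda]_y `|u y| = \int[lambda]_y u y).
  move=> /(le_trans (ler_norm _)).
  rewrite -RintegralZl// -subr_le0 -RintegralB//; last first.
    exact: (integrableZl measurableT Lam iu).
  have iW : lambda.-integrable setT (EFin \o (fun x => h x * u x - Lam * u x)).
    exact: (integrableB measurableT ihu (integrableZl measurableT Lam iu)).
  have W0 x : 0 <= h x * u x - Lam * u x.
    rewrite -mulrBl /u indicE; case: (boolP (x \in _)) => [/set_mem[Ax _]|_].
      by rewrite mulr1 subr_ge0; exact: ltW.
    by rewrite mulr0.
  move=> le0.
  have E0 : (\int[lambda]_x `|(h x * u x - Lam * u x)%:E| = 0)%E.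
    apply/eqP; rewrite eq_le integral_ge0 ?andbT//.
    rewrite -(fineK (integrable_fin_num measurableT (integrable_norm iW))) lee_fin.
    apply: le_trans le0; rewrite le_eqVlt; apply/orP; left; apply/eqP.
    by apply: eq_Rintegral => x _; rewrite /= ger0_norm.
  have mW' : measurable_fun setT (EFin \o (fun x => h x * u x - Lam * u x)).
    by case/integrableP : iW.
  move/(ae_eq_integral_abs lambda measurableT mW') : E0.
  apply: filterS => x /(_ I) /= [] /eqP; rewrite -mulrBl mulf_eq0 subr_eq0.
  move=> /orP[/eqP -> //|]; rewrite /u indicE; case: (boolP (x \in _)).
    by rewrite oner_eq0.
  move=> /negP + _ Qx; rewrite inE => nA; rewrite leNgt; apply/negP => Ax.
  by apply: nA.
by apply: eq_Rintegral => x _; rewrite /= ger0_norm.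
Qed.

End approximation.

(** * Slopes and the essential supremum of the directional derivative *)

Section ae_points.
Context {R : realType} {n : nat}.
Local Notation lambda := (@lebesgue_rV R n).

Lemma ae_ball_point (P : 'rV[R]_n -> Prop) (x : 'rV[R]_n) (r : R) : 0 < r ->
  {ae lambda, forall y, P y} -> exists2 y, `|x - y| < r & P y.
Proof.
move=> r0 [N [mN N0 PN]]; apply: contrapT => nP.
have BN : ball x r `<=` N.
  move=> y; rewrite -ball_normE /= => xy; apply: PN => /= Py.
  by apply: nP; exists y.
have : (lambda (ball x r) <= lambda N)%E.
  by apply: le_measure; rewrite ?inE//; exact: measurable_rV_ball.
rewrite N0 lebesgue_rV_ball// lee_fin leNgt exprn_gt0//.
by rewrite pmulrn_rgt0.
Qed.

(** Excludes the value [-oo] for the essential supremum of a nonnegative function. *)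
Lemma lebesgue_rVT_gt0 : (0 < lambda setT)%E.
Proof.
apply: (@lt_le_trans _ _ (lambda (ball (0%R : 'rV[R]_n) 1%R))).
  by rewrite lebesgue_rV_ball// lte_fin exprn_gt0// pmulrn_rgt0.
by apply: le_measure; rewrite ?inE//; exact: measurable_rV_ball.
Qed.

End ae_points.

Section slopes.
Context {R : realType} {n : nat}.
Local Notation lambda := (@lebesgue_rV R n).
Variables (f : 'rV[R]_n -> R) (L : R).
Hypothesis L0 : 0 <= L.
Hypothesis fL : forall x y, `|f x - f y| <= L * `|x - y|.
Implicit Types (x y xi eta : 'rV[R]_n) (t s : R).

Lemma lipschitz_increment xi x t : `|f (x + t *: xi) - f x| <= `|t| * (L * `|xi|).
Proof.
apply: le_trans (fL _ _) _.
by rewrite addrAC subrr add0r normrZ mulrCA.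
Qed.

(** The best Lipschitz constant of [f] along the direction [xi]; as a function of [xi] it is a
    seminorm, at most [L |xi|]. *)
Definition slope xi : R :=
  sup [set `|f (xt.1 + xt.2 *: xi) - f xt.1| / xt.2
      | xt in [set xt : 'rV[R]_n * R | 0 < xt.2]].

Lemma slope_has_sup xi :
  has_sup [set `|f (xt.1 + xt.2 *: xi) - f xt.1| / xt.2
      | xt in [set xt : 'rV[R]_n * R | 0 < xt.2]].
Proof.
split.
  by exists (`|f (0 + 1 *: xi) - f 0| / 1); exists (0, 1) => //=; exact: ltr01.
exists (L * `|xi|) => _ [[x t] /= t0 <-].
by rewrite ler_pdivrMr// (le_trans (lipschitz_increment _ _ _))// gtr0_norm// mulrC.
Qed.

Lemma slope_ub xi x t : `|f (x + t *: xi) - f x| <= `|t| * slope xi.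
Proof.
wlog t0 : x t / 0 < t => [H|].
  have [t0|t0|->] := ltgtP t 0; last by rewrite scale0r addr0 subrr !normr0 mul0r.
  - have := H (x + t *: xi) (- t); rewrite oppr_gt0 => /(_ t0).
    by rewrite scaleNr addrK normrN distrC.
  - exact: H.
rewrite (gtr0_norm t0) [leRHS]mulrC -ler_pdivrMr//; apply: sup_upper_bound.
  exact: slope_has_sup.
by exists (x, t).
Qed.

Lemma slope_le xi (N : R) :
  (forall x t, 0 < t -> `|f (x + t *: xi) - f x| <= t * N) -> slope xi <= N.
Proof.
move=> H; apply: ge_sup; first by case: (slope_has_sup xi).
by move=> _ [[x t] /= t0 <-]; rewrite ler_pdivrMr// mulrC H.
Qed.

Lemma slope_ge0 xi : 0 <= slope xi.
Proof.
have := slope_ub xi 0 1; rewrite normr1 mul1r; apply: le_trans; exact: normr_ge0.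
Qed.

Lemma slope_le_norm xi : slope xi <= L * `|xi|.
Proof.
by apply: slope_le => x t t0; rewrite (le_trans (lipschitz_increment _ _ _))// gtr0_norm.
Qed.

Lemma slopeZ xi t : slope (t *: xi) = `|t| * slope xi.
Proof.
have le t' xi' : slope (t' *: xi') <= `|t'| * slope xi'.
  apply: slope_le => x r r0; rewrite scalerA (le_trans (slope_ub _ _ _))//.
  by rewrite normrM gtr0_norm// mulrA.
have [->|t0] := eqVneq t 0.
  rewrite scale0r normr0 mul0r; apply/eqP; rewrite eq_le slope_ge0 andbT.
  by rewrite (le_trans (slope_le_norm _))// normr0 mulr0.
apply/eqP; rewrite eq_le le/= -ler_pdivlMl ?normr_gt0//.
by have := le t^-1 (t *: xi); rewrite scalerA mulVf// scale1r normfV.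
Qed.

Lemma slopeD xi eta : slope (xi + eta) <= slope xi + slope eta.
Proof.
apply: slope_le => x t t0.
have h1 := slope_ub eta (x + t *: xi) t.
have h2 := slope_ub xi x t.
rewrite (gtr0_norm t0) in h1 h2.
rewrite [X in t * X]addrC mulrDr (le_trans _ (lerD h1 h2))//.
rewrite scalerDr addrA (le_trans _ (ler_normD _ _))//.
by rewrite addrA subrK.
Qed.

Lemma slope_le_near xi eta : slope xi <= slope eta + L * `|xi - eta|.
Proof.
rewrite -{1}(subrK eta xi) addrC (le_trans (slopeD _ _))// lerD2l.
exact: slope_le_norm.
Qed.

Lemma slope_adherent xi (e : R) : 0 < e ->
  exists x t, 0 < t /\ slope xi - e < `|f (x + t *: xi) - f x| / t.
Proof.
move=> e0; have [_ [[x t] /= t0 <-] h] := sup_adherent e0 (slope_has_sup xi).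
by exists x, t.
Qed.

Section weak_gradient_slope.
Variable g : 'rV[R]_n -> 'rV[R]_n.
Hypothesis fi : lambda.-integrable setT (EFin \o f).
Hypothesis wg : is_weak_gradient f g.
Hypothesis gi : forall i, lambda.-integrable setT (EFin \o (fun x => g x ord0 i)).

(** The increment [D y = f (y + t xi) - f y] is paired with a bump around [x]. The pairing is at
    most [t N] times the integral of the bump, and [D] varies by at most [2 L d] on the support, so
    [|D x| <= t N + 2 L d]. *)
Lemma slope_le_ae (xi : 'rV[R]_n) (N : R) : 0 <= N ->
  {ae lambda, forall x, `|dotv (g x) xi| <= N} -> slope xi <= N.
Proof.
move=> N0 hN; apply: slope_le => x t t0.
apply/ler_addgt0Pr => e e0.
have L1 : 0 < L + L + 1 by rewrite ltr_wpDl// addr_ge0.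
(* Chosen so that the oscillation [(L + L) * d] of [D] on the box is at most [e]. *)
pose d := e / (L + L + 1); have d0 : 0 < d by rewrite divr_gt0.
pose phi := bump 1 (x - const_mx d) (x + const_mx d).
have sphi : smooth_cs phi by exact: smooth_cs_bump.
have phii := test_function_integrable sphi.1.
pose D y := f (y + t *: xi) - f y.
have [Di DE] := shifted_pairing_sub fi xi t sphi.
have := shifted_pairing_le_ae fi wg gi sphi N0 (ltW t0) hN.
rewrite /= DE => H.
have I0 : 0 < \int[lambda]_y `|phi y|.
  rewrite lt0r Rintegral_ge0// andbT; apply/eqP => phi0.
  have E0 : (\int[lambda]_x `|(phi x)%:E| = 0)%E.
    rewrite -(fineK (integrable_fin_num measurableT (integrable_norm phii))).
    by congr EFin.
  have mphi : measurable_fun setT (EFin \o phi) by case/integrableP : phii.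
  move/(ae_eq_integral_abs lambda measurableT mphi) : E0.
  move=> /(ae_ball_point x d0)[y xy /(_ I) /= [] /eqP].
  rewrite gt_eqF// bump_gt0// => i; rewrite in_itv/= !mxE.
  have := rV_coord_le_norm (x - y) i; rewrite !mxE => /le_lt_trans/(_ xy).
  by rewrite ltr_distlC.
have Dd y : open_box (x - const_mx d) (x + const_mx d) y -> `|D y - D x| <= (L + L) * d.
  move=> xy; have yd : `|y - x| <= d.
    apply/rV_norm_le; first exact: ltW.
    move=> i; have := xy i; rewrite in_itv/= !mxE -ltr_distlC => /ltW.
    by rewrite distrC.
  rewrite (_ : D y - D x = (f (y + t *: xi) - f (x + t *: xi)) - (f y - f x)); last first.
    by rewrite /D; ring.
  rewrite (le_trans (ler_normB _ _))// mulrDl lerD//.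
    by rewrite (le_trans (fL _ _))// ler_wpM2l// opprD addrACA subrr addr0.
  by rewrite (le_trans (fL _ _))// ler_wpM2l.
(* Multiplying by the sign of [D x] turns closeness of [D y] to [D x] into a lower bound of the
   integrand, without cancellation. *)
have key : (`|D x| - (L + L) * d) * \int[lambda]_y `|phi y| <=
    Num.sg (D x) * \int[lambda]_y (D y * phi y).
  rewrite -RintegralZl//; last exact: integrable_norm.
  rewrite -RintegralZl//.
  apply: le_Rintegral => //.
  - exact: (integrableZl measurableT _ (integrable_norm phii)).
  - exact: (integrableZl measurableT _ Di).
  move=> y _.
  have [xy|nxy] := pselect (open_box (x - const_mx d) (x + const_mx d) y); last first.
    by rewrite /phi bump_eq0// normr0 !mulr0.
  rewrite mulrA (ger0_norm (bump_ge0 _ _ _ _)) ler_wpM2r ?bump_ge0//.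
  have := Dd y xy => {}Dd.
  have : `|Num.sg (D x) * (D y - D x)| <= (L + L) * d.
    apply: le_trans Dd; rewrite normrM ler_piMl// normr_sg.
    by case: (_ != 0).
  rewrite mulrBr -normrEsg ler_norml => /andP[+ _].
  by rewrite lerBrDr addrC.
have : (`|D x| - (L + L) * d) * \int[lambda]_y `|phi y| <=
    t * N * \int[lambda]_y `|phi y|.
  apply: (le_trans key); apply: le_trans H.
  rewrite (le_trans (ler_norm _))// normrM ler_piMl// normr_sg.
  by case: (_ != 0).
rewrite ler_pM2r// lerBlDr => /le_trans; apply; rewrite lerD2l.
rewrite /d mulrCA ger_pMr//.
by rewrite ler_pdivrMr// mul1r lerDl.
Qed.

(** The one-sided criterion is applied to the weak derivative and to its opposite. *)
Lemma slope_ae (xi : 'rV[R]_n) :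
  {ae lambda, forall x, `|dotv (g x) xi| <= slope xi}.
Proof.
have hle := weak_derivative_le fi wg gi (slope_ub xi).
have hi := integrable_weak_derivative gi xi.
have hNi : lambda.-integrable setT (EFin \o (fun x => - dotv (g x) xi)).
  rewrite (_ : _ \o _ = -%E \o (EFin \o (fun x => dotv (g x) xi)))//.
  exact: integrableN.
have A1 := approximation_ae_le hi (slope_ge0 xi) hle.
have A2 : {ae lambda, forall x, - dotv (g x) xi <= slope xi}.
  apply: (approximation_ae_le hNi (slope_ge0 xi)) => phi sphi.
  apply: le_trans (hle phi sphi).
  rewrite le_eqVlt; apply/orP; left; apply/eqP.
  rewrite -[RHS]normrN -mulN1r -RintegralZl//; last exact: integrable_mul_smooth.
  by congr Num.norm; apply: eq_Rintegral => x _; rewrite mulN1r mulNr.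
near=> x; rewrite ler_norml; apply/andP; split; last by near: x.
by rewrite lerNl; near: x.
Unshelve. all: by end_near. Qed.

End weak_gradient_slope.

Lemma polar_gauge_inftyE (xi : 'rV[R]_n) :
  lambda.-integrable setT (EFin \o f) ->
  is_weak_gradient f (weak_gradient f) ->
  (forall i, lambda.-integrable setT (EFin \o (fun x => weak_gradient f x ord0 i))) ->
  polar_gauge_infty f xi = (slope xi)%:E.
Proof.
move=> fi wg gi; apply/eqP; rewrite eq_le; apply/andP; split.
  by apply/ess_supP; apply: filterS (slope_ae fi wg gi xi) => x /=; rewrite lee_fin.
have ge0 : (0 <= polar_gauge_infty f xi)%E.
  apply: ess_sup_gee; first exact: lebesgue_rVT_gt0.
  by apply: aeW => x; rewrite lee_fin.
have := ess_sup_ge lambda (fun x => `|dotv (weak_gradient f x) xi|%:E).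
rewrite -/(polar_gauge_infty f xi); move: ge0.
case: (polar_gauge_infty f xi) => [r| |]//; last by move=> _ _; exact: leey.
rewrite lee_fin => r0 H; rewrite lee_fin; apply: slope_le_ae wg gi _ _ _ _ => //.
Qed.

End slopes.

(** * Bounds on the unit sphere *)

Section euclidean_sphere.
Context {R : realType} {n : nat}.
Implicit Types (x xi : 'rV[R]_n).

Lemma dotv_ge0 x : 0 <= dotv x x.
Proof. by apply: sumr_ge0 => i _; rewrite -expr2 sqr_ge0. Qed.

Lemma sphere_dotv xi : unit_sphere n xi -> dotv xi xi = 1.
Proof.
rewrite /unit_sphere /= /enorm => h.
by rewrite -(sqr_sqrtr (dotv_ge0 xi)) h expr1n.
Qed.

Lemma coord_le_enorm x i : `|x ord0 i| <= enorm x.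
Proof.
rewrite -sqrtr_sqr ler_wsqrtr// /dotv (bigD1 i)//= expr2 lerDl.
by apply: sumr_ge0 => j _; rewrite -expr2 sqr_ge0.
Qed.

Lemma sphere_norm_le1 xi : unit_sphere n xi -> `|xi| <= 1.
Proof. by move=> h; apply/rV_norm_le => // i; rewrite -h coord_le_enorm. Qed.

(** The sphere is Euclidean while [|xi|] is the sup norm. Each of the [n] squares is at most [|xi|],
    because the coordinates are at most [1]. *)
Lemma sphere_norm_ge xi : unit_sphere n xi -> 1 <= n%:R * `|xi|.
Proof.
move=> h; suff : dotv xi xi <= n%:R * `|xi| by rewrite sphere_dotv.
rewrite /dotv.
apply: (@le_trans _ _ (\sum_(i < n) `|xi|)); last first.
  by rewrite sumr_const card_ord -[leLHS]mulr_natl.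
apply: ler_sum => i _; rewrite -expr2 -real_normK ?num_real// expr2.
have hc := rV_coord_le_norm xi i.
apply: (@le_trans _ _ (1 * `|xi|)); last by rewrite mul1r.
by apply: ler_pM => //; rewrite (le_trans hc)// sphere_norm_le1.
Qed.

Lemma continuous_enorm : continuous (@enorm R n).
Proof.
move=> x; apply: (@continuous_comp _ _ _ (fun x : 'rV[R]_n => dotv x x)); last first.
  exact: sqrt_continuous.
apply: (@continuous_big _ _ +%R 0 xpredT _ _ _ (fun i (x : 'rV[R]_n) => x ord0 i * x ord0 i)).
  exact: add_continuous.
by move=> i _ y; apply: continuousM; exact: coord_continuous.
Qed.

Lemma compact_unit_sphere : compact (unit_sphere n : set 'rV[R]_n).
Proof.
apply: bounded_closed_compact.
  exists 1; split; first exact: num_real.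
  by move=> y y1 x /sphere_norm_le1/le_trans; apply; exact: ltW.
rewrite (_ : unit_sphere n = @enorm R n @^-1` [set 1])//.
apply: closed_comp; last exact: closed_eq.
by move=> x _; exact: continuous_enorm.
Qed.

End euclidean_sphere.

Section decay.
Context {R : realType} {n : nat}.
Local Notation lambda := (@lebesgue_rV R n).
Variables (f : 'rV[R]_n -> R) (L : R).
Hypothesis L0 : 0 <= L.
Hypothesis fL : forall x y, `|f x - f y| <= L * `|x - y|.
Hypothesis fi : lambda.-integrable setT (EFin \o f).
Implicit Types (x y xi : 'rV[R]_n) (t s : R).

(** If [|f y| >= m], then [|f| >= m / 2] on a ball around [y] whose radius [d] depends only on [m]
    and [L], which contributes at least [c] to the integral. Far out this contradicts the vanishing
    of the tails of the integral of [|f|]. *)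
Lemma lipschitz_integrable_decay (m : R) : 0 < m ->
  exists T, forall y, T <= `|y| -> `|f y| < m.
Proof.
move=> m0; have L1 : 0 < L + 1 by rewrite ltr_wpDl.
pose d := m / 2 / (L + 1); have d0 : 0 < d by rewrite !divr_gt0.
pose c := (m / 2) * (d *+ 2) ^+ n.
have c0 : 0 < c by rewrite mulr_gt0 ?divr_gt0// exprn_gt0// pmulrn_rgt0.
pose A (k : nat) : set 'rV[R]_n := ~` ball 0 k%:R.
have mA k : measurable (A k) by apply: measurableC; exact: measurable_rV_ball.
have [|||||_ _] := @dominated_convergence _ _ _ lambda setT measurableT
  (fun k x => (`|f x| * \1_(A k) x)%:E) (cst 0%E) (EFin \o (fun x => `|f x|)).
- move=> k; apply/measurable_EFinP; apply: measurable_funM.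
    by apply: measurableT_comp => //; case/integrableP : fi => /measurable_EFinP.
  exact: measurable_indic.
- exact: measurable_cst.
- apply: aeW => x _; apply: cvg_near_cst.
  exists (Num.trunc `|x|).+1 => // k /= xk.
  rewrite indicE memNset ?mulr0// /A /= => h; apply: h.
  rewrite -ball_normE /= sub0r normrN (lt_le_trans (truncnS_gt _))//.
  by rewrite ler_nat.
- exact: integrable_norm.
- apply: aeW => x k _ /=; rewrite lee_fin ger0_norm ?mulr_ge0//.
  by rewrite ler_piMr// indicE; case: (_ \in _).
rewrite integral0 => tail.
have H1 : nbhs (0%E : \bar R) [set z | (z < c%:E)%E].
  apply: open_nbhs_nbhs; split; last by rewrite /= lte_fin.
  exact: open_ereal_lt_ereal.
have [k _ /(_ k (leqnn k)) /= ck] := tail _ H1.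
(* The margin [d] keeps the whole ball around [y] outside the ball of radius [k]. *)
exists (k%:R + d) => y Ty; rewrite ltNge; apply/negP => my.
move: ck; rewrite ltNge => /negP; apply.
apply: (@le_trans _ _ (\int[lambda]_x ((m / 2)%:E * (\1_(ball y d) x)%:E))%E).
  rewrite nonneg_integralZl//; last by rewrite divr_gt0.
  rewrite integral_indic//; last exact: measurable_rV_ball.
  by rewrite setIT [X in (_ * X)%E](lebesgue_rV_ball y d0).
apply: nonneg_le_integral => x _; first by rewrite -EFinM lee_fin mulr_ge0// divr_ge0// ltW.
rewrite -EFinM lee_fin indicE; case: (boolP (x \in _)) => [/set_mem|_]; last first.
  by rewrite mulr0 mulr_ge0.
rewrite -ball_normE /= => yx; rewrite mulr1 indicE mem_set.
  rewrite mulr1.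
  have := fL y x; have : L * `|y - x| <= m / 2.
    rewrite (le_trans (ler_wpM2l L0 (ltW yx)))// /d mulrCA ler_piMr//.
      by rewrite divr_ge0// ltW.
    by rewrite ler_pdivrMr// mul1r lerDl.
  have := ler_normB (f y) (f y - f x); rewrite subKr.
  have := ler_normD (f y - f x) (f x); rewrite subrK.
  lra.
rewrite /A /= -ball_normE /= sub0r normrN => xk.
have := ler_normD (y - x) x; rewrite subrK; lra.
Qed.

(** The normalisation [1 <= B] keeps [B + B] positive, since it is raised to real powers. *)
Lemma lipschitz_integrable_bounded : exists2 B, 1 <= B & forall x, `|f x| <= B.
Proof.
have [T hT] := lipschitz_integrable_decay ltr01.
exists (1 + `|f 0| + L * `|T|) => [|x].
  by rewrite -addrA lerDl addr_ge0// mulr_ge0.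
have [Tx|xT] := leP T `|x|.
  by rewrite (le_trans (ltW (hT _ Tx)))// -addrA lerDl addr_ge0// mulr_ge0.
have := fL x 0; rewrite subr0.
have := ler_normD (f x - f 0) (f 0); rewrite subrK.
have : L * `|x| <= L * `|T|.
  by rewrite ler_wpM2l// (le_trans (ltW xT))// ler_norm.
lra.
Qed.

Hypothesis f_neq0 : f <> (fun=> 0).

(** Start where [f] is nonzero and move so far that [f] has dropped below half that value. One step
    length serves all directions, which makes the lower bounds on the sphere uniform. *)
Lemma increment_lower_bound : exists m T : R, [/\ 0 < m, 0 < T &
  forall xi, unit_sphere n xi -> exists x, m <= `|f (x + T *: xi) - f x|].
Proof.
have [x0 fx0] : exists x, f x != 0.
  apply: contrapT => /forallNP h; apply: f_neq0; apply/funext => x.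
  by apply/eqP; have /negP := h x; rewrite negbK.
have m0 : 0 < `|f x0| / 2 by rewrite divr_gt0// normr_gt0.
have [T hT] := lipschitz_integrable_decay m0.
(* The factor [n] compensates for the sup norm of a unit vector, at least [1 / n]; [|x0|] accounts
   for the starting point. *)
exists (`|f x0| / 2), (n%:R * (`|T| + `|x0|) + 1); split=> //.
move=> xi Sxi; exists x0; set t := _ + 1.
have t0 : 0 < t by rewrite ltr_wpDl// mulr_ge0// addr_ge0.
have h : `|T| + `|x0| <= t * `|xi|.
  rewrite -[leLHS]mul1r.
  apply: le_trans (ler_wpM2r _ (sphere_norm_ge Sxi)) _; first by rewrite addr_ge0.
  by rewrite mulrAC ler_wpM2r// /t lerDl.
have : `|f (x0 + t *: xi)| < `|f x0| / 2.
  apply: hT; have := ler_normB (x0 + t *: xi) x0.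
  rewrite addrAC subrr add0r normrZ gtr0_norm//.
  have := ler_norm T; lra.
have := ler_normB (f (x0 + t *: xi)) (f (x0 + t *: xi) - f x0); rewrite subKr.
lra.
Qed.

Lemma slope_sphere_gt0 : exists2 c, 0 < c & forall xi, unit_sphere n xi -> c <= slope f xi.
Proof.
have [m [T [m0 T0 h]]] := increment_lower_bound.
exists (m / T) => [|xi /h[x mx]]; first by rewrite divr_gt0.
rewrite ler_pdivrMr// (le_trans mx)//.
by rewrite (le_trans (slope_ub fL _ _ _))// gtr0_norm// mulrC.
Qed.

End decay.

Section holder_slopes.
Context {R : realType} {n : nat}.
Local Notation lambda := (@lebesgue_rV R n).
Variables (f : 'rV[R]_n -> R) (L B : R).
Hypothesis L0 : 0 <= L.
Hypothesis fL : forall x y, `|f x - f y| <= L * `|x - y|.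
Hypothesis B1 : 1 <= B.
Hypothesis fB : forall x, `|f x| <= B.
Implicit Types (x y xi eta : 'rV[R]_n) (t s : R).

Let twoB_gt0 : 0 < B + B.
Proof. by have := B1; lra. Qed.

Lemma increment_le_bound xi x t : `|f (x + t *: xi) - f x| <= B + B.
Proof. by rewrite (le_trans (ler_normB _ _))// lerD. Qed.

(** The Hoelder seminorm of order [s] along [xi]: subadditive in [xi], homogeneous of degree [s],
    and equal to the [s]-th power of the gauge for [p = +oo]. *)
Definition holder_slope s xi : R :=
  sup [set xt.2 `^ (- s) * `|f (xt.1 + xt.2 *: xi) - f xt.1|
      | xt in [set xt : 'rV[R]_n * R | 0 < xt.2]].

(** Interpolation: the quotient is [(D / t) ^ s * D ^ (1 - s)], where [D / t] is at most the slope
    and [D] at most [B + B]. *)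
Lemma holder_quotient_le s xi x t : 0 < s < 1 -> 0 < t ->
  t `^ (- s) * `|f (x + t *: xi) - f x| <= slope f xi `^ s * (B + B) `^ (1 - s).
Proof.
move=> /andP[s0 s1] t0; set D := `|_ - _|.
have D0 : 0 <= D by rewrite /D.
have -> : t `^ (- s) * D = (D / t) `^ s * D `^ (1 - s).
  rewrite powRM ?invr_ge0 ?(ltW t0)// mulrAC -powRD; last first.
    by rewrite addrC subrK oner_eq0.
  rewrite addrC subrK powRr1// mulrC; congr (_ * _).
  by rewrite -powR_inv1 ?(ltW t0)// -powRrM mulN1r.
apply: ler_pM; rewrite ?powR_ge0//.
  apply: ge0_ler_powR; rewrite ?nnegrE ?(ltW s0) ?slope_ge0 ?divr_ge0 ?(ltW t0)//.
    exact: (slope_ge0 fL).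
  rewrite ler_pdivrMr//; have := slope_ub fL xi x t.
  by rewrite (gtr0_norm t0) [leRHS]mulrC.
apply: ge0_ler_powR; rewrite ?nnegrE ?subr_ge0 ?(ltW s1) ?(ltW twoB_gt0)//.
exact: increment_le_bound.
Qed.

Lemma holder_slope_has_sup s xi : 0 < s < 1 ->
  has_sup [set xt.2 `^ (- s) * `|f (xt.1 + xt.2 *: xi) - f xt.1|
      | xt in [set xt : 'rV[R]_n * R | 0 < xt.2]].
Proof.
move=> s01; split.
  by exists (1 `^ (- s) * `|f (0 + 1 *: xi) - f 0|); exists (0, 1) => //=; exact: ltr01.
exists (slope f xi `^ s * (B + B) `^ (1 - s)) => _ [[x t] /= t0 <-].
exact: holder_quotient_le.
Qed.

Lemma holder_slope_ub s xi x t : 0 < s < 1 -> 0 < t ->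
  t `^ (- s) * `|f (x + t *: xi) - f x| <= holder_slope s xi.
Proof.
move=> s01 t0; apply: sup_upper_bound; first exact: holder_slope_has_sup.
by exists (x, t).
Qed.

Lemma holder_slope_le s xi (N : R) : 0 < s < 1 ->
  (forall x t, 0 < t -> t `^ (- s) * `|f (x + t *: xi) - f x| <= N) ->
  holder_slope s xi <= N.
Proof.
move=> s01 H; apply: ge_sup; first by case: (holder_slope_has_sup xi s01).
by move=> _ [[x t] /= t0 <-]; exact: H.
Qed.

Lemma holder_slope_ge0 s xi : 0 < s < 1 -> 0 <= holder_slope s xi.
Proof.
move=> s01; have := holder_slope_ub xi 0 s01 ltr01; apply: le_trans.
by rewrite mulr_ge0 ?powR_ge0.
Qed.

Lemma holder_slope_le_slope s xi : 0 < s < 1 ->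
  holder_slope s xi <= slope f xi `^ s * (B + B) `^ (1 - s).
Proof. by move=> s01; apply: holder_slope_le => // x t; exact: holder_quotient_le. Qed.

Lemma holder_slopeD s xi eta : 0 < s < 1 ->
  holder_slope s (xi + eta) <= holder_slope s xi + holder_slope s eta.
Proof.
move=> s01; apply: holder_slope_le => // x t t0.
have h1 := holder_slope_ub eta (x + t *: xi) s01 t0.
have h2 := holder_slope_ub xi x s01 t0.
rewrite [leRHS]addrC (le_trans _ (lerD h1 h2))// -mulrDr ler_wpM2l ?powR_ge0//.
rewrite scalerDr addrA (le_trans _ (ler_normD _ _))//.
by rewrite addrA subrK.
Qed.

Lemma holder_slopeZ s c xi : 0 < s < 1 -> 0 < c ->
  holder_slope s (c *: xi) = c `^ s * holder_slope s xi.
Proof.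
move=> s01.
have le c' xi' : 0 < c' -> holder_slope s (c' *: xi') <= c' `^ s * holder_slope s xi'.
  move=> c0; apply: holder_slope_le => // x t t0.
  have := holder_slope_ub xi' x s01 (mulr_gt0 t0 c0).
  rewrite scalerA powRM ?(ltW t0) ?(ltW c0)// -mulrA mulrCA (powRN c').
  by rewrite ler_pdivrMl// powR_gt0.
move=> c0; apply/eqP; rewrite eq_le le//=.
rewrite -ler_pdivlMl ?powR_gt0//.
have ci0 : 0 < c^-1 by rewrite invr_gt0.
have := le _ (c *: xi) ci0; rewrite scalerA mulVf ?gt_eqF// scale1r.
by rewrite -(powR_inv1 (ltW c0)) -powRrM mulN1r powRN.
Qed.

Lemma frac_polar_gauge_inftyE s xi : 0 < s < 1 ->
  frac_polar_gauge_infty f s xi = (holder_slope s xi `^ s^-1)%:E.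
Proof.
move=> s01; rewrite /frac_polar_gauge_infty -poweR_EFin; congr (_ `^ _)%E.
have [h1 h2] := holder_slope_has_sup xi s01.
rewrite -ereal_sup_EFin//; congr ereal_sup.
by rewrite image_comp.
Qed.

Hypothesis fi : lambda.-integrable setT (EFin \o f).
Hypothesis f_neq0 : f <> (fun=> 0).

Lemma holder_slope_sphere_gt0 s : 0 < s < 1 ->
  exists2 c, 0 < c & forall xi, unit_sphere n xi -> c <= holder_slope s xi.
Proof.
move=> s01; have [m [T [m0 T0 h]]] := increment_lower_bound L0 fL fi f_neq0.
exists (T `^ (- s) * m) => [|xi /h[x mx]]; first by rewrite mulr_gt0// powR_gt0.
rewrite (le_trans _ (holder_slope_ub xi x s01 T0))//.
by rewrite ler_wpM2l// powR_ge0.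
Qed.

End holder_slopes.

Section powR_exponents.
Context {R : realType}.
Implicit Types (a c u e : R).

Lemma powR_cvg_exponent I (F : set_system I) {FF : Filter F} (u_ : I -> R) a u :
  0 < a -> u_ i @[i --> F] --> u -> a `^ (u_ i) @[i --> F] --> a `^ u.
Proof.
move=> a0 cu; rewrite /powR gt_eqF//.
by apply: continuous_cvg; [exact: continuous_expR|apply: cvgMl].
Qed.

Lemma cvg_invr_pinfty : (p : R)^-1 @[p --> +oo] --> (0 : R).
Proof. by apply/gtr0_cvgV0; [exact: nbhs_pinfty_gt|exact: cvg_id]. Qed.

Lemma near_powR_invr c e : 0 < c -> 0 < e ->
  \forall p \near +oo, 1 - e <= c `^ p^-1 <= 1 + e.
Proof.
move=> c0 e0; have : c `^ p^-1 @[p --> +oo] --> (1 : R).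
  rewrite -[X in _ --> X](powRr0 c); apply: powR_cvg_exponent => //.
  exact: cvg_invr_pinfty.
move/cvgrPdist_le => /(_ _ e0); apply: filterS => p.
by rewrite ler_distlC.
Qed.

End powR_exponents.

(** * The limit s to 1 *)

Section limit_s_to_1.
Context {R : realType} {n : nat}.
Local Notation lambda := (@lebesgue_rV R n).
Variables (f : 'rV[R]_n -> R) (L : R).
Hypothesis L0 : 0 <= L.
Hypothesis fL : forall x y, `|f x - f y| <= L * `|x - y|.
Hypothesis fi : lambda.-integrable setT (EFin \o f).
Hypothesis f_neq0 : f <> (fun=> 0).
Hypothesis wg : is_weak_gradient f (weak_gradient f).
Hypothesis gi : forall i,
  lambda.-integrable setT (EFin \o (fun x => weak_gradient f x ord0 i)).
Implicit Types (x xi : 'rV[R]_n) (s t : R) (K : set 'rV[R]_n).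

Lemma gauge_polar_body_infty xi : gauge (polar_body_infty f) xi = (slope f xi)%:E.
Proof.
have E := @polar_gauge_inftyE R n f L L0 fL.
rewrite /polar_body_infty gauge_set_of_gauge ?E// ?lee_fin ?(slope_ge0 fL)//.
move=> l l0; rewrite !E// (slopeZ fL) EFinM ger0_norm// invr_ge0.
exact: ltW.
Qed.

Lemma gauge_frac_polar_body_infty s xi : 0 < s < 1 ->
  gauge (frac_polar_body_infty f s) xi = (holder_slope f s xi `^ s^-1)%:E.
Proof.
move=> s01; have [B B1 fB] := lipschitz_integrable_bounded L0 fL fi.
have E xi' := frac_polar_gauge_inftyE fL B1 fB xi' s01.
rewrite /frac_polar_body_infty gauge_set_of_gauge ?E ?lee_fin ?powR_ge0//.
move=> l l0; rewrite !E; have li0 : 0 < l^-1 by rewrite invr_gt0.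
rewrite (holder_slopeZ fL B1 fB _ s01 li0) powRM ?powR_ge0//; last first.
  exact: (holder_slope_ge0 fL B1 fB _ s01).
by rewrite -powRrM mulfV ?powRr1 ?(ltW li0)// gt_eqF//; case/andP: s01.
Qed.

(** A nearly extremal pair [x0], [t0] for the slope at [xi0] gives an increment at least [b] in all
    nearby directions, so the gauge is at least [b ^ (1 / s) / t0], which tends to [b / t0], nearly
    the slope. *)
Lemma holder_slope_near_ge (e : R) : 0 < e < 1 ->
  \forall s \near 1^'-, forall xi, unit_sphere n xi ->
    (1 - e) * slope f xi <= holder_slope f s xi `^ s^-1.
Proof.
move=> /andP[e0 e1]; have [B B1 fB] := lipschitz_integrable_bounded L0 fL fi.
have [c c0 hc] := slope_sphere_gt0 L0 fL fi f_neq0.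
apply: ((compact_near_coveringP _).1 (@compact_unit_sphere R n)) => xi0 Sxi0.
pose s0 := slope f xi0; have s0_gt0 : 0 < s0 by rewrite (lt_le_trans c0)// hc.
(* One [e / 8] is lost by near extremality and one by moving [xi0] to [xi]; together they give the
   [e / 4] in [b]. A further [e / 4] pays for [b ^ (1 / s)]. What is needed at the end is
   [(1 - e) (1 + e / 4) <= (1 - e / 4) ^ 2]. *)
have e8 : 0 < e / 8 * s0 by rewrite mulr_gt0// divr_gt0.
have [x0 [t0 [t0_gt0 hxt]]] := slope_adherent fL xi0 e8.
pose b := (1 - e / 4) * s0 * t0.
have b0 : 0 < b by rewrite !mulr_gt0// subr_gt0 ltr_pdivrMr// mul1r (lt_trans e1)// ltr1n.
have L1 : 0 < L + 1 by rewrite ltr_wpDl.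
have cb : b `^ s^-1 @[s --> 1^'-] --> b.
  rewrite -[X in _ --> X](powRr1 (ltW b0)) -[X in _ `^ X]invr1.
  apply: powR_cvg_exponent => //; apply: cvgV; rewrite ?oner_neq0//.
  exact: cvg_at_left_filter cvg_id.
have e4b : (1 - e / 4) * b < b.
  by rewrite gtr_pMl// ltrBlDr ltrDl divr_gt0.
exists ([set xi | L * `|xi - xi0| <= e / 8 * s0],
  [set s | 0 < s < 1 /\ (1 - e / 4) * b <= b `^ s^-1]).
  split => /=.
    apply/nbhs_ballP; exists (e / 8 * s0 / (L + 1)); first by rewrite /= divr_gt0.
    move=> y; rewrite -ball_normE /= ltr_pdivlMr// mulrC distrC => /ltW; apply: le_trans.
    by rewrite ler_wpM2r// lerDl.
  near=> s; split.
    by apply/andP; split; near: s; [exact: nbhs_left_gt|exact: nbhs_left_lt].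
  near: s; move/cvgrPdist_le : cb => /(_ (b - (1 - e / 4) * b)).
  rewrite subr_gt0 => /(_ e4b); apply: filterS => s.
  by rewrite ler_distlC opprB addrC subrK => /andP[].
move=> [xi s] /= [hxi [s01 hs]].
have [s_gt0 s_lt1] := andP s01.
have h1 : slope f xi <= (1 + e / 4) * s0.
  rewrite (le_trans (slope_le_near fL xi xi0))// -/s0.
  have : 0 <= e * s0 by rewrite mulr_ge0// ltW.
  move: hxi; lra.
have h2 : b <= `|f (x0 + t0 *: xi) - f x0|.
  have : `|f (x0 + t0 *: xi0) - f (x0 + t0 *: xi)| <= t0 * (e / 8 * s0).
    rewrite (le_trans (fL _ _))// opprD addrACA subrr add0r -scalerBr normrZ.
    by rewrite gtr0_norm// mulrCA ler_pM2l// distrC.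
  move: hxt; rewrite ltr_pdivlMr// -/s0 /b => hxt hd.
  have := ler_distD (f (x0 + t0 *: xi)) (f (x0 + t0 *: xi0)) (f x0).
  lra.
have h3 : t0^-1 * b `^ s^-1 <= holder_slope f s xi `^ s^-1.
  have h4 : t0 `^ (- s) * b <= holder_slope f s xi.
    apply: le_trans (holder_slope_ub fL B1 fB xi x0 s01 t0_gt0).
    by rewrite ler_wpM2l ?powR_ge0.
  have -> : t0^-1 * b `^ s^-1 = (t0 `^ (- s) * b) `^ s^-1.
    rewrite powRM ?powR_ge0 ?(ltW b0)// -powRrM mulNr mulfV ?gt_eqF//.
    by rewrite powR_inv1// ltW.
  apply: ge0_ler_powR; rewrite ?nnegrE ?invr_ge0 ?(ltW s_gt0)//.
    by rewrite mulr_ge0 ?powR_ge0// ltW.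
  by rewrite (le_trans _ h4)// mulr_ge0 ?powR_ge0// ltW.
apply: le_trans h3; apply: le_trans (ler_wpM2l _ hs); last first.
  by rewrite invr_ge0 ltW.
have -> : t0^-1 * ((1 - e / 4) * b) = (1 - e / 4) * (1 - e / 4) * s0.
  by rewrite /b; field; rewrite gt_eqF.
apply: le_trans (ler_wpM2l _ h1) _; first by rewrite subr_ge0 ltW.
rewrite mulrA ler_pM2r//.
have : 0 <= e * e by rewrite mulr_ge0// ltW.
lra.
Unshelve. all: by end_near. Qed.

Lemma near_powR_left_1 (c e : R) : 0 < c -> 0 < e ->
  \forall s \near 1^'-, c `^ ((1 - s) / s) <= 1 + e.
Proof.
move=> c0 e0.
have h : c `^ ((1 - s) / s) @[s --> 1^'-] --> (1 : R).
  rewrite -[X in _ --> X](powRr0 c); apply: powR_cvg_exponent => //.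
  rewrite -[X in _ --> X](mul0r (1^-1 : R)) -[X in X * _](subrr 1).
  have cs : (s : R) @[s --> 1^'-] --> (1 : R) by exact: cvg_at_left_filter cvg_id.
  apply: cvgM; last by apply: cvgV; rewrite ?oner_neq0.
  by apply: cvgB => //; exact: cvg_cst.
move/cvgrPdist_le : h => /(_ _ e0); apply: filterS => s.
by rewrite ler_distlC => /andP[].
Qed.

Lemma limit_frac_polar_body_infty (q : R) K :
  dual_mixed_volume q K (frac_polar_body_infty f s) @[s --> 1^'-] -->
    dual_mixed_volume q K (polar_body_infty f).
Proof.
have [B B1 fB] := lipschitz_integrable_bounded L0 fL fi.
have [c c0 hc] := slope_sphere_gt0 L0 fL fi f_neq0.
apply: dual_mixed_volume_cvg => [xi Sxi|e e01].
  by rewrite gauge_polar_body_infty lte_fin ltry andbT (lt_le_trans c0)// hc.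
have [e0 e1] := andP e01.
have BB : 0 < B + B by have := B1; lra.
near=> s => xi Sxi.
have s01 : 0 < s < 1.
  by apply/andP; split; near: s; [exact: nbhs_left_gt|exact: nbhs_left_lt].
have [s0 s1] := andP s01.
rewrite gauge_polar_body_infty gauge_frac_polar_body_infty//.
rewrite -!EFinM !lee_fin; apply/andP; split.
  by move: xi Sxi; near: s; exact: holder_slope_near_ge.
have sl0 := slope_ge0 fL xi.
(* The power [1 / s] of the interpolation bound is the slope times [(B + B) ^ ((1 - s) / s)], and
   the last factor tends to [1] independently of [xi]. *)
apply: (@le_trans _ _ ((slope f xi `^ s * (B + B) `^ (1 - s)) `^ s^-1)).
  apply: ge0_ler_powR; rewrite ?nnegrE ?invr_ge0 ?(ltW s0)//.
  - exact: (holder_slope_ge0 fL B1 fB).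
  - by rewrite mulr_ge0 ?powR_ge0.
  - exact: (holder_slope_le_slope fL B1 fB).
rewrite powRM ?powR_ge0// -!powRrM mulfV ?gt_eqF// powRr1// mulrC.
rewrite ler_wpM2r//; near: s; exact: near_powR_left_1.
Unshelve. all: by end_near. Qed.

End limit_s_to_1.

(** * The limit p to infinity, local case *)

Section limit_p_to_infinity.
Context {R : realType} {n : nat}.
Local Notation lambda := (@lebesgue_rV R n).
Variables (f : 'rV[R]_n -> R) (L : R).
Hypothesis L0 : 0 <= L.
Hypothesis fL : forall x y, `|f x - f y| <= L * `|x - y|.
Hypothesis fi : lambda.-integrable setT (EFin \o f).
Hypothesis f_neq0 : f <> (fun=> 0).
Hypothesis wg : is_weak_gradient f (weak_gradient f).
Hypothesis gi : forall i,
  lambda.-integrable setT (EFin \o (fun x => weak_gradient f x ord0 i)).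
Implicit Types (x xi : 'rV[R]_n) (p : R) (K : set 'rV[R]_n).

Let h xi x : R := dotv (weak_gradient f x) xi.

Let mh xi : measurable_fun setT (h xi).
Proof. by apply: measurable_weak_derivative wg _. Qed.

Let mhp xi p : measurable_fun setT (fun x => (`|h xi x| `^ p)%:E).
Proof.
apply/measurable_EFinP; apply: (measurableT_comp (measurable_powR _)) => //.
exact: measurableT_comp.
Qed.

Lemma gauge_polar_body p xi : 0 < p -> gauge (polar_body f p) xi = polar_gauge f p xi.
Proof.
move=> p0; rewrite /polar_body gauge_set_of_gauge ?poweR_ge0//.
move=> l l0; have li0 : 0 < l^-1 by rewrite invr_gt0.
rewrite /polar_gauge.
under eq_integral => x _.
  rewrite (_ : dotv _ (l^-1 *: xi) = l^-1 * h xi x); last first.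
    by rewrite /h /dotv mulr_sumr; apply: eq_bigr => i _; rewrite mxE mulrCA.
  rewrite normrM powRM// EFinM; over.
rewrite nonneg_integralZl ?powR_gt0 ?normr_gt0 ?gt_eqF//.
rewrite poweRM ?lee_fin ?powR_ge0//; last first.
  by apply: integral_ge0 => x _; rewrite lee_fin powR_ge0.
congr (_ * _)%E; rewrite poweR_EFin -powRrM mulfV ?gt_eqF//.
by rewrite powRr1// gtr0_norm.
Qed.

(** A bound for the [L^1] norm of [<grad f, xi>] that is uniform on the sphere. *)
Let A : R := \sum_(i < n) \int[lambda]_x `|weak_gradient f x ord0 i|.

Let intnorm xi : unit_sphere n xi -> \int[lambda]_x `|h xi x| <= A.
Proof.
move=> Sxi; rewrite /A -Rintegral_sum; last by move=> i; exact: integrable_norm.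
apply: le_Rintegral => //.
- exact/integrable_norm/integrable_weak_derivative.
- by apply: integrable_sum_R => i; exact: integrable_norm.
move=> x _; rewrite (le_trans (ler_norm_sum _ _ _))//; apply: ler_sum => i _.
rewrite normrM ler_piMr// (le_trans (rV_coord_le_norm _ _))//.
exact: sphere_norm_le1.
Qed.

Lemma integral_powR_weak_derivative_le p xi : 1 <= p -> unit_sphere n xi ->
  (\int[lambda]_x (`|h xi x| `^ p)%:E <= (slope f xi `^ (p - 1) * A)%:E)%E.
Proof.
move=> p1 Sxi; have p0 : 0 < p by rewrite (lt_le_trans _ p1).
have hi := integrable_weak_derivative gi xi.
apply: (@le_trans _ _ (\int[lambda]_x ((slope f xi `^ (p - 1))%:E * `|(h xi x)%:E|))%E).
  apply: ae_ge0_le_integral => //.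
  - by move=> x _; rewrite lee_fin mulr_ge0// powR_ge0.
  - apply: measurable_funeM; apply: measurableT_comp => //.
    exact/measurable_EFinP.
  - apply: filterS (slope_ae fL fi wg gi xi) => x hx _.
    rewrite /= -EFinM lee_fin -(mulr_powRB1 _ p0)// mulrC ler_wpM2r//.
    by apply: ge0_ler_powR; rewrite ?nnegrE ?subr_ge0 ?(slope_ge0 fL).
rewrite ge0_integralZl//; last 2 first.
  - apply: measurableT_comp => //; exact/measurable_EFinP.
  - by rewrite lee_fin powR_ge0.
rewrite EFinM lee_wpmul2l ?lee_fin ?powR_ge0//.
rewrite -(fineK (integrable_fin_num measurableT (integrable_norm hi))) lee_fin.
exact: intnorm.
Qed.

Lemma polar_gauge_near_le (e : R) : 0 < e ->
  \forall p \near +oo, forall xi, unit_sphere n xi ->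
    (polar_gauge f p xi <= ((1 + e) * slope f xi)%:E)%E.
Proof.
move=> e0; have [c c0 hc] := slope_sphere_gt0 L0 fL fi f_neq0.
have A0 : 0 <= A by apply: sumr_ge0 => i _; apply: Rintegral_ge0.
(* Dividing by the lower bound [c] of the slope replaces the power [p - 1] by [p]; adding [1] makes
   [C] positive, so that [C ^ (1 / p)] tends to [1]. *)
pose C := A / c + 1; have C0 : 0 < C by rewrite ltr_wpDl// divr_ge0// ltW.
near=> p => xi Sxi.
have p1 : 1 <= p by near: p; exact: nbhs_pinfty_ge.
have p0 : 0 < p by rewrite (lt_le_trans _ p1).
have sl0 : 0 < slope f xi by rewrite (lt_le_trans c0)// hc.
have hA : slope f xi `^ (p - 1) * A <= slope f xi `^ p * C.
  rewrite -(mulr_powRB1 (ltW sl0) p0) [slope f xi * _]mulrC -mulrA.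
  rewrite ler_wpM2l ?powR_ge0// /C mulrDr mulr1 mulrCA.
  rewrite (@le_trans _ _ (A * (slope f xi / c)))//; last by rewrite lerDl ltW.
  by rewrite ler_peMr// ler_pdivlMr// mul1r hc.
have hAe : (\int[lambda]_x (`|h xi x| `^ p)%:E <= (slope f xi `^ p * C)%:E)%E.
  by rewrite (le_trans (integral_powR_weak_derivative_le p1 Sxi))// lee_fin.
apply: (@le_trans _ _ ((slope f xi `^ p * C)%:E `^ p^-1)%E).
  apply: gt0_ler_poweR => //; rewrite ?invr_ge0 ?(ltW p0)// in_itv/= ?leey ?andbT.
    by apply: integral_ge0 => x _; rewrite lee_fin powR_ge0.
  by rewrite lee_fin mulr_ge0 ?powR_ge0// ltW.
rewrite poweR_EFin lee_fin powRM ?powR_ge0 ?(ltW C0)// -powRrM mulfV ?gt_eqF//.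
rewrite powRr1 ?(ltW sl0)// mulrC ler_wpM2r ?(ltW sl0)//.
have /andP[] // : 1 - e <= C `^ p^-1 <= 1 + e.
by near: p; exact: near_powR_invr.
Unshelve. all: by end_near. Qed.

(** The set [E] where [|<grad f, xi0>|] is nearly its essential supremum has positive measure. For
    [xi] near [xi0] the derivative along [xi] is still at least [b] almost everywhere on [E], and
    the measure of [E] enters only through a [p]-th root. *)
Lemma polar_gauge_near_ge (e : R) : 0 < e < 1 ->
  \forall p \near +oo, forall xi, unit_sphere n xi ->
    (((1 - e) * slope f xi)%:E <= polar_gauge f p xi)%E.
Proof.
move=> /andP[e0 e1]; have [c c0 hc] := slope_sphere_gt0 L0 fL fi f_neq0.
apply: ((compact_near_coveringP _).1 (@compact_unit_sphere R n)) => xi0 Sxi0.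
pose s0 := slope f xi0; have s0_gt0 : 0 < s0 by rewrite (lt_le_trans c0)// hc.
pose E : set 'rV[R]_n := [set x | (1 - e / 4) * s0 < `|h xi0 x|].
have mE : measurable E.
  rewrite (_ : E = (fun x => `|h xi0 x|) @^-1` `](1 - e / 4) * s0, +oo[%classic).
    rewrite -[X in measurable X]setTI.
    by apply: (measurableT_comp _ (mh xi0)) => //; exact: measurable_itv.
  by apply/seteqP; split=> x; rewrite /E /= in_itv/= andbT.
have s1_ge0 : 0 <= (1 - e / 4) * s0 by rewrite mulr_ge0 ?(ltW s0_gt0)//; lra.
have E0 : (0 < lambda E)%E.
  rewrite lt0e measure_ge0 andbT; apply/eqP => E0.
  have : slope f xi0 <= (1 - e / 4) * s0.
    apply: (slope_le_ae L0 fL fi wg gi) => //.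
    exists E; split=> // x /= /negP; rewrite -ltNge; exact.
  rewrite -/s0 -[X in X <= _]mul1r ler_pM2r//; lra.
(* A positive real below the measure of [E] spares a separate treatment of infinite measure. *)
have [m m0 mE_le] : exists2 m : R, 0 < m & (m%:E <= lambda E)%E.
  move: E0; case: (lambda E) => [r| |]//; last by exists 1 => //; exact: leey.
  by rewrite lte_fin => r0; exists r.
have L1 : 0 < L + 1 by rewrite ltr_wpDl.
have e4 : 0 < e / 4 * s0 by rewrite mulr_gt0// divr_gt0.
exists ([set xi | L * `|xi - xi0| <= e / 4 * s0],
  [set p | 1 <= p /\ 1 - e / 8 <= m `^ p^-1]).
  split => /=.
    apply/nbhs_ballP; exists (e / 4 * s0 / (L + 1)); first by rewrite /= divr_gt0.
    move=> y; rewrite -ball_normE /= ltr_pdivlMr// mulrC distrC => /ltW; apply: le_trans.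
    by rewrite ler_wpM2r// lerDl.
  near=> p; split; first by near: p; exact: nbhs_pinfty_ge.
  have /andP[] // : 1 - e / 8 <= m `^ p^-1 <= 1 + e / 8.
  by near: p; apply: near_powR_invr => //; rewrite divr_gt0.
move=> [xi p] /= [hxi [p1 mp]]; have p0 : 0 < p by rewrite (lt_le_trans _ p1).
have h1 : slope f xi <= (1 + e / 4) * s0.
  rewrite (le_trans (slope_le_near fL xi xi0))// -/s0; move: hxi; lra.
pose b := (1 - e / 2) * s0.
have b0 : 0 < b by rewrite mulr_gt0//; lra.
have hb : ((b `^ p * m)%:E <= \int[lambda]_x (`|h xi x| `^ p)%:E)%E.
  apply: (@le_trans _ _ (\int[lambda]_x ((b `^ p)%:E * (\1_E x)%:E))%E).
    rewrite nonneg_integralZl ?powR_gt0//.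
    by rewrite integral_indic// setIT EFinM lee_wpmul2l// lee_fin powR_ge0.
  apply: ae_ge0_le_integral => //.
  - by move=> x _; rewrite -EFinM lee_fin mulr_ge0// powR_ge0.
  - by apply: measurable_funeM; apply/measurable_EFinP; exact: measurable_indic.
  (* The change of direction is controlled almost everywhere by the slope along [xi0 - xi]. The
     exceptional null set may depend on [xi], which is fixed here. *)
  apply: filterS (slope_ae fL fi wg gi (xi0 - xi)) => x hx _.
  rewrite /= -EFinM lee_fin indicE; case: (boolP (x \in E)) => [/set_mem Ex|_]; last first.
    by rewrite mulr0 powR_ge0.
  rewrite mulr1; apply: ge0_ler_powR; rewrite ?nnegrE ?(ltW p0) ?(ltW b0)//.
  have hsub : dotv (weak_gradient f x) (xi0 - xi) = h xi0 x - h xi x.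
    by rewrite /h /dotv -sumrB; apply: eq_bigr => i _; rewrite !mxE mulrBr.
  move: hx; rewrite hsub => hx.
  have hs := slope_le_norm fL (xi0 - xi); rewrite distrC in hs.
  have := ler_normD (h xi0 x - h xi x) (h xi x); rewrite subrK.
  move: Ex; rewrite /E /b /=; move: hxi hs hx; lra.
apply: (@le_trans _ _ ((b `^ p * m)%:E `^ p^-1)%E); last first.
  apply: gt0_ler_poweR => //; rewrite ?invr_ge0 ?(ltW p0)// in_itv/= ?leey ?andbT.
    by rewrite lee_fin mulr_ge0 ?powR_ge0// ltW.
  by apply: integral_ge0 => x _; rewrite lee_fin powR_ge0.
rewrite poweR_EFin lee_fin powRM ?powR_ge0 ?(ltW m0)// -powRrM mulfV ?gt_eqF//.
rewrite powRr1 ?(ltW b0)//.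
apply: le_trans (ler_wpM2l (ltW b0) mp).
apply: le_trans (ler_wpM2l _ h1) _; first by rewrite subr_ge0 ltW.
rewrite /b mulrA [leRHS]mulrAC ler_pM2r//.
have : 0 <= e * e by rewrite mulr_ge0// ltW.
lra.
Unshelve. all: by end_near. Qed.

Lemma limit_polar_body (q : R) K :
  dual_mixed_volume q K (polar_body f p) @[p --> +oo] -->
    dual_mixed_volume q K (polar_body_infty f).
Proof.
have [c c0 hc] := slope_sphere_gt0 L0 fL fi f_neq0.
apply: dual_mixed_volume_cvg => [xi Sxi|e e01].
  by rewrite (gauge_polar_body_infty L0 fL)// lte_fin ltry andbT (lt_le_trans c0)// hc.
have [e0 e1] := andP e01.
near=> p => xi Sxi.
have p0 : 0 < p by near: p; exact: nbhs_pinfty_gt.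
rewrite (gauge_polar_body_infty L0 fL)// gauge_polar_body// -!EFinM; apply/andP; split.
  by move: xi Sxi; near: p; exact: polar_gauge_near_ge.
by move: xi Sxi; near: p; exact: polar_gauge_near_le.
Unshelve. all: by end_near. Qed.

End limit_p_to_infinity.

(** * The limit p to infinity, fractional case *)

Section scaling.
Context {R : realType}.
Local Open Scope ereal_scope.

(** Uniqueness again, with intervals as test sets; it is what the homogeneity of the fractional
    gauges requires. *)
Lemma lebesgue_measure_scaling (c : R) (c0 : (0 < c)%R) (A : set (measurableTypeR R)) :
  measurable A ->
  lebesgue_measure A =
  c%:E * pushforward (@lebesgue_measure R)
    (fun x : measurableTypeR R => (c * x)%R : measurableTypeR R) A.
Proof.
move=> mA; have mc : measurable_fun setT
    (fun x : measurableTypeR R => (c * x)%R : measurableTypeR R).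
  exact: measurable_funM.
pose nu := measure_function_pushforward__canonical__measure_function_Measure
  (@lebesgue_measure R) mc.
pose mu := mscale (NngNum (ltW c0)) nu.
rewrite -[RHS]/(mu A); apply: lebesgue_measure_unique => //.
move=> _ [[a b] _ <-].
rewrite [RHS](_ : _ = c%:E * lebesgue_measure `](a / c)%R, (b / c)%R]%classic).
  rewrite !lebesgue_measure_itv/= !lte_fin ltr_pM2r ?invr_gt0//.
  case: ifPn => // _; last by rewrite mule0.
  by rewrite -!EFinB -EFinM -mulrBl mulrCA mulfV ?gt_eqF// mulr1.
rewrite /mu /= /mscale /= /pushforward; congr (_ * lebesgue_measure _).
by apply/seteqP; split=> x /=; rewrite !in_itv/= ltr_pdivrMr// ler_pdivlMr// (mulrC c).
Qed.

Lemma ge0_integral_scaling (c : R) (F : R -> \bar R) : (0 < c)%R ->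
  measurable_fun setT F -> (forall x, 0 <= F x) ->
  \int[@lebesgue_measure R]_(x in `]0%R, +oo[) F x =
  c%:E * \int[@lebesgue_measure R]_(x in `]0%R, +oo[) F (c * x)%R.
Proof.
move=> c0 mF F0; have mc : measurable_fun setT
    (fun x : measurableTypeR R => (c * x)%R : measurableTypeR R).
  exact: measurable_funM.
pose nu := measure_function_pushforward__canonical__measure_function_Measure
  (@lebesgue_measure R) mc.
transitivity (\int[mscale (NngNum (ltW c0)) nu]_(x in `]0%R, +oo[) F x).
  by apply: eq_measure_integral => A mA _; exact: lebesgue_measure_scaling.
rewrite ge0_integral_mscale//; last exact: measurable_funTS.
congr (_ * _).
rewrite [LHS](@ge0_integral_pushforward _ _ _ _ _ _ mc lebesgue_measure)//.
  congr (integral _ _ _); apply/seteqP; split=> x /=; rewrite !in_itv/= !andbT;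
    by rewrite pmulr_rgt0.
exact: measurable_funTS.
Qed.

End scaling.

Section frac_gauge.
Context {R : realType} {n : nat}.
Local Notation lambda := (@lebesgue_rV R n).
Variables (f : 'rV[R]_n -> R).
Hypothesis mf : measurable_fun setT f.
Implicit Types (x xi : 'rV[R]_n) (s p t : R).

Let J p xi t : \bar R := (\int[lambda]_x (`|f (x + t *: xi) - f x| `^ p)%:E)%E.

Lemma measurable_increment p xi : measurable_fun setT
  (fun tx : measurableTypeR R * 'rV[R]_n =>
    (`|f (tx.2 + (tx.1 : R) *: xi) - f tx.2| `^ p)%:E).
Proof.
apply/measurable_EFinP; apply: (measurableT_comp (measurable_powR _)) => //.
apply: measurableT_comp => //; apply: measurable_funB.
  by apply: (measurableT_comp mf); exact: measurable_scalar_add.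
by apply: (measurableT_comp mf); exact: measurable_snd.
Qed.

Let mJ p xi : measurable_fun setT (J p xi).
Proof.
have := measurable_fun_fubini_tonelli_F (m2 := lambda)
  (fun tx : measurableTypeR R * 'rV[R]_n =>
    (`|f (tx.2 + (tx.1 : R) *: xi) - f tx.2| `^ p)%:E).
apply; first exact: measurable_increment.
by move=> tx; rewrite lee_fin powR_ge0.
Qed.

Let J_ge0 p xi t : (0 <= J p xi t)%E.
Proof. by apply: integral_ge0 => x _; rewrite lee_fin powR_ge0. Qed.

Lemma measurable_frac_integrand s p xi : measurable_fun setT
  (fun t : R => ((t `^ (- (p * s) - 1))%:E * J p xi t)%E).
Proof.
apply: emeasurable_funM; last exact: mJ.
exact/measurable_EFinP.
Qed.

Lemma gauge_frac_polar_body s p xi : 0 < s < 1 -> 0 < p ->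
  gauge (frac_polar_body f s p) xi = frac_polar_gauge f s p xi.
Proof.
move=> /andP[s0 s1] p0; have ps0 : 0 < p * s by rewrite mulr_gt0.
rewrite /frac_polar_body gauge_set_of_gauge ?poweR_ge0//.
move=> l l0; have li0 : 0 < l^-1 by rewrite invr_gt0.
rewrite /frac_polar_gauge.
set I := (X in (_ = _ * (_ * X) `^ _)%E).
set I' := (X in ((_ * X) `^ _ = _)%E).
have I0 : (0 <= I)%E.
  by apply: integral_ge0 => t _; rewrite mule_ge0 ?lee_fin ?powR_ge0//; exact: J_ge0.
have II' : I' = ((l^-1 `^ (p * s))%:E * I)%E.
  rewrite /I (ge0_integral_scaling li0 (measurable_frac_integrand s p xi)); last first.
    by move=> t; rewrite mule_ge0 ?lee_fin ?powR_ge0.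
  rewrite -!nonneg_integralZl ?powR_gt0//; last 2 first.
  - by move=> t _; rewrite !mule_ge0 ?lee_fin ?powR_ge0// ltW.
  - by move=> t _; rewrite !mule_ge0 ?lee_fin ?powR_ge0// ltW.
  apply: eq_integral => t; rewrite inE/= in_itv/= andbT => t0.
  have -> : J p xi (l^-1 * t) = J p (l^-1 *: xi) t.
    by apply: eq_integral => x _; rewrite scalerA [t * _]mulrC.
  (* The factor [l^-1] from the change of variable and the power [- p s - 1] from the weight leave
     [- p s], which the factor in front cancels. *)
  have E : l^-1 `^ (p * s) * (l^-1 * (l^-1 * t) `^ (- (p * s) - 1)) =
      t `^ (- (p * s) - 1).
    have ln0 : l^-1 != 0 by rewrite invr_eq0 gt_eqF.
    rewrite powRM ?(ltW li0) ?(ltW t0)// !mulrA -[RHS]mul1r; congr (_ * _).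
    rewrite -{2}(powRr1 (ltW li0)) -!powRD ?ln0 ?implybT//.
    by rewrite addrA addrAC addrK subrr powRr0.
  by rewrite -E !EFinM -!muleA.
have K0 : (0 <= (p * (1 - s))%:E * I)%E.
  by rewrite mule_ge0// lee_fin mulr_ge0 ?subr_ge0 ?ltW.
clearbody I I'; rewrite II' [X in (X `^ _ = _)%E]muleCA.
have E2 : ((l^-1 `^ (p * s))%:E `^ (p * s)^-1 = (l^-1)%:E)%E.
  by rewrite poweR_EFin -powRrM mulfV ?gt_eqF// powRr1// ltW.
rewrite -E2 -poweRM//.
by rewrite lee_fin powR_ge0.
Qed.

End frac_gauge.

(** The quadratic term of the exponential series at [p ln b] already beats [p E]. This absorbs the
    factor [p] in the fractional gauge. *)
Lemma near_linear_le_powR (R : realType) (E b : R) : 0 <= E -> 1 < b ->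
  \forall p \near +oo, p * E <= b `^ p.
Proof.
move=> E0 b1; have b0 : 0 < b by rewrite (lt_trans _ b1).
have k0 : 0 < ln b by rewrite ln_gt0.
near=> p.
have p0 : 0 < p by near: p; exact: nbhs_pinfty_gt.
rewrite /powR gt_eqF//; have := @expR_ge1Dxn R (p * ln b) 1 (mulr_ge0 (ltW p0) (ltW k0)).
apply: le_trans; rewrite (@le_trans _ _ ((p * ln b) ^+ 2 / 2`!%:R))//; last by rewrite lerDr.
have : 2 * E / (ln b ^+ 2) <= p by near: p; apply: nbhs_pinfty_ge; exact: num_real.
rewrite ler_pdivrMr ?exprn_gt0// => h.
rewrite (_ : 2`! = 2)%N// ler_pdivlMr// exprMn [p ^+ 2]expr2 -!mulrA ler_pM2l//.
by rewrite mulrC.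
Unshelve. all: by end_near. Qed.

Section frac_polar_gauge_upper.
Context {R : realType} {n : nat}.
Local Notation lambda := (@lebesgue_rV R n).
Variables (f : 'rV[R]_n -> R) (L B : R).
Hypothesis L0 : 0 <= L.
Hypothesis fL : forall x y, `|f x - f y| <= L * `|x - y|.
Hypothesis B1 : 1 <= B.
Hypothesis fB : forall x, `|f x| <= B.
Hypothesis fi : lambda.-integrable setT (EFin \o f).
Hypothesis f_neq0 : f <> (fun=> 0).
Variable s : R.
Hypothesis s01 : 0 < s < 1.
Implicit Types (x xi : 'rV[R]_n) (t p : R) (K : set 'rV[R]_n).

Let s0 : 0 < s. Proof. by case/andP : s01. Qed.
Let s1 : s < 1. Proof. by case/andP : s01. Qed.

Local Notation F1 := (\int[lambda]_x `|f x|).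

Let mf : measurable_fun setT f.
Proof. by case/integrableP : fi => /measurable_EFinP. Qed.

(** The two powers serve [t <= 1] and [t > 1]. The factor [2] bounds [1 + t ^ 2] on the former range
    and [(1 + t ^ 2) / t ^ 2] on the latter. *)
Definition kernel_bound (a : R) : R :=
  2 * (L `^ (a - 1) + (B + B) `^ (a - 1)).

(* For [p >= a], [|D|^p] is split as [|D|^(p - a) * |D|^(a - 1) * |D|]: the first
   factor is at most [(holder_slope * t^s)^(p - a)], the last one is integrable in
   [x], and the conditions on [a] make what remains of the weight in [t]
   integrable near [0] and near [+oo]. *)
Section exponent_splitting.
Variable a : R.
Hypothesis as_ge : 2 <= a * (1 - s).
Hypothesis as_ge1 : 1 <= a * s.

Let a_ge1 : 1 <= a. Proof. by move: as_ge as_ge1; lra. Qed.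

Local Notation D1 := (kernel_bound a).

Let D1_ge0 : 0 <= D1.
Proof. by rewrite mulr_ge0// addr_ge0// powR_ge0. Qed.

(** For [t <= 1] the bound [D <= L t] leaves [t ^ (a (1 - s) - 2)], at most [1] by [as_ge]. For
    [t > 1] the bound [D <= B + B] leaves [t ^ (- a s - 1)], at most [t ^ (-2)] by [as_ge1]. Both
    are absorbed by [1 / (1 + t ^ 2)], whose integral over the half-line is [pi / 2]. *)
Lemma increment_kernel_le xi x t : `|xi| <= 1 -> 0 < t ->
  t `^ (- (a * s) - 1) * `|f (x + t *: xi) - f x| `^ (a - 1) <= D1 / (1 + t ^+ 2).
Proof.
move=> xi1 t0; set D := `|_ - _|; have D0 : 0 <= D by rewrite /D.
have a10 : 0 <= a - 1 by rewrite subr_ge0.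
have t2 : 0 < 1 + t ^+ 2 by rewrite ltr_pwDl// sqr_ge0.
have B0 : 0 <= B + B by have := B1; lra.
rewrite ler_pdivlMr//.
have [t1|t1] := leP t 1.
  have hD : D <= L * t.
    rewrite (le_trans (lipschitz_increment fL _ _ _))// gtr0_norm// mulrCA mulrA.
    by rewrite ler_piMr// mulr_ge0// ltW.
  have h1 : t `^ (- (a * s) - 1) * D `^ (a - 1) <= L `^ (a - 1).
    apply: (@le_trans _ _ (t `^ (- (a * s) - 1) * (L * t) `^ (a - 1))).
      rewrite ler_wpM2l ?powR_ge0//; apply: ge0_ler_powR; rewrite ?nnegrE//.
        by rewrite mulr_ge0// ltW.
    rewrite powRM ?(ltW t0)// mulrCA -powRD; last by rewrite (gt_eqF t0) implybT.
    rewrite ler_piMr ?powR_ge0// -[leRHS](powRr0 t).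
    apply: ger_powR; first by rewrite t0.
    by have := as_ge; rewrite mulrBr mulr1; lra.
  have h2 : 1 + t ^+ 2 <= 2 by have := exprn_ile1 2 (ltW t0) t1; lra.
  apply: (@le_trans _ _ (L `^ (a - 1) * 2)).
    by apply: ler_pM => //; rewrite ?mulr_ge0 ?powR_ge0// ltW.
  by rewrite /kernel_bound mulrC ler_pM2l// lerDl powR_ge0.
have hD : D `^ (a - 1) <= (B + B) `^ (a - 1).
  apply: ge0_ler_powR; rewrite ?nnegrE//.
  exact: increment_le_bound.
have h1 : t `^ (- (a * s) - 1) <= (t ^+ 2)^-1.
  rewrite -(powR_invn 2 (ltW t0)); apply: ler_powR; first exact: ltW.
  have := as_ge1; lra.
have tt : 0 < t ^+ 2 by rewrite exprn_gt0.
apply: (@le_trans _ _ ((t ^+ 2)^-1 * (B + B) `^ (a - 1) * (1 + t ^+ 2))).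
  rewrite ler_wpM2r ?(ltW t2)//; apply: ler_pM; rewrite ?powR_ge0//.
rewrite -mulrA mulrC ler_pdivrMr// /kernel_bound.
have : 1 <= t ^+ 2 by rewrite exprn_ege1// ltW.
have := powR_ge0 L (a - 1); have := powR_ge0 (B + B) (a - 1).
move: (L `^ _) ((B + B) `^ _) (t ^+ 2) => u v w u0 v0 w1.
nra.
Qed.

Lemma frac_kernel_le xi x t p : `|xi| <= 1 -> 0 < t -> a <= p ->
  t `^ (- (p * s) - 1) * `|f (x + t *: xi) - f x| `^ p <=
  holder_slope f s xi `^ (p - a) * (D1 / (1 + t ^+ 2)) * `|f (x + t *: xi) - f x|.
Proof.
move=> xi1 t0 ap; have := increment_kernel_le x xi1 t0; set D := `|_ - _|.
have D0 : 0 <= D by rewrite /D.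
set M := holder_slope f s xi => hk.
have M0 : 0 <= M by exact: (holder_slope_ge0 fL B1 fB).
have hD : D <= M * t `^ s.
  have := holder_slope_ub fL B1 fB xi x s01 t0.
  by rewrite powRN mulrC ler_pdivrMr ?powR_gt0.
have pa : 0 <= p - a by rewrite subr_ge0.
have a0 : 0 < a by rewrite (lt_le_trans _ a_ge1).
have -> : D `^ p = D `^ (p - a) * (D `^ (a - 1) * D).
  rewrite [_ * D]mulrC mulr_powRB1// -powRD ?subrK//.
  by rewrite gt_eqF// (lt_le_trans a0).
apply: (@le_trans _ _ (t `^ (- (p * s) - 1) * ((M * t `^ s) `^ (p - a) * (D `^ (a - 1) * D)))).
  rewrite ler_wpM2l ?powR_ge0// ler_wpM2r ?mulr_ge0 ?powR_ge0//.
  by apply: ge0_ler_powR; rewrite ?nnegrE ?mulr_ge0 ?powR_ge0.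
have -> : t `^ (- (p * s) - 1) * ((M * t `^ s) `^ (p - a) * (D `^ (a - 1) * D)) =
    M `^ (p - a) * (t `^ (- (a * s) - 1) * D `^ (a - 1)) * D.
  rewrite powRM ?powR_ge0// -powRrM.
  have -> : t `^ (- (a * s) - 1) = t `^ (- (p * s) - 1) * t `^ (s * (p - a)).
    rewrite -powRD; last by rewrite (gt_eqF t0) implybT.
    by congr (_ `^ _); ring.
  ring.
by rewrite ler_wpM2r// ler_wpM2l ?powR_ge0.
Qed.

Lemma integral_increment_le (v : 'rV[R]_n) :
  (\int[lambda]_x (`|f (x + v) - f x|)%:E <= (F1 + F1)%:E)%E.
Proof.
have nf := integrable_norm fi.
have mft : measurable_fun setT (fun x : 'rV[R]_n => `|f (x + v)|%:E).
  apply/measurable_EFinP; apply: measurableT_comp => //.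
  by apply: (measurableT_comp mf); exact: measurable_addv.
have mfn : measurable_fun setT (fun x : 'rV[R]_n => `|f x|%:E).
  by apply/measurable_EFinP; exact: measurableT_comp.
apply: (@le_trans _ _ (\int[lambda]_x (`|f (x + v)|%:E + `|f x|%:E))%E).
  by apply: nonneg_le_integral => x _; rewrite lee_fin// ler_normB.
rewrite ge0_integralD//.
rewrite (ge0_integral_translation v (F := fun x => `|f x|%:E))//.
by rewrite EFinD -(fineK (integrable_fin_num measurableT nf)).
Qed.

Lemma frac_integral_le xi p : `|xi| <= 1 -> a <= p ->
  (\int[lebesgue_measure]_(t in `]0%R, +oo[)
     ((t `^ (- (p * s) - 1))%:E *
      \int[lambda]_x (`|f (x + t *: xi) - f x| `^ p)%:E) <=
   (holder_slope f s xi `^ (p - a) * (D1 * (F1 + F1) * (pi / 2)))%:E)%E.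
Proof.
move=> xi1 ap; set M := holder_slope f s xi.
have F0 : 0 <= F1 by apply: Rintegral_ge0.
pose k := M `^ (p - a) * (D1 * (F1 + F1)).
have k0 : 0 <= k.
  by apply: mulr_ge0; [exact: powR_ge0|apply: mulr_ge0 => //; exact: addr_ge0].
have H t : 0 < t -> ((t `^ (- (p * s) - 1))%:E *
      \int[lambda]_x (`|f (x + t *: xi) - f x| `^ p)%:E <=
      k%:E * ((oneDsqr t)^-1)%:E)%E.
  move=> t0; rewrite -nonneg_integralZl ?powR_gt0//.
  have c0 : 0 <= M `^ (p - a) * (D1 / (1 + t ^+ 2)).
    by rewrite mulr_ge0 ?powR_ge0// divr_ge0// addr_ge0// sqr_ge0.
  have mD : measurable_fun setT (fun x : 'rV[R]_n => `|f (x + t *: xi) - f x|%:E).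
    apply/measurable_EFinP; apply: measurableT_comp => //; apply: measurable_funB => //.
    by apply: (measurableT_comp mf); exact: measurable_addv.
  apply: (@le_trans _ _ (\int[lambda]_x ((M `^ (p - a) * (D1 / (1 + t ^+ 2)))%:E *
      `|f (x + t *: xi) - f x|%:E))%E).
    apply: nonneg_le_integral => x _; rewrite -EFinM lee_fin.
      by rewrite mulr_ge0 ?powR_ge0.
    exact: frac_kernel_le.
  rewrite ge0_integralZl//.
  apply: le_trans (lee_wpmul2l _ (integral_increment_le (t *: xi))) _.
    by rewrite lee_fin.
  rewrite -!EFinM lee_fin /k /oneDsqr le_eqVlt; apply/orP; left; apply/eqP.
  ring.
apply: (@le_trans _ _ (\int[lebesgue_measure]_(t in `]0%R, +oo[)
    (k%:E * ((oneDsqr t)^-1)%:E))%E).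
  apply: nonneg_le_integral => t; rewrite /= in_itv/= andbT => t0; last exact: H.
  rewrite mule_ge0 ?lee_fin ?powR_ge0//.
  by apply: integral_ge0 => x _; rewrite lee_fin powR_ge0.
apply: (@le_trans _ _ (\int[lebesgue_measure]_(t in `[0%R, +oo[)
    (k%:E * ((oneDsqr t)^-1)%:E))%E).
  apply: ge0_subset_integral => //.
  - apply: measurable_funeM; apply/measurable_EFinP.
    apply: measurable_funTS; apply: continuous_measurable_fun.
    exact: continuous_oneDsqrV.
  - by move=> t _; rewrite -EFinM lee_fin mulr_ge0// invr_ge0 addr_ge0// sqr_ge0.
  - by move=> t /=; rewrite !in_itv/= !andbT => /ltW.
rewrite ge0_integralZl//; last first.
  apply/measurable_EFinP; apply: measurable_funTS; apply: continuous_measurable_fun.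
  exact: continuous_oneDsqrV.
by rewrite integral0y_oneDsqr -EFinM lee_fin /k !mulrA.
Qed.

End exponent_splitting.

Lemma frac_polar_gauge_near_le (e : R) : 0 < e ->
  \forall p \near +oo, forall xi, unit_sphere n xi ->
    (frac_polar_gauge f s p xi <= ((1 + e) * holder_slope f s xi `^ s^-1)%:E)%E.
Proof.
move=> e0; have [c c0 hc] := holder_slope_sphere_gt0 L0 fL B1 fB fi f_neq0 s01.
(* Each summand alone secures one of the two conditions on [a]. *)
pose a := 2 / (1 - s) + s^-1.
have as_ge : 2 <= a * (1 - s).
  have h : 0 < 1 - s by rewrite subr_gt0.
  by rewrite mulrDl divfK ?gt_eqF// lerDl mulr_ge0 ?(ltW h)// invr_ge0 ltW.
have as_ge1 : 1 <= a * s.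
  have h : 0 < 1 - s by rewrite subr_gt0.
  rewrite mulrDl mulVf ?gt_eqF// lerDr mulr_ge0 ?(ltW s0)//.
  by rewrite divr_ge0 ?(ltW h).
have a_ge1 : 1 <= a by move: as_ge as_ge1; lra.
move: a as_ge as_ge1 a_ge1 => a as_ge as_ge1 a_ge1.
have F0 : 0 <= F1 by apply: Rintegral_ge0.
pose D2 := kernel_bound a * (F1 + F1) * (pi / 2).
have D20 : 0 <= D2.
  apply: mulr_ge0; last by rewrite divr_ge0// pi_ge0.
  by apply: mulr_ge0; [rewrite mulr_ge0// addr_ge0// powR_ge0|exact: addr_ge0].
(* The power [M ^ (p - a)] is at most [M ^ p * c ^ (- a)] uniformly on the sphere; the remaining
   [p * E] is then dominated by [((1 + e) ^ s) ^ p], whose root of order [p s] is [1 + e]. *)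
pose E := D2 * c `^ (- a).
have E0 : 0 <= E by rewrite mulr_ge0 ?powR_ge0.
have b1 : 1 < (1 + e) `^ s.
  rewrite /powR gt_eqF ?addr_gt0//.
  by rewrite -[ltLHS](@expR0 R) ltr_expR mulr_gt0// ln_gt0// ltrDl.
near=> p => xi Sxi.
have ap : a <= p by near: p; apply: nbhs_pinfty_ge; exact: num_real.
have a0 : 0 < a by rewrite (lt_le_trans _ a_ge1).
have p0 : 0 < p by rewrite (lt_le_trans a0).
have ps0 : 0 < p * s by rewrite mulr_gt0.
set M := holder_slope f s xi.
have M0 : 0 < M by rewrite (lt_le_trans c0)// hc.
have h : (p * (1 - s)) * (M `^ (p - a) * D2) <= M `^ p * ((1 + e) `^ s) `^ p.
  have hE : p * E <= ((1 + e) `^ s) `^ p by near: p; exact: near_linear_le_powR.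
  apply: le_trans (ler_wpM2l (powR_ge0 _ _) hE).
  have -> : p * (1 - s) * (M `^ (p - a) * D2) = M `^ p * (p * (D2 * M `^ (- a))) * (1 - s).
    rewrite powRD; last by rewrite (gt_eqF M0) implybT.
    ring.
  have h1 : M `^ p * (p * (D2 * M `^ (- a))) <= M `^ p * (p * E).
    rewrite ler_wpM2l ?powR_ge0// ler_wpM2l ?(ltW p0)// ler_wpM2l//.
    rewrite !powRN lef_pV2 ?posrE ?powR_gt0//.
    by apply: ge0_ler_powR; rewrite ?nnegrE ?(ltW a0) ?(ltW c0) ?(ltW M0)// hc.
  apply: le_trans h1; apply: ler_piMr; last by rewrite lerBlDr lerDl ltW.
  rewrite mulr_ge0 ?powR_ge0//; apply: mulr_ge0; first exact: ltW.
  by rewrite mulr_ge0 ?powR_ge0.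
have q0 : 0 <= p * (1 - s) by rewrite mulr_ge0 ?(ltW p0)// subr_ge0 ltW.
have hE := frac_integral_le as_ge as_ge1 (sphere_norm_le1 Sxi) ap.
rewrite /frac_polar_gauge.
apply: (@le_trans _ _ ((M `^ p * ((1 + e) `^ s) `^ p)%:E `^ (p * s)^-1)%E).
  apply: gt0_ler_poweR; rewrite ?invr_ge0 ?(ltW ps0)// ?in_itv/= ?leey ?andbT.
  - rewrite mule_ge0 ?lee_fin//; apply: integral_ge0 => t _.
    rewrite mule_ge0 ?lee_fin ?powR_ge0//.
    by apply: integral_ge0 => x _; rewrite lee_fin powR_ge0.
  - by rewrite lee_fin mulr_ge0 ?powR_ge0.
  - apply: (@le_trans _ _ ((p * (1 - s)) * (M `^ (p - a) * D2))%:E); last by rewrite lee_fin.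
    by rewrite [leRHS]EFinM lee_wpmul2l// lee_fin.
rewrite poweR_EFin lee_fin powRM ?powR_ge0// -!powRrM [s * (p * _)]mulrA.
have -> : p * (p * s)^-1 = s^-1 by rewrite invfM mulrA mulfV ?gt_eqF// mul1r.
have -> : s * p * (p * s)^-1 = 1 by rewrite [s * p]mulrC mulfV ?gt_eqF.
by rewrite powRr1 ?addr_ge0 ?(ltW e0)// mulrC.
Unshelve. all: by end_near. Qed.

End frac_polar_gauge_upper.

Section frac_polar_gauge_lower.
Context {R : realType} {n : nat}.
Local Notation lambda := (@lebesgue_rV R n).
Variables (f : 'rV[R]_n -> R) (L B : R).
Hypothesis L0 : 0 <= L.
Hypothesis fL : forall x y, `|f x - f y| <= L * `|x - y|.
Hypothesis B1 : 1 <= B.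
Hypothesis fB : forall x, `|f x| <= B.
Variable s : R.
Hypothesis s01 : 0 < s < 1.
Implicit Types (x xi : 'rV[R]_n) (t p : R) (K : set 'rV[R]_n).

Let s0 : 0 < s. Proof. by case/andP : s01. Qed.
Let s1 : s < 1. Proof. by case/andP : s01. Qed.

(** A nearly extremal triple stays so under small changes of direction, base point and step. Steps
    are taken just below [t0], so that [t ^ s <= t0 ^ s]. *)
Lemma holder_slope_adherent xi0 (M : R) : 0 <= M < holder_slope f s xi0 ->
  exists x0 t0 r, [/\ 0 < r, r <= t0 / 2 &
    forall xi x t, `|xi - xi0| <= r -> `|x - x0| <= r -> t0 - r < t < t0 ->
      M * t `^ s <= `|f (x + t *: xi) - f x|].
Proof.
move=> /andP[M0 MH].
have e0 : 0 < holder_slope f s xi0 - M by rewrite subr_gt0.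
have [_ [[x0 t0] /= t0_gt0 <-]] :=
  sup_adherent e0 (holder_slope_has_sup fL B1 fB xi0 s01).
rewrite -/(holder_slope f s xi0) opprB addrC subrK => hM.
pose N := `|f (x0 + t0 *: xi0) - f x0|; rewrite -/N in hM.
pose g := N - M * t0 `^ s.
have g0 : 0 < g by rewrite subr_gt0 -ltr_pdivlMr ?powR_gt0// mulrC -powRN.
(* The two evaluation points move by at most [r] and [r + t0 r + r |xi0|], and [r <= g / C] keeps
   the resulting change of the increment within the slack [g]. *)
pose C := (L + 1) * (2 + t0 + `|xi0|).
have C1 : 0 < 2 + t0 + `|xi0| by rewrite ltr_wpDr// addr_gt0.
have C0 : 0 < C by rewrite mulr_gt0// ltr_wpDl.
pose r := Num.min (t0 / 2) (g / C).
have r0 : 0 < r by rewrite lt_min !divr_gt0.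
have rt : r <= t0 / 2 by rewrite ge_min lexx.
have rg : L * (r * (2 + t0 + `|xi0|)) <= g.
  have : r <= g / C by rewrite ge_min lexx orbT.
  rewrite ler_pdivlMr// /C mulrCA; apply: le_trans.
  by rewrite ler_wpM2r ?lerDl// mulr_ge0 ?(ltW r0)// ltW.
exists x0, t0, r; split=> // xi x t hxi hx /andP[t1 t2].
have t_gt0 : 0 < t by move: t1 rt; lra.
have h1 : `|f x0 - f x| <= L * r.
  by rewrite (le_trans (fL _ _))// ler_wpM2l// distrC.
have h2 : `|f (x0 + t0 *: xi0) - f (x + t *: xi)| <= L * (r + (t0 * r + r * `|xi0|)).
  rewrite (le_trans (fL _ _))// ler_wpM2l// distrC opprD addrACA.
  rewrite (le_trans (ler_normD _ _))// lerD//.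
  have -> : t *: xi - t0 *: xi0 = t *: (xi - xi0) + (t - t0) *: xi0.
    by rewrite scalerBr scalerBl addrA subrK.
  rewrite (le_trans (ler_normD _ _))// !normrZ lerD//.
    by rewrite (gtr0_norm t_gt0) ler_pM// ltW.
  by rewrite ler_wpM2r// distrC ger0_norm ?subr_ge0 ?(ltW t2)//; move: t1; lra.
have h3 : M * t `^ s <= M * t0 `^ s.
  by rewrite ler_wpM2l//; apply: ge0_ler_powR; rewrite ?nnegrE ?ltW.
apply: (le_trans h3).
have := ler_distD (f (x + t *: xi)) (f (x0 + t0 *: xi0)) (f x0).
have := ler_distD (f x) (f (x + t *: xi)) (f x0).
rewrite -/N [`|f x - f x0|]distrC; move: h1 h2 rg; rewrite /g.
clearbody N; lra.
Qed.

(** Only the product of [ball x0 r] and []t0 - r, t0[] is kept. There [(t ^ s) ^ p] cancels the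
    weight up to [1 / t], which is at least [1 / t0]. *)
Lemma frac_integral_ge xi x0 (M r t0 p : R) : 0 < M -> 0 < r -> r <= t0 / 2 -> 0 < p ->
  (forall x t, `|x - x0| <= r -> t0 - r < t < t0 ->
    M * t `^ s <= `|f (x + t *: xi) - f x|) ->
  ((M `^ p * (((r *+ 2) ^+ n) / t0 * r))%:E <=
   \int[lebesgue_measure]_(t in `]0%R, +oo[)
     ((t `^ (- (p * s) - 1))%:E *
      \int[lambda]_x (`|f (x + t *: xi) - f x| `^ p)%:E))%E.
Proof.
move=> M_gt0 r0 rt p0 H; have M0 := ltW M_gt0; have t0_gt0 : 0 < t0 by move: r0 rt; lra.
pose V : R := (r *+ 2) ^+ n.
have V0 : 0 < V by rewrite exprn_gt0// pmulrn_lgt0.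
pose D : set R := `]t0 - r, t0[%classic.
apply: (@le_trans _ _ (\int[lebesgue_measure]_(t in `]0%R, +oo[)
    ((M `^ p * (V / t0))%:E * (\1_D t)%:E))%E).
  rewrite nonneg_integralZl ?mulr_gt0 ?powR_gt0 ?invr_gt0// integral_indic//; last first.
    exact: measurable_itv.
  rewrite (_ : D `&` _ = D); last first.
    apply/setIidl => t; rewrite /D /= !in_itv/= andbT => /andP[h _].
    by move: h rt; lra.
  have mD : lebesgue_measure D = r%:E.
    rewrite [LHS]lebesgue_measure_itv/= lte_fin ltrBlDr ltrDl r0.
    by rewrite -EFinD opprB addrC subrK.
  by rewrite [X in (_ * X)%E]mD -EFinM mulrA.
apply: nonneg_le_integral => t; rewrite /= in_itv/= andbT => t_gt0.
  by rewrite -EFinM lee_fin !mulr_ge0// ?powR_ge0// ?invr_ge0 ltW.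
rewrite indicE; case: (boolP (t \in D)) => [/set_mem|_]; last first.
  rewrite mule0 mule_ge0 ?lee_fin ?powR_ge0//.
  by apply: integral_ge0 => x _; rewrite lee_fin powR_ge0.
rewrite /D /= in_itv/= mule1 => Dt; have [_ tt0] := andP Dt.
apply: (@le_trans _ _ ((t `^ (- (p * s) - 1))%:E *
    ((M * t `^ s) `^ p * V)%:E)%E).
  rewrite -EFinM lee_fin powRM ?powR_ge0// -powRrM.
  have -> : t `^ (- (p * s) - 1) * (M `^ p * t `^ (s * p) * V) =
      M `^ p * (V * (t `^ (- (p * s) - 1) * t `^ (s * p))) by ring.
  rewrite ler_wpM2l ?powR_ge0// ler_pM2l// -powRD; last by rewrite (gt_eqF t_gt0) implybT.
  have -> : - (p * s) - 1 + s * p = - 1 by ring.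
  by rewrite powR_inv1 ?(ltW t_gt0)// lef_pV2 ?posrE// ltW.
rewrite lee_wpmul2l ?lee_fin ?powR_ge0//.
apply: (@le_trans _ _ (\int[lambda]_x (((M * t `^ s) `^ p)%:E * (\1_(ball x0 r) x)%:E))%E).
  rewrite nonneg_integralZl ?powR_gt0 ?mulr_gt0 ?powR_gt0//.
  rewrite integral_indic//; last exact: measurable_rV_ball.
  by rewrite setIT [X in (_ * X)%E](lebesgue_rV_ball x0 r0) EFinM.
apply: nonneg_le_integral => x _.
  by rewrite -EFinM lee_fin mulr_ge0 ?powR_ge0.
rewrite indicE -EFinM lee_fin; case: (boolP (x \in _)) => [/set_mem|_]; last first.
  by rewrite mulr0 powR_ge0.
rewrite -ball_normE /= mulr1 distrC => /ltW hx; apply: ge0_ler_powR; rewrite ?nnegrE ?(ltW p0)//.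
  by rewrite mulr_ge0// powR_ge0.
exact: H.
Qed.

Hypothesis fi : lambda.-integrable setT (EFin \o f).
Hypothesis f_neq0 : f <> (fun=> 0).

Lemma frac_polar_gauge_near_ge (e : R) : 0 < e < 1 ->
  \forall p \near +oo, forall xi, unit_sphere n xi ->
    (((1 - e) * holder_slope f s xi `^ s^-1)%:E <= frac_polar_gauge f s p xi)%E.
Proof.
move=> /andP[e0 e1]; have [c c0 hc] := holder_slope_sphere_gt0 L0 fL B1 fB fi f_neq0 s01.
apply: ((compact_near_coveringP _).1 (@compact_unit_sphere R n)) => xi0 Sxi0.
pose M0 := holder_slope f s xi0; have M0_gt0 : 0 < M0 by rewrite (lt_le_trans c0)// hc.
have e'0 : 0 < 1 - e by rewrite subr_gt0.
pose rho := (1 - e) `^ s.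
have rho0 : 0 < rho by rewrite powR_gt0.
have rho1 : rho < 1.
  rewrite /rho /powR gt_eqF// -[ltRHS]expR0 ltr_expR pmulr_rlt0//.
  by apply: ln_lt0; rewrite e'0 gtrBl.
have rhop : 0 < 1 + rho by rewrite addr_gt0.
(* The solution of [rho (M0 + d) = M0 - d]. The common value [M] is below [M0], hence nearly
   attained, and is also [rho] times the bound [M0 + d] for nearby directions. The power [1 / s]
   turns [rho] into [1 - e]. *)
pose d := (1 - rho) / (1 + rho) * M0.
have d0 : 0 < d by rewrite mulr_gt0// divr_gt0// subr_gt0.
pose M := rho * (M0 + d).
have M_gt0 : 0 < M by rewrite mulr_gt0// addr_gt0.
have MM0 : M < M0.
  have -> : M = M0 - d by rewrite /M /d; field; rewrite gt_eqF.
  by rewrite gtrBl.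
have [|x0 [t0 [r [r0 rt H]]]] := @holder_slope_adherent xi0 M; first by rewrite (ltW M_gt0).
have t0_gt0 : 0 < t0 by move: r0 rt; lra.
pose kappa := ((r *+ 2) ^+ n) / t0 * r.
have kappa0 : 0 < kappa by rewrite mulr_gt0// divr_gt0// exprn_gt0// pmulrn_lgt0.
have B20 : 0 < (B + B) `^ (1 - s) by rewrite powR_gt0//; have := B1; lra.
(* By interpolation, a slope at most [d1] along [xi - xi0] makes the Hoelder slope along it at most
   [d]. *)
pose d1 := (d / (B + B) `^ (1 - s)) `^ s^-1.
have d10 : 0 < d1 by rewrite powR_gt0// divr_gt0.
have L1 : 0 < L + 1 by rewrite ltr_wpDl.
exists ([set xi | `|xi - xi0| <= r /\ L * `|xi - xi0| <= d1],
  (* The growing prefactor [p (1 - s)] eventually outweighs the constant [kappa], so no root of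
     [kappa] has to be estimated. *)
  [set p | 0 < p /\ 1 <= p * (1 - s) * kappa]).
  split => /=.
    apply/nbhs_ballP; exists (Num.min r (d1 / (L + 1))).
      by rewrite /= lt_min r0 divr_gt0.
    move=> y; rewrite -ball_normE /= lt_min distrC => /andP[/ltW y1]; split=> //.
    move: b; rewrite ltr_pdivlMr// mulrC => /ltW; apply: le_trans.
    by rewrite ler_wpM2r// lerDl.
  near=> p; split; first by near: p; exact: nbhs_pinfty_gt.
  rewrite -mulrA -ler_pdivrMr; last by apply: mulr_gt0 => //; rewrite subr_gt0.
  by near: p;  apply: nbhs_pinfty_ge; exact: num_real.
move=> [xi p] /= [[xi_r xi_d] [p0 pk]].
have ps0 : 0 < p * s by rewrite mulr_gt0.
have h1 : holder_slope f s xi <= M0 + d.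
  rewrite -[xi](subrK xi0) addrC.
  rewrite (le_trans (holder_slopeD fL B1 fB _ _ s01))// lerD2l.
  rewrite (le_trans (holder_slope_le_slope fL B1 fB _ s01))// -ler_pdivlMr//.
  have -> : d / (B + B) `^ (1 - s) = d1 `^ s.
    by rewrite /d1 -powRrM mulVf ?gt_eqF// powRr1// divr_ge0// ltW.
  apply: ge0_ler_powR; rewrite ?nnegrE ?(ltW s0) ?(ltW d10) ?(slope_ge0 fL)//.
  by rewrite (le_trans (slope_le_norm fL _)).
have h2 : (1 - e) * holder_slope f s xi `^ s^-1 <= M `^ s^-1.
  rewrite /M powRM ?(ltW rho0)//; last by rewrite addr_ge0 ?ltW.
  rewrite /rho -powRrM mulfV ?gt_eqF// powRr1 ?(ltW e'0)// ler_pM2l//.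
  apply: ge0_ler_powR; rewrite ?nnegrE ?invr_ge0 ?(ltW s0)//.
    exact: (holder_slope_ge0 fL B1 fB).
  by rewrite addr_ge0 ?ltW.
apply: (@le_trans _ _ (M `^ s^-1)%:E); first by rewrite lee_fin.
have hI := frac_integral_ge M_gt0 r0 rt p0 (fun x t => H xi x t xi_r).
rewrite /frac_polar_gauge.
apply: (@le_trans _ _ ((M `^ p)%:E `^ (p * s)^-1)%E).
  rewrite poweR_EFin -powRrM lee_fin.
  have -> // : p * (p * s)^-1 = s^-1.
  by rewrite invfM mulrA mulfV ?gt_eqF// mul1r.
have q0 : 0 <= p * (1 - s) by rewrite mulr_ge0 ?(ltW p0)// subr_ge0 ltW.
apply: gt0_ler_poweR; rewrite ?invr_ge0 ?(ltW ps0)// ?in_itv/= ?leey ?andbT.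
- by rewrite lee_fin powR_ge0.
- rewrite mule_ge0 ?lee_fin//; apply: integral_ge0 => t _.
  rewrite mule_ge0 ?lee_fin ?powR_ge0//.
  by apply: integral_ge0 => x _; rewrite lee_fin powR_ge0.
apply: (@le_trans _ _ ((p * (1 - s)) * (M `^ p * kappa))%:E).
  by rewrite lee_fin mulrCA ler_peMr ?powR_ge0.
by rewrite [leLHS]EFinM lee_wpmul2l// lee_fin.
Unshelve. all: by end_near. Qed.

Lemma limit_frac_polar_body (q : R) K :
  dual_mixed_volume q K (frac_polar_body f s p) @[p --> +oo] -->
    dual_mixed_volume q K (frac_polar_body_infty f s).
Proof.
have mf : measurable_fun setT f by case/integrableP : fi => /measurable_EFinP.
have [c c0 hc] := holder_slope_sphere_gt0 L0 fL B1 fB fi f_neq0 s01.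
have G xi := gauge_frac_polar_body_infty L0 fL fi xi s01.
apply: dual_mixed_volume_cvg => [xi Sxi|e e01].
  by rewrite G lte_fin ltry andbT powR_gt0// (lt_le_trans c0)// hc.
have [e0 e1] := andP e01.
near=> p => xi Sxi.
have p0 : 0 < p by near: p; exact: nbhs_pinfty_gt.
rewrite G (gauge_frac_polar_body mf)// -!EFinM; apply/andP; split.
  by move: xi Sxi; near: p; exact: frac_polar_gauge_near_ge.
by move: xi Sxi; near: p; exact: (frac_polar_gauge_near_le L0 fL B1 fB fi f_neq0).
Unshelve. all: by end_near. Qed.

End frac_polar_gauge_lower.

(** Existence of some weak gradient turns the chosen representative into a genuine one; its
    coordinates are dominated by its Euclidean norm. *)
Lemma sobolev1_integrable {R : realType} n (f : 'rV[R]_n -> R) : sobolev 1%E f ->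
  [/\ (@lebesgue_rV R n).-integrable setT (EFin \o f),
      is_weak_gradient f (weak_gradient f) &
      forall i, (@lebesgue_rV R n).-integrable setT
        (EFin \o (fun x => weak_gradient f x ord0 i))].
Proof.
move=> [/Lfun1_integrable fi [g fg] /Lfun1_integrable gi].
have wg : is_weak_gradient f (weak_gradient f) by apply: (xgetPex (fun=> 0)); exists g.
split=> // i; apply: (le_integrable measurableT _ _ gi).
  by apply/measurable_EFinP; case: wg.
by move=> x _; rewrite lee_fin (le_trans (coord_le_enorm _ _))// ler_norm.
Qed.

Theorem theorem4p2 (R : realType) (n : nat) (n_gt0 : (0 < n)%N)
    (f : 'rV[R]_n -> R) (K : set 'rV[R]_n) (q : R)
    (f_W11 : sobolev 1%E f) (f_W1oo : sobolev +oo%E f)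
    (f_lipschitz : lipschitz f) (f_neq0 : f <> (fun=> 0))
    (Kq : (star_body K /\ n%:R < q) \/
          [/\ star_body K, bounded_set K, q < n%:R & q != 0]) :
  [/\ forall s : R, 0 < s < 1 ->
        dual_mixed_volume q K (frac_polar_body f s p) @[p --> +oo] -->
        dual_mixed_volume q K (frac_polar_body_infty f s),
      dual_mixed_volume q K (polar_body f p) @[p --> +oo] -->
        dual_mixed_volume q K (polar_body_infty f) &
      dual_mixed_volume q K (frac_polar_body_infty f s) @[s --> 1^'-] -->
        dual_mixed_volume q K (polar_body_infty f)].
Proof.
have [fi wg gi] := sobolev1_integrable f_W11.
have [L L_gt0 fL] : exists2 L : R, 0 < L & forall x y, `|f x - f y| <= L * `|x - y|.
  have /pinfty_ex_gt0[L L0 h] := f_lipschitz; exists L => // x y.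
  exact: (h (x, y)).
have L0 := ltW L_gt0.
have [B B1 fB] := lipschitz_integrable_bounded L0 fL fi.
split=> [s s01||].
- exact: (limit_frac_polar_body L0 fL B1 fB).
- exact: (limit_polar_body L0 fL).
- exact: (limit_frac_polar_body_infty L0 fL).
Qed.
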